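(* Suppose $\alpha\in k^*$ is such that $(\alpha,0)\in(k^*\times k_{\mathbb C}^* )_{reg}$. Then $L(\alpha)$ is diffeomorphic to the product $X(\alpha,0)\times k_{\mathbb C}^*$. In particular, $X(\alpha,0)$ is homotopy equivalent to $L(\alpha)$.
   Context: Identify $\mathbb H^N$ with $\mathbb C^N\times\mathbb C^N\ni(z,w)$. $T^N=\{\zeta\in\mathbb C^N:|\zeta_i|=1\}$ acts on the right by $(z,w)\zeta=(z\zeta,w\zeta^{-1})$. Let $K\subset T^N$ be a connected subtorus with Lie algebra $k$, inclusion $\iota:k\to t^N$, dual $\iota^*:(t^N)^*\to k^*$; $k_{\mathbb C}=k\otimes\mathbb C$ and $k_{\mathbb C}^*$ is its complex dual. $\{u_i\}\subset(t^N)^*$ is dual to the standard basis of $t^N$. The hyperkähler moment map is $\mu=(\mu_1,\mu_{\mathbb C}):\mathbb H^N\to k^*\times k_{\mathbb C}^*$, $$\mu_1(z,w)=\pi\sum_i(|z_i|^2-|w_i|^2)\iota^*u_i,\qquad \mu_{\mathbb C}(z,w)=-2\pi\sqrt{-1}\sum_iz_iw_i\,\iota^*u_i,$$ and $(k^*\times k_{\mathbb C}^* )_{reg}$ is its set of regular values. Put $X(\alpha,0)=(\mu_1^{-1}(\alpha)\cap\mu_{\mathbb C}^{-1}(0))/K$ (the toric hyperkähler orbifold) and $L(\alpha)=\mu_1^{-1}(\alpha)/K$ (the symplectic quotient of $\mathbb H^N$ by $K$, a non-compact toric orbifold). In general these spaces are orbifolds, and ''diffeomorphic'' is meant in the orbifold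 sense. *)

(* Defs.v *)
From HB Require Import structures.
From mathcomp Require Import all_boot all_order all_algebra all_fingroup.
From mathcomp Require Import generic_quotient.
From mathcomp Require Import complex.
From mathcomp Require Import all_classical all_reals.
From mathcomp Require Import topology normedtype derive trigo.

Set Implicit Arguments.
Unset Strict Implicit.
Unset Printing Implicit Defensive.

Import Order.TTheory GRing.Theory Num.Theory numFieldNormedType.Exports.

Local Open Scope quotient_scope.
Local Open Scope classical_set_scope.
Local Open Scope ring_scope.

Section Smooth.
Variable R : realType.
Implicit Types E F : normedModType R.

Fixpoint Ck_on E F (k : nat) (U : set E) (f : E -> F) : Prop :=
  if k is k'.+1 then
    (forall x, U x -> differentiable f x) /\
    (forall v, Ck_on k' U (fun x => 'd f x v))
  else forall x, U x -> {for x, continuous f}.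

(* [A] need not be open: smoothness means local extension to a C^oo map of the
   ambient space. The values of [f] outside [A] are irrelevant. *)
Definition smooth_on E F (A : set E) (f : E -> F) : Prop :=
  forall x, A x -> exists (O : set E) (g : E -> F),
    [/\ open O, O x, forall k, Ck_on k O g
      & forall y, A y -> O y -> g y = f y].

Definition diffeo E F (A : set E) (B : set F) (f : E -> F) : Prop :=
  exists g : F -> E,
    [/\ smooth_on A f, smooth_on B g,
        forall x, A x -> B (f x) /\ g (f x) = x
      & forall y, B y -> A (g y) /\ f (g y) = y].

Definition local_diffeo E F (A : set E) (B : set F) (f : E -> F) : Prop :=
  forall x, A x -> exists (O : set E) (O' : set F),
    [/\ open O, O x, open O' & diffeo (A `&` O) (B `&` O') f].

Definition regular_value E F (f : E -> F) (v : F) : Prop :=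
  forall x, f x = v -> forall y, exists u, 'd f x u = y.

End Smooth.

(* A chart of an orbifold with underlying space [T], modelled on [E], is an open
   set [U] of [E], a finite group acting on [U], and a map U -> T inducing a
   homeomorphism from the orbit space of [U] onto an open subset of [T].
   The action is not required to be effective. *)
Record orbichart (R : realType) (E : normedModType R) (T : topologicalType) :=
  OrbiChart {
    oc_dom : set E;
    oc_grp : finGroupType;
    oc_act : oc_grp -> E -> E;
    oc_map : E -> T
  }.
Arguments oc_act {R E T} o _ _.

Section Orbifold.
Variable R : realType.
Implicit Types (E V : normedModType R) (T : topologicalType).

Record is_orbichart E T (c : orbichart E T) : Prop := IsOrbiChart {
  oc_dom_open : open (oc_dom c);
  oc_act_dom : forall g x, oc_dom c x -> oc_dom c (oc_act c g x);
  oc_act_smooth : forall g, smooth_on (oc_dom c) (oc_act c g);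
  oc_act1 : forall x, oc_dom c x -> oc_act c 1%g x = x;
  oc_actM : forall g h x, oc_dom c x ->
    oc_act c (g * h)%g x = oc_act c g (oc_act c h x);
  oc_map_continuous : forall x, oc_dom c x -> {for x, continuous (oc_map c)};
  oc_map_open : forall O, open O -> O `<=` oc_dom c -> open (oc_map c @` O);
  oc_map_orbit : forall x y, oc_dom c x -> oc_dom c y ->
    (oc_map c x = oc_map c y <-> exists g, y = oc_act c g x)
}.

Definition prod_orbichart E T V (c : orbichart E T) :
    orbichart (E * V)%type (T * V)%type :=
  OrbiChart (oc_dom c `*` [set: V])
    (fun (g : oc_grp c) (p : E * V) => (oc_act c g p.1, p.2))
    (fun p : E * V => (oc_map c p.1, p.2)).

Definition prod_orbiatlas E T V (A : orbichart E T -> Prop) :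
    orbichart (E * V)%type (T * V)%type -> Prop :=
  fun c' => exists2 c, A c & c' = prod_orbichart V c.

(* A homeomorphism of the underlying spaces which, around every point, lifts to
   an equivariant diffeomorphism between orbifold charts. *)
Definition orbifold_diffeomorphic E E' T T'
    (A : orbichart E T -> Prop) (A' : orbichart E' T' -> Prop) : Prop :=
  exists (f : T -> T') (f' : T' -> T),
    [/\ continuous f, continuous f', cancel f f', cancel f' f
      & forall x : T, exists (c : orbichart E T) (c' : orbichart E' T')
          (theta : oc_grp c -> oc_grp c') (l : E -> E'),
        [/\ A c /\ A' c', (oc_map c @` oc_dom c) x,
            bijective theta /\
              (forall g h, theta (g * h)%g = (theta g * theta h)%g),
            diffeo (oc_dom c) (oc_dom c') l
          & forall y, oc_dom c y ->
              (forall g, l (oc_act c g y) = oc_act c' (theta g) (l y)) /\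
              f (oc_map c y) = oc_map c' (l y)]].

End Orbifold.

Definition homotopic (R : realType) (T T' : topologicalType) (f g : T -> T') :=
  exists h : R * T -> T',
    [/\ {within `[0%R, 1%R] `*` [set: T], continuous h},
        forall x, h (0, x) = f x & forall x, h (1, x) = g x].

Definition homotopy_equivalent (R : realType) (T T' : topologicalType) :=
  exists (f : T -> T') (g : T' -> T),
    [/\ continuous f, continuous g,
        homotopic R (g \o f) id & homotopic R (f \o g) id].

(* C^N is a real normed space: the pair (real parts, imaginary parts). *)
Notation Cn R N := ('rV[R]_N * 'rV[R]_N)%type.
Notation Hn R N := (Cn R N * Cn R N)%type.

Section Torus.
Variables (R : realType) (N : nat).

Definition cpt (z : Cn R N) (i : 'I_N) : R[i] := (z.1 0 i +i* z.2 0 i)%C.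

Definition cvec (f : 'I_N -> R[i]) : Cn R N :=
  (\row_i complex.Re (f i), \row_i complex.Im (f i)).

Definition cone : Cn R N := cvec (fun=> 1).
Definition cmul (a b : Cn R N) : Cn R N := cvec (fun i => cpt a i * cpt b i).
Definition cinv (a : Cn R N) : Cn R N := cvec (fun i => (cpt a i)^-1).

Definition tact (q : Hn R N) (a : Cn R N) : Hn R N :=
  (cmul q.1 a, cmul q.2 (cinv a)).

Record subtorus := Subtorus {
  tset :> set (Cn R N);
  subtorus_unit : forall a, tset a -> forall i, `|cpt a i| = 1;
  subtorus1 : tset cone;
  subtorusM : forall a b, tset a -> tset b ->
    tset (cmul a b);
  subtorusV : forall a, tset a -> tset (cinv a);
  subtorus_closed : closed tset;
  subtorus_connected : connected tset
}.

(* t^N is identified with R^N so that the exponential has kernel Z^N; this is the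
   normalization for which [mu1] below is the moment map. *)
Definition texp (x : 'rV[R]_N) : Cn R N :=
  cvec (fun i => (cos (2 * trigo.pi * x 0 i) +i* sin (2 * trigo.pi * x 0 i))%C).

Definition lie_algebra (K : subtorus) : set 'rV[R]_N :=
  [set x | forall t : R, tset K (texp (t *: x))].

(* The rows of [B] form a basis of the Lie algebra k of [K]; in particular
   d = dim k, and k^*, k_C^* are R^d, C^d in the dual basis. *)
Definition lie_basis d (K : subtorus) (B : 'M[R]_(d, N)) : Prop :=
  row_free B /\ forall x : 'rV[R]_N, lie_algebra K x <-> (x <= B)%MS.

Lemma cpt_cvec f i : cpt (cvec f) i = f i.
Proof. by rewrite /cpt /cvec !mxE; case: (f i). Qed.

Lemma cptK (z : Cn R N) : cvec (cpt z) = z.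
Proof.
by case: z => a b; congr pair; apply/rowP => i; rewrite mxE.
Qed.

Lemma eq_cvec (f g : 'I_N -> R[i]) : f =1 g -> cvec f = cvec g.
Proof. by move=> fg; congr pair; apply/rowP => i; rewrite !mxE fg. Qed.

Lemma tact1 q : tact q cone = q.
Proof.
case: q => z w; rewrite /tact /cmul /=; congr pair;
  by rewrite -[RHS]cptK; apply: eq_cvec => i; rewrite !cpt_cvec ?invr1 mulr1.
Qed.

Lemma tactM q a b : tact (tact q a) b = tact q (cmul a b).
Proof.
rewrite /tact /cmul /=; congr pair; apply: eq_cvec => i;
  by rewrite !cpt_cvec -?mulrA // invfM.
Qed.

Lemma cmulV (K : subtorus) a : tset K a -> cmul a (cinv a) = cone.
Proof.
move=> /subtorus_unit a1; apply: eq_cvec => i.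
by rewrite cpt_cvec divff // -normr_eq0 a1 oner_eq0.
Qed.

End Torus.

Section OrbitSpace.
Variables (R : realType) (N : nat) (M : set (Hn R N)) (K : subtorus R N).

Definition orbit_relb (x y : M) : bool :=
  `[< exists2 a, tset K a & set_val y = tact (set_val x) a >].

Lemma orbit_relb_refl : reflexive orbit_relb.
Proof. by move=> x; apply/asboolP; exists (cone R N);
  [exact: subtorus1 | rewrite tact1]. Qed.

Lemma orbit_relb_sub x y : orbit_relb x y -> orbit_relb y x.
Proof.
move=> /asboolP[a Ka e]; apply/asboolP; exists (cinv a); first exact: subtorusV.
by rewrite e tactM (cmulV Ka) tact1.
Qed.

Lemma orbit_relb_sym : symmetric orbit_relb.
Proof. by move=> x y; apply/idP/idP; exact: orbit_relb_sub. Qed.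

Lemma orbit_relb_trans : transitive orbit_relb.
Proof.
move=> y x z /asboolP[a Ka ea] /asboolP[b Kb eb]; apply/asboolP.
by exists (cmul a b); [exact: subtorusM | rewrite eb ea tactM].
Qed.

Definition orbit_rel :=
  EquivRel orbit_relb orbit_relb_refl orbit_relb_sym orbit_relb_trans.

Definition orbit_space : Type := quotient_topology {eq_quot orbit_rel}%qT.

HB.instance Definition _ := Topological.on orbit_space.

Definition orbit_pi (x : M) : orbit_space :=
  (\pi_{eq_quot orbit_rel} x)%qT.

(* The charts of M / K given by slices: [j] embeds the group of the chart as a
   finite subgroup G of [K], [s] parametrizes a G-invariant slice, and
   (x, a) |-> s(x) a identifies U x_G K, as a K-manifold, with an open subset
   of [M]. *)
Definition orbit_atlas (E : normedModType R) (c : orbichart E orbit_space) :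
    Prop :=
  is_orbichart c /\
    exists (j : oc_grp c -> Cn R N) (s : E -> Hn R N),
    [/\ injective j /\ (forall g, tset K (j g)),
        forall g h, j (g * h)%g = cmul (j g) (j h),
        local_diffeo (oc_dom c `*` tset K) M
          (fun p : E * Cn R N => tact (s p.1) p.2),
        forall x y a b, oc_dom c x -> oc_dom c y -> tset K a -> tset K b ->
          (tact (s x) a = tact (s y) b <->
           exists2 g, y = oc_act c g x & a = cmul (j g) b)
      & forall x, oc_dom c x ->
          exists2 m : M, set_val m = s x & oc_map c x = orbit_pi m].

End OrbitSpace.

Section Moment.
Variables (R : realType) (N d : nat) (B : 'M[R]_(d, N)).

Definition sqmod (c : R[i]) : R := complex.Re c ^+ 2 + complex.Im c ^+ 2.

(* In the basis dual to the rows of [B], iota^* u_i has coordinates B j i. *)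
Definition mu1 (q : Hn R N) : 'rV[R]_d :=
  \row_j (trigo.pi *
    \sum_(i < N) (sqmod (cpt q.1 i) - sqmod (cpt q.2 i)) * B j i).

Definition muC (q : Hn R N) : Cn R d :=
  cvec (fun j => - (2 * trigo.pi)%:C%C * 'i%C *
    \sum_(i < N) cpt q.1 i * cpt q.2 i * (B j i)%:C%C).

Definition hk_moment (q : Hn R N) : 'rV[R]_d * Cn R d := (mu1 q, muC q).

Definition level_L (alpha : 'rV[R]_d) : set (Hn R N) :=
  [set q | mu1 q = alpha].

Definition level_X (alpha : 'rV[R]_d) (beta : Cn R d) : set (Hn R N) :=
  [set q | mu1 q = alpha /\ muC q = beta].

End Moment.

Section Quotients.
Variables (R : realType) (N d : nat) (K : subtorus R N) (B : 'M[R]_(d, N)).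

Definition L_space (alpha : 'rV[R]_d) : Type :=
  orbit_space (level_L B alpha) K.
HB.instance Definition _ alpha := Topological.on (L_space alpha).

Definition X_space (alpha : 'rV[R]_d) (beta : Cn R d) : Type :=
  orbit_space (level_X B alpha beta) K.
HB.instance Definition _ alpha beta := Topological.on (X_space alpha beta).

Definition L_atlas (alpha : 'rV[R]_d) :
    orbichart 'rV[R]_(4 * N - 2 * d) (L_space alpha) -> Prop :=
  @orbit_atlas _ _ (level_L B alpha) K _.

Definition X_atlas (alpha : 'rV[R]_d) (beta : Cn R d) :
    orbichart 'rV[R]_(4 * N - 4 * d) (X_space alpha beta) -> Prop :=
  @orbit_atlas _ _ (level_X B alpha beta) K _.

End Quotients.

Arguments L_atlas {R N d} K B alpha _.
Arguments X_atlas {R N d} K B alpha beta _.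
Arguments prod_orbiatlas {R E T} V A _.

(* Main.v *)
(* On each factor C x C = H of H^N put x = |z|^2 - |w|^2 and y = z w, so that mu_1
   is linear in the x_i and mu_C is linear in the y_i. The group SU(1,1) acts on H
   by boosts (z, w) |-> (C z + E c conj(w), C w + E c conj(z)) with
   C^2 - |c|^2 E^2 = 1; these fix x, commute with the circle action and move y.
   Choosing C and E so that y moves exactly to y + c d(x), where d >= 0 vanishes to
   infinite order at x = 0 and only there, makes the boost smooth even at the fixed
   point (0, 0), and its inverse is the boost by - c. Boosting the i-th factor by
   the i-th coordinate of a vector in the row space of B changes mu_C by a linear
   map with Gram matrix B diag(d(x_i)) B^T. Regularity of (alpha, 0) says that the
   columns of B with x_i != 0 span, so this matrix is invertible on mu_1^-1(alpha),
   and the boosts give a K-equivariant diffeomorphism of mu_1^-1(alpha) with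
   (mu_1^-1(alpha) /\ mu_C^-1(0)) x k_C^*. It carries slices to slices, hence
   descends to the orbifold quotients.

   Slices of the zero level: pick d coordinates f j with x_{f j} != 0 on which B has
   an invertible minor. The remaining coordinates u are free; the moment equations
   determine x_{f j} and y_{f j}, and K is used to make the nonzero one of z_{f j},
   w_{f j} positive. The subgroup of K fixing the coordinates f j is finite. *)

From HB Require Import structures.
From mathcomp Require Import all_boot all_order all_algebra all_fingroup.
From mathcomp Require Import generic_quotient complex.
From mathcomp Require Import all_classical all_reals.
From mathcomp Require Import topology normedtype sequences landau derive exp trigo realfun.
From mathcomp Require Import ring lra zify.
Require Import Defs.

Set Implicit Arguments.
Unset Strict Implicit.
Unset Printing Implicit Defensive.

Import Order.TTheory GRing.Theory Num.Theory numFieldNormedType.Exports.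

Local Open Scope classical_set_scope.
Local Open Scope ring_scope.

(** * Smooth maps *)

(** A map commuting with the circle fixes (0, 0), so the displacement of y must vanish there. It is
    made to depend on x alone because x is conserved: the displacement is then the same before and
    after a boost, and the boosts by c and - c cancel. Since r = |z|^2 + |w|^2 satisfies |x| <= r,
    vanishing to infinite order in x also absorbs the negative powers of r in C and E, which would
    otherwise be singular at (0, 0). These coefficients come from a Lorentzian half-angle formula:
    (r, 2 y) lies on the hyperboloid r^2 - 4 |y|^2 = x^2, a boost along c moves y parallel to c, and
    if it carries r to r' then E / C = 2 d(x) / (r + r'). The levels and K are only closed subsets
    of vector spaces, so smoothness on them is obtained by exhibiting smooth maps on open sets of
    the ambient space. Slices are constructed for the zero level only; those of mu_1^-1(alpha) are
    transported by the boosts. K is given as a closed connected group, so the finiteness of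
    stabilizers is extracted from its Lie algebra by compactness. *)

Section Calculus.
Variable R : realType.
Implicit Types E F G : normedModType R.

(** The epsilon form of differentiability serves where no chain rule applies: for maps that agree
    only near a point, and at the zeros of the flat functions. *)
Lemma is_diff_small E F (f : E -> F) (df : {linear E -> F}) (x : E) :
  continuous df ->
  (forall e : R, 0 < e -> \forall h \near 0, `|f (h + x) - f x - df h| <= e * `|h|) ->
  is_diff x f df.
Proof.
move=> dfc dfe.
have H : f \o shift x = cst (f x) + df +o_ 0 id.
  apply/eqaddoP => e e0; near=> h; rewrite /= !fctE /= /shift opprD addrA.
  by near: h; apply: dfe.
have D := diff_unique dfc H.
apply: DiffDef => //; apply/diff_locallyP; rewrite D; split=> //.
Unshelve. all: by end_near. Qed.

Lemma differentiable_small E F (f : E -> F) (x : E) :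
  differentiable f x ->
  forall e : R, 0 < e ->
    \forall h \near 0, `|f (h + x) - f x - 'd f x h| <= e * `|h|.
Proof.
move=> /diff_locallyP[_ /eqaddoP H] e e0; near=> h.
rewrite -addrA -opprD; near: h; exact: H.
Unshelve. all: by end_near. Qed.

Lemma near_eq_is_diff E F (f g : E -> F) (x : E) :
  (\forall y \near x, f y = g y) -> differentiable f x -> is_diff x g ('d f x).
Proof.
move=> fg df; apply: is_diff_small; first exact: diff_continuous.
move=> e e0; have /nbhs0P fg0 := fg; near=> h.
have <- : f (h + x) = g (h + x) by rewrite addrC; near: h; exact: fg0.
have <- : f x = g x by exact: nbhs_singleton fg.
near: h; exact: differentiable_small.
Unshelve. all: by end_near. Qed.

Lemma Ck_onS E F k (U : set E) (f : E -> F) : Ck_on k.+1 U f <->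
  (forall x, U x -> differentiable f x) /\ forall v, Ck_on k U (fun x => 'd f x v).
Proof. by []. Qed.

Lemma Ck_onW E F k (U : set E) (f : E -> F) : Ck_on k.+1 U f -> Ck_on k U f.
Proof.
elim: k f => [|k IH] f [df ddf].
  by move=> x Ux; apply/differentiable_continuous/df.
by split=> // v; apply: IH; exact: ddf.
Qed.

Lemma Ck_on_sub E F k (U V : set E) (f : E -> F) :
  U `<=` V -> Ck_on k V f -> Ck_on k U f.
Proof.
move=> UV; elim: k f => [|k IH] f; first by move=> H x /UV/H.
by move=> /Ck_onS[df ddf]; apply/Ck_onS; split=> [x /UV/df//|v]; exact: IH.
Qed.

Lemma Ck_on_ext E F k (U : set E) (f g : E -> F) : open U ->
  {in U, f =1 g} -> Ck_on k U f -> Ck_on k U g.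
Proof.
move=> oU; elim: k f g => [|k IH] f g fg.
  move=> H x Ux; have Hx : f @ x --> f x by exact: H.
  have nfg : \forall y \near x, f y = g y.
    by apply: filterS (open_nbhs_nbhs (conj oU Ux)) => y Uy; apply: fg; rewrite inE.
  suff: g @ x --> g x by []; rewrite -(nbhs_singleton nfg); apply: cvg_trans Hx.
  exact: near_eq_cvg.
move=> /Ck_onS[df ddf].
have nfg x : U x -> \forall y \near x, f y = g y.
  by move=> Ux; apply: filterS (open_nbhs_nbhs (conj oU Ux)) => y Uy; apply: fg; rewrite inE.
have dg x (Ux : U x) := near_eq_is_diff (nfg x Ux) (df x Ux).
apply/Ck_onS; split=> [x Ux|v]; first by have [] := dg x Ux.
refine (IH _ _ _ (ddf v)) => x; rewrite inE => Ux.
have [_ e] := dg x Ux; exact/esym/(congr1 (fun u => u v) e).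
Qed.

(** The inductive step of the closure properties: a formula valid on [U] may replace ['d f], and it
    is enough that this formula is C^k in the point for each fixed direction. *)
Lemma Ck_on_step E F k (U : set E) (f : E -> F) (df : E -> E -> F) : open U ->
  (forall x, U x -> is_diff x f (df x)) ->
  (forall v, Ck_on k U (df ^~ v)) -> Ck_on k.+1 U f.
Proof.
move=> oU fdf ddf; apply/Ck_onS; split=> [x Ux|v]; first by have [] := fdf x Ux.
apply: Ck_on_ext (ddf v) => // x; rewrite inE => Ux.
by have [_ ->] := fdf x Ux.
Qed.

Lemma Ck_on_cst E F k (U : set E) (c : F) : Ck_on k U (fun=> c).
Proof.
elim: k c => [|k IH] c; first by move=> x _; exact: cst_continuous.
apply/Ck_onS; split=> [x _|v]; first exact: differentiable_cst.
have -> : (fun x => 'd (fun=> c) x v) = (fun=> 0 : F).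
  by apply/funext=> x; rewrite (@diff_cst _ _ _ c).
exact: IH.
Qed.

Lemma Ck_on_lin E F k (U : set E) (f : {linear E -> F}) :
  continuous f -> Ck_on k U f.
Proof.
case: k => [|k] fc; first by move=> x _; exact: fc.
apply/Ck_onS; split=> [x _|v]; first exact: linear_differentiable.
have -> : (fun x => 'd f x v) = (fun=> f v).
  by apply/funext=> x; rewrite diff_lin.
exact: Ck_on_cst.
Qed.

Lemma Ck_onD E F k (U : set E) (f g : E -> F) : open U ->
  Ck_on k U f -> Ck_on k U g -> Ck_on k U (fun x => f x + g x).
Proof.
move=> oU; elim: k f g => [|k IH] f g.
  by move=> fc gc x Ux; apply: continuousD; [exact: fc|exact: gc].
move=> /Ck_onS[df ddf] /Ck_onS[dg ddg].
apply: (@Ck_on_step _ _ _ _ _ (fun x v => 'd f x v + 'd g x v)) => //.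
  move=> x Ux; apply: is_diffD; apply: differentiableP; [exact: df|exact: dg].
by move=> v; apply: (IH (fun x => 'd f x v) (fun x => 'd g x v)).
Qed.

Lemma Ck_on_sum E F k (U : set E) (I : Type) (s : seq I) (P : pred I) (f : I -> E -> F) :
  open U -> (forall i, Ck_on k U (f i)) ->
  Ck_on k U (fun x => \sum_(i <- s | P i) f i x).
Proof.
move=> oU H; elim: s => [|i s IH].
  apply: Ck_on_ext (@Ck_on_cst E F k U 0) => // x _; by rewrite big_nil.
case Pi : (P i).
  apply: Ck_on_ext (Ck_onD oU (H i) IH) => // x _; by rewrite big_cons Pi.
by apply: Ck_on_ext IH => // x _; rewrite big_cons Pi.
Qed.

Lemma scale_is_bilinear F : bilinear_for
  (GRing.Scale.Law.clone R F *:%R _) (GRing.Scale.Law.clone R F *:%R _)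
  (@GRing.scale R F : R -> F -> F).
Proof.
split=> [u'|u] a x y /=; first by rewrite scalerDl scalerA.
by rewrite scalerDr !scalerA mulrC.
Qed.

HB.instance Definition _ F := bilinear_isBilinear.Build R R F F _ _
  (@GRing.scale R F : R -> F -> F) (@scale_is_bilinear F).

Lemma is_diff_scale E F (f : E -> F) (a : E -> R) (x : E) :
  differentiable a x -> differentiable f x ->
  is_diff x (fun y => a y *: f y) (fun v => a x *: 'd f x v + 'd a x v *: f x).
Proof.
move=> da df.
have sc : continuous (fun p : R * F => p.1 *: p.2) by exact: scale_continuous.
have h (p : R * F) : is_diff p (fun p : R * F => p.1 *: p.2)
    (fun q => p.1 *: q.2 + q.1 *: p.2).
  apply: DiffDef; first exact: (@differentiable_bilin _ _ _ _ (@GRing.scale R F)).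
  exact: (@diff_bilin _ _ _ _ (@GRing.scale R F)).
have h2 := is_diff_pair (differentiableP da) (differentiableP df).
exact: (is_diff_comp h2 (h (a x, f x))).
Qed.

Lemma Ck_on_scale E F k (U : set E) (a : E -> R) (f : E -> F) : open U ->
  Ck_on k U a -> Ck_on k U f -> Ck_on k U (fun x => a x *: f x).
Proof.
move=> oU; elim: k a f => [|k IH] a f.
  by move=> ac fc x Ux; apply: continuousZ; [exact: ac|exact: fc].
move=> Ca Cf; have /Ck_onS[da dda] := Ca; have /Ck_onS[df ddf] := Cf.
apply: (@Ck_on_step _ _ _ _ _
  (fun x v => a x *: 'd f x v + 'd a x v *: f x)) => //.
  by move=> x Ux; apply: is_diff_scale; [exact: da|exact: df].
move=> v; apply: Ck_onD => //; first by apply: (IH a (fun x => 'd f x v)) => //; exact: Ck_onW.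
by apply: (IH (fun x => 'd a x v) f) => //; exact: Ck_onW.
Qed.

Lemma Ck_on_linl E F G k (U : set E) (f : E -> F) (L : {linear F -> G}) : open U ->
  continuous L -> Ck_on k U f -> Ck_on k U (fun x => L (f x)).
Proof.
move=> oU Lc; elim: k f => [|k IH] f.
  by move=> fc x Ux; apply: continuous_comp; [exact: fc|exact: Lc].
move=> /Ck_onS[df ddf]; apply: (@Ck_on_step _ _ _ _ _ (fun x v => L ('d f x v))) => //.
  move=> x Ux; apply: is_diff_comp; first exact/differentiableP/df.
  by apply: DiffDef; [exact: linear_differentiable|exact: diff_lin].
by move=> v; apply: (IH (fun x => 'd f x v)).
Qed.

(* For [F] of finite dimension, in the form needed by the chain rule for [Ck_on]. *)
Definition findim F := exists n (l : 'I_n -> {linear F -> R}) (e : 'I_n -> F),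
  (forall i, continuous (l i)) /\ forall y, y = \sum_i l i y *: e i.

(** In the derivative of the composite, the direction ['d f x v] fed to ['d g] varies with [x],
    while [Ck_on] speaks of fixed directions. Expanding it along the vectors [e i] leaves a finite
    sum of scalar multiples of derivatives in fixed directions. *)
Lemma Ck_on_comp E F G k (U : set E) (V : set F) (f : E -> F) (g : F -> G) :
  findim F -> open U -> open V -> {homo f : x / U x >-> V x} ->
  Ck_on k U f -> Ck_on k V g -> Ck_on k U (fun x => g (f x)).
Proof.
move=> [n [l [e [lc le]]]] oU oV UV; elim: k g => [|k IH] g.
  by move=> fc gc x Ux; apply: continuous_comp; [exact: fc|exact/gc/UV].
move=> Cf /Ck_onS[dg ddg]; have /Ck_onS[df ddf] := Cf.
apply: (@Ck_on_step _ _ _ _ _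
  (fun x v => \sum_i l i ('d f x v) *: 'd g (f x) (e i))) => //.
  move=> x Ux; have := is_diff_comp (differentiableP (df x Ux)) (differentiableP (dg _ (UV _ Ux))).
  move/is_diff_eq; apply; apply/funext => v /=.
  by rewrite {1}[_ v]le linear_sum; apply: eq_bigr => i _; rewrite linearZ.
move=> v; apply: Ck_on_sum => // i; apply: Ck_on_scale => //.
  by apply: (Ck_on_linl (L := l i)) => //; exact: ddf.
by apply: (IH (fun x => 'd g x (e i))); [exact: Ck_onW|exact: ddg].
Qed.

Lemma findimR : findim R.
Proof.
exists 1%N, (fun=> idfun), (fun=> 1); split=> [_ x|y]; first exact: cvg_id.
by rewrite big_ord1 /= [_ *: _]mulr1.
Qed.

Lemma Ck_on_real k (U : set R) (f df : R -> R) : open U ->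
  (forall x, U x -> is_derive x 1 f (df x)) -> Ck_on k U df -> Ck_on k.+1 U f.
Proof.
move=> oU fdf Cdf; apply: (@Ck_on_step _ _ _ _ _ (fun x v => df x *: v)) => //.
  move=> x Ux; have [h1 h2] := fdf x Ux.
  apply: DiffDef; first exact/derivable1_diffP.
  by rewrite (deriv1E h1) derive1E h2; apply/funext => v; rewrite [LHS]mulrC.
by move=> v; apply: Ck_on_scale => //; exact: Ck_on_cst.
Qed.

Definition Cinf_on E F (U : set E) (f : E -> F) := forall k, Ck_on k U f.

Lemma Cinf_on_comp1 E (U : set E) (V : set R) (phi : R -> R) (f : E -> R) :
  open U -> open V -> Cinf_on V phi -> Cinf_on U f ->
  {homo f : x / U x >-> V x} -> Cinf_on U (fun x => phi (f x)).
Proof.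
by move=> oU oV hp hf UV k; apply: (@Ck_on_comp _ _ _ k U V) => //; exact: findimR.
Qed.

Lemma Cinf_onM E (U : set E) (f g : E -> R) : open U ->
  Cinf_on U f -> Cinf_on U g -> Cinf_on U (fun x => f x * g x).
Proof. by move=> oU hf hg k; exact: (Ck_on_scale oU (hf k) (hg k)). Qed.

Lemma Cinf_onD E F (U : set E) (f g : E -> F) : open U ->
  Cinf_on U f -> Cinf_on U g -> Cinf_on U (fun x => f x + g x).
Proof. by move=> oU hf hg k; exact: Ck_onD. Qed.

Lemma Cinf_onN E F (U : set E) (f : E -> F) : open U ->
  Cinf_on U f -> Cinf_on U (fun x => - f x).
Proof.
move=> oU hf k; apply: Ck_on_ext (Ck_on_scale oU (Ck_on_cst k U (-1 : R)) (hf k)) => //.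
by move=> x _; rewrite scaleN1r.
Qed.

Lemma Cinf_onB E F (U : set E) (f g : E -> F) : open U ->
  Cinf_on U f -> Cinf_on U g -> Cinf_on U (fun x => f x - g x).
Proof. by move=> oU hf hg; apply: Cinf_onD => //; exact: Cinf_onN. Qed.

Lemma Cinf_on_cst E F (U : set E) (c : F) : Cinf_on U (fun=> c).
Proof. by move=> k; exact: Ck_on_cst. Qed.

Lemma Cinf_on_id E (U : set E) : Cinf_on U id.
Proof. by move=> k; apply: (@Ck_on_lin _ _ _ _ idfun) => x; exact: cvg_id. Qed.

Lemma Cinf_onX E (U : set E) (f : E -> R) n : open U ->
  Cinf_on U f -> Cinf_on U (fun x => f x ^+ n).
Proof.
move=> oU hf; elim: n => [|n IH]; first exact: Cinf_on_cst.
under eq_fun do rewrite exprS; exact: Cinf_onM.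
Qed.

Lemma Cinf_on_sum E F (U : set E) (I : Type) (s : seq I) (P : pred I) (f : I -> E -> F) :
  open U -> (forall i, Cinf_on U (f i)) ->
  Cinf_on U (fun x => \sum_(i <- s | P i) f i x).
Proof. by move=> oU hf k; apply: Ck_on_sum => // i; exact: hf. Qed.

Lemma Cinf_on_prod E (U : set E) (I : Type) (s : seq I) (P : pred I) (f : I -> E -> R) :
  open U -> (forall i, Cinf_on U (f i)) ->
  Cinf_on U (fun x => \prod_(i <- s | P i) f i x).
Proof.
move=> oU hf; elim: s => [|i s IH].
  by under eq_fun do rewrite big_nil; exact: Cinf_on_cst.
under eq_fun do rewrite big_cons; case: (P i) => //; exact: Cinf_onM.
Qed.

Lemma Cinf_onV E (U : set E) (f : E -> R) : open U -> Cinf_on U f ->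
  (forall x, U x -> f x != 0) -> Cinf_on U (fun x => (f x)^-1).
Proof.
move=> oU hf f0.
have oV : open [set x : R | x != 0] by exact: open_neq.
apply: (@Cinf_on_comp1 _ _ [set x | x != 0] GRing.inv) => //; elim=> [|k IH].
  by move=> x x0; exact: inv_continuous.
(* The derivative is a product of copies of the function itself, so regularity bootstraps. *)
apply: (@Ck_on_real _ _ _ (fun x => -1 *: (x^-1 *: x^-1))) => //.
  move=> x x0; have := @is_deriveV R id x 1 1 x0 (is_derive_id x 1).
  move/is_derive_eq; apply.
  by rewrite /GRing.scale /= mulr1 mulN1r expr2 invfM.
apply: Ck_on_scale => //; first exact: Ck_on_cst.
exact: Ck_on_scale.
Qed.

Lemma Cinf_on_sqrt E (U : set E) (f : E -> R) : open U -> Cinf_on U f ->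
  (forall x, U x -> 0 < f x) -> Cinf_on U (fun x => Num.sqrt (f x)).
Proof.
move=> oU hf f0.
have oV : open [set x : R | 0 < x] by exact: open_gt.
apply: (@Cinf_on_comp1 _ _ [set x | 0 < x] Num.sqrt) => //; elim=> [|k IH].
  by move=> x x0; exact: sqrt_continuous.
apply: (@Ck_on_real _ _ _ (fun x => (2 * Num.sqrt x)^-1)) => //.
have h : Ck_on k [set x : R | 0 < x] (fun x => 2 * Num.sqrt x).
  by apply: (Ck_on_scale (F := R)) => //; exact: Ck_on_cst.
have oW : open [set x : R | x != 0] by exact: open_neq.
apply: (@Ck_on_comp _ _ _ k _ [set x : R | x != 0] _ GRing.inv) => //.
- exact: findimR.
- by move=> x x0 /=; rewrite mulf_neq0 ?pnatr_eq0// sqrtr_eq0 -ltNge.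
- by apply: (@Cinf_onV R _ id) => //; exact: Cinf_on_id.
Qed.

Lemma Cinf_on_trig : Cinf_on setT (@cos R) /\ Cinf_on setT (@sin R).
Proof.
have oT : open (setT : set R) by exact: openT.
suff h k : Ck_on k setT (@cos R) /\ Ck_on k setT (@sin R).
  by split=> k; case: (h k).
elim: k => [|k [IHc IHs]].
  by split=> x _; [exact: continuous_cos|exact: continuous_sin].
split; last first.
  by apply: (@Ck_on_real _ _ _ cos) => // x _; exact: is_derive_sin.
apply: (@Ck_on_real _ _ _ (fun x => -1 *: sin x)) => //.
  by move=> x _; rewrite scaleN1r; exact: is_derive_cos.
by apply: Ck_on_scale => //; exact: Ck_on_cst.
Qed.

Lemma Cinf_on_cos E (U : set E) (f : E -> R) : open U -> Cinf_on U f ->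
  Cinf_on U (fun x => cos (f x)).
Proof.
move=> oU hf; apply: (@Cinf_on_comp1 _ _ setT) => //; first exact: openT.
by case: Cinf_on_trig.
Qed.

Lemma Cinf_on_sin E (U : set E) (f : E -> R) : open U -> Cinf_on U f ->
  Cinf_on U (fun x => sin (f x)).
Proof.
move=> oU hf; apply: (@Cinf_on_comp1 _ _ setT) => //; first exact: openT.
by case: Cinf_on_trig.
Qed.

Lemma Cinf_on_atan E (U : set E) (f : E -> R) : open U -> Cinf_on U f ->
  Cinf_on U (fun x => atan (f x)).
Proof.
move=> oU hf; have oT : open (setT : set R) by exact: openT.
apply: (@Cinf_on_comp1 _ _ setT) => //; case=> [|k].
  by move=> x _; exact: continuous_atan.
apply: (@Ck_on_real _ _ _ (fun x => (1 + x ^+ 2)^-1)) => //.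
apply: (Cinf_onV (f := fun x : R => 1 + x ^+ 2)) => //.
  apply: Cinf_onD => //; first exact: Cinf_on_cst.
  by apply: Cinf_onX => //; exact: Cinf_on_id.
by move=> x _; rewrite gt_eqF// ltr_pwDl// sqr_ge0.
Qed.

Lemma Cinf_on_linl E F G (U : set E) (f : E -> F) (L : {linear F -> G}) : open U ->
  continuous L -> Cinf_on U f -> Cinf_on U (fun x => L (f x)).
Proof. by move=> oU Lc hf k; exact: Ck_on_linl. Qed.

Lemma Cinf_on_pair E F G (U : set E) (f : E -> F) (g : E -> G) : open U ->
  Cinf_on U f -> Cinf_on U g -> Cinf_on U (fun x => (f x, g x)).
Proof.
move=> oU + + k => /(_ k) + /(_ k); move: f g.
elim: k => [|k IH] f g.
  by move=> hf hg x Ux; apply: cvg_pair; [exact: hf|exact: hg].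
move=> /Ck_onS[df ddf] /Ck_onS[dg ddg].
apply: (@Ck_on_step _ _ _ _ _ (fun x v => ('d f x v, 'd g x v))) => //.
  by move=> x Ux; apply: is_diff_pair; apply: differentiableP; [exact: df|exact: dg].
by move=> v; apply: (IH (fun x => 'd f x v) (fun x => 'd g x v)).
Qed.

Lemma Cinf_on_fst E F G (U : set E) (f : E -> F * G) : open U ->
  Cinf_on U f -> Cinf_on U (fun x => (f x).1).
Proof.
by move=> oU hf; apply: (Cinf_on_linl (L := fst)) => // x; exact: cvg_fst.
Qed.

Lemma Cinf_on_snd E F G (U : set E) (f : E -> F * G) : open U ->
  Cinf_on U f -> Cinf_on U (fun x => (f x).2).
Proof.
by move=> oU hf; apply: (Cinf_on_linl (L := snd)) => // x; exact: cvg_snd.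
Qed.

Definition mxcoord m n i j (M : 'M[R]_(m, n)) : R := M i j.

Fact mxcoord_is_linear m n i j : linear (@mxcoord m n i j).
Proof. by move=> a u v; rewrite /mxcoord !mxE. Qed.

HB.instance Definition _ m n i j :=
  GRing.isLinear.Build R _ _ _ (@mxcoord m n i j) (mxcoord_is_linear i j).

Lemma Cinf_on_coord E m n (U : set E) (f : E -> 'M[R]_(m, n)) i j : open U ->
  Cinf_on U f -> Cinf_on U (fun x => f x i j).
Proof.
move=> oU hf; apply: (Cinf_on_linl (L := mxcoord i j)) => //.
exact: coord_continuous.
Qed.

Lemma Cinf_on_matrix E m n (U : set E) (f : 'I_m -> 'I_n -> E -> R) : open U ->
  (forall i j, Cinf_on U (f i j)) -> Cinf_on U (fun x => \matrix_(i, j) f i j x).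
Proof.
move=> oU hf k.
apply: (@Ck_on_ext _ _ _ _ (fun x => \sum_i \sum_j f i j x *: delta_mx i j)) => //.
  by move=> x _; rewrite [RHS]matrix_sum_delta; do 2! apply: eq_bigr => ? _; rewrite mxE.
apply: Ck_on_sum => // i; apply: Ck_on_sum => // j.
by apply: Ck_on_scale => //; [exact: hf|exact: Ck_on_cst].
Qed.

Lemma findim_sum F (I : finType) (l : I -> {linear F -> R}) (e : I -> F) :
  (forall i, continuous (l i)) -> (forall y, y = \sum_i l i y *: e i) -> findim F.
Proof.
move=> lc le; exists #|I|, (fun i => l (enum_val i)), (fun i => e (enum_val i)).
split=> [i|y]; first exact: lc.
by rewrite {1}[y]le (reindex_onto enum_val enum_rank)/=; [apply: eq_bigl => i; rewrite enum_valK eqxx|move=> i _; rewrite enum_rankK].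
Qed.

Lemma findim_mx m n : findim 'M[R]_(m, n).
Proof.
apply: (@findim_sum _ ('I_m * 'I_n)%type (fun p => mxcoord p.1 p.2)
  (fun p => delta_mx p.1 p.2)) => [p|y]; first exact: coord_continuous.
by rewrite {1}[y]matrix_sum_delta pair_bigA.
Qed.

Lemma findim_prod F G : findim F -> findim G -> findim (F * G)%type.
Proof.
move=> [n [l [e [lc le]]]] [n' [l' [e' [lc' le']]]].
apply: (@findim_sum _ ('I_n + 'I_n')%type
  (fun s => match s with inl i => (l i \o fst : {linear (F * G)%type -> R})
                       | inr j => (l' j \o snd : {linear (F * G)%type -> R}) end)
  (fun s => match s with inl i => (e i, 0) | inr j => (0, e' j) end)) => [[i|j]|[y z]].
- by move=> p; apply: continuous_comp; [exact: cvg_fst|exact: lc].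
- by move=> p; apply: continuous_comp; [exact: cvg_snd|exact: lc'].
rewrite big_sumType; apply: injective_projections.
  rewrite raddfD /= !raddf_sum /= [X in _ + X]big1 ?addr0.
    by rewrite {1}[y]le; apply: eq_bigr.
  by move=> j _ /=; rewrite scaler0.
rewrite raddfD /= !raddf_sum /= [X in X + _]big1 ?add0r.
  by rewrite {1}[z]le'; apply: eq_bigr.
by move=> j _ /=; rewrite scaler0.
Qed.

Lemma Cinf_on_comp E F G (U : set E) (V : set F) (f : E -> F) (g : F -> G) :
  findim F -> open U -> open V -> {homo f : x / U x >-> V x} ->
  Cinf_on U f -> Cinf_on V g -> Cinf_on U (fun x => g (f x)).
Proof. by move=> hF oU oV UV hf hg k; exact: (Ck_on_comp hF oU oV UV (hf k) (hg k)). Qed.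

End Calculus.

(** * Flat functions and boosts *)

Section Flat.
Variable R : realType.

Lemma is_diff_mul (E : normedModType R) (f g : E -> R) (df dg : E -> R) q :
  is_diff q f df -> is_diff q g dg ->
  is_diff q (fun y => f y * g y) (fun v => f q * dg v + g q * df v).
Proof. by move=> hf hg; exact: (is_diffM hf hg). Qed.

Lemma is_diffVX (E : normedModType R) (f df : E -> R) k q :
  is_diff q f df -> f q != 0 ->
  is_diff q (fun y => (f y)^-1 ^+ k) (fun v => - (k%:R * (f q)^-1 ^+ k.+1 * df v)).
Proof.
move=> [hf edf] f0; elim: k => [|k IH].
  apply: (is_diff_eq (is_diff_cst (1 : R) q)).
  by apply/funext => v; rewrite !mul0r oppr0.
have hV : is_diff q (fun y => (f y)^-1) (fun v => - (f q) ^- 2 * df v).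
  by apply: DiffDef; [exact: differentiableV|rewrite diffV// edf].
have -> : (fun y => (f y)^-1 ^+ k.+1) = (fun y => (f y)^-1 * (f y)^-1 ^+ k).
  by apply/funext => y; rewrite exprS.
apply: (is_diff_eq (is_diff_mul hV IH)); apply/funext => v.
by rewrite -exprVn -natr1 !exprS; ring.
Qed.

Lemma is_diff_exp (E : normedModType R) (f df : E -> R) q :
  is_diff q f df -> is_diff q (fun y => expR (f y)) (fun v => expR (f q) * df v).
Proof.
move=> hf; have [h1 h2] := is_derive_expR (f q).
have he : is_diff (f q) expR (fun v => expR (f q) * v).
  apply: DiffDef; first exact/derivable1_diffP.
  by rewrite (deriv1E h1) derive1E h2; apply/funext => v; rewrite [LHS]mulrC.
exact: (is_diff_comp hf he).
Qed.

(* This family is closed under differentiation; for [m > 0] the junk value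
   [0^-1 = 0] makes it vanish at [x = 0], as it should. *)
Definition flat m n (x r : R) : R := expR (- x^-1 ^+ 2) * x^-1 ^+ m * r^-1 ^+ n.

(** For t > 1 a single term of the exponential series at t^2, the one of index k + 1, already
    dominates t^k; for t <= 1 both factors are at most 1. *)
Lemma expR_pow_le (t : R) k : 0 <= t -> expR (- t ^+ 2) * t ^+ k <= k.+1`!%:R.
Proof.
move=> t0; rewrite expRN mulrC ler_pdivrMr ?expR_gt0//.
have f1 : 1 <= k.+1`!%:R :> R by rewrite ler1n fact_gt0.
have [t1|t1] := leP t 1.
  apply: (@le_trans _ _ 1); first exact: exprn_ile1.
  by rewrite -[leLHS]mulr1 ler_pM// -[leLHS]expR0 ler_expR sqr_ge0.
have := expR_ge1Dxn k (sqr_ge0 t).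
move=> /(le_trans (ler_wpDl ler01 (lexx _))).
rewrite ler_pdivrMr ?ltr0n ?fact_gt0// mulrC; apply: le_trans.
by rewrite -exprM ler_weXn2l ?(ltW t1)// (leq_trans (leqnSn k)) ?leq_pmull.
Qed.

(** Since |x| <= r, each [r^-1] costs at most one more [|x|^-1], and the exponential absorbs them
    all. One further power is absorbed to leave the factor [|x|] on the right, whence the factorial
    of m + n + 3. *)
Lemma flat_le m n (x r : R) : `|x| <= r ->
  `|flat m.+1 n x r| <= (m + n).+3`!%:R * `|x|.
Proof.
move=> xr; have [->|x0] := eqVneq x 0.
  by rewrite /flat invr0 [0 ^+ m.+1]exprS mul0r mulr0 mul0r !normr0 mulr0.
have x1 : 0 < `|x| by rewrite normr_gt0.
have r0 : 0 < r by exact: lt_le_trans xr.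
rewrite /flat !normrM !normrX !normfV (gtr0_norm r0).
rewrite -ler_pdivrMr//; apply: le_trans (@expR_pow_le `|x|^-1 (m + n).+2 _); last by rewrite invr_ge0.
have -> : `|expR (- x^-1 ^+ 2)| = expR (- `|x|^-1 ^+ 2).
  by rewrite gtr0_norm ?expR_gt0// -normfV real_normK ?num_real.
rewrite -2!mulrA ler_pM2l ?expR_gt0// [leRHS](_ : _ = `|x|^-1 ^+ m.+1 * (`|x|^-1 ^+ n * `|x|^-1)); last first.
  by rewrite -exprSr -exprD addSn addnS.
rewrite -mulrA ler_wpM2l ?exprn_ge0 ?invr_ge0// ler_wpM2r ?invr_ge0//.
by rewrite lerXn2r ?nnegrE ?invr_ge0 ?(ltW r0)// lef_pV2.
Qed.

Variables (E : normedModType R) (U : set E) (x r : E -> R).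
Hypotheses (oU : open U) (Cx : Cinf_on U x) (Cr : Cinf_on U r).
Hypothesis xr : forall q, U q -> `|x q| <= r q.

Let fl m n q := flat m n (x q) (r q).

Let dfl m n q v :=
  (2 *: fl m.+4 n q - m.+1%:R *: fl m.+2 n q) *: 'd x q v
  - n%:R *: (fl m.+1 n.+1 q *: 'd r q v).

Lemma is_diff_flat m n q : U q -> is_diff q (fl m.+1 n) (dfl m n q).
Proof.
move=> Uq.
have dx : differentiable x q by have /Ck_onS[+ _] := Cx 1%N; exact.
have dr : differentiable r q by have /Ck_onS[+ _] := Cr 1%N; exact.
(* At a zero of [x] the formula for the differential gives 0. There [fl] is [x] times the next flat
   function, hence O(|x|^2), and [x] grows at most linearly in the increment. *)
have [x0|x0] := eqVneq (x q) 0.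
  have fl0 k l : fl k.+1 l q = 0.
    by rewrite /fl /flat x0 invr0 [0 ^+ k.+1]exprS mul0r mulr0 mul0r.
  have -> : dfl m n q = (\0 : {linear E -> R}).
    by apply/funext => v; rewrite /dfl !fl0 !scaler0 subr0 !scale0r scaler0 subr0.
  apply: is_diff_small => [|e e0]; first exact: cst_continuous.
  have /linear_lipschitz[K K0 HK] := diff_continuous dx.
  pose C : R := (m.+1 + n).+3`!%:R; have C0 : 0 < C by rewrite ltr0n fact_gt0.
  have dx1 := differentiable_small dx ltr01.
  have U0 : \forall h \near 0, U (h + q).
    have /nbhs0P := open_nbhs_nbhs (conj oU Uq).
    by apply: filterS => h; rewrite addrC.
  (* With |x| <= (K + 1) |h| and |fl| <= C |x|^2, this bound on |h| gives |fl| <= e |h|. The 1 in K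
     + 1 is the error granted to the linear approximation of [x]. *)
  have h0 : \forall h \near (0 : E), `|h| < e / (C * (K + 1) ^+ 2).
    apply/nbhs0_lt; rewrite divr_gt0// mulr_gt0// exprn_gt0// addr_gt0//.
  near=> h.
  have hx : `|x (h + q)| <= (K + 1) * `|h|.
    have : `|x (h + q) - x q - 'd x q h| <= 1 * `|h| by near: h; exact: dx1.
    rewrite x0 subr0 mulrDl mul1r => /(le_trans (lerB_dist _ _)).
    by rewrite lerBlDl => /le_trans; apply; rewrite lerD2r.
  have hr : `|x (h + q)| <= r (h + q) by apply: xr; near: h; exact: U0.
  rewrite fl0 subr0 /= subr0.
  have -> : fl m.+1 n (h + q) = x (h + q) * fl m.+2 n (h + q).
    rewrite /fl /flat; have [->|y0] := eqVneq (x (h + q)) 0.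
      by rewrite invr0 [0 ^+ m.+1]exprS !mul0r mulr0 mul0r.
    by rewrite [_ ^+ m.+2]exprS; field.
  rewrite normrM; apply: le_trans (ler_wpM2l (normr_ge0 _) (flat_le _ _ hr)) _.
  rewrite -/C mulrCA.
  apply: (@le_trans _ _ (C * (((K + 1) * `|h|) * ((K + 1) * `|h|)))).
    by rewrite ler_wpM2l ?(ltW C0)// ler_pM.
  rewrite (_ : _ * _ = (C * (K + 1) ^+ 2 * `|h|) * `|h|); last by ring.
  rewrite ler_wpM2r// mulrC -ler_pdivlMr; first by apply/ltW; near: h.
  by rewrite mulr_gt0// exprn_gt0// addr_gt0.
have r0 : r q != 0 by rewrite gt_eqF// (lt_le_trans _ (xr Uq))// normr_gt0.
have hx := differentiableP dx; have hr := differentiableP dr.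
have h := is_diff_mul (is_diff_mul (is_diff_exp (is_diffN (is_diffVX 2 hx x0))) (is_diffVX m.+1 hx x0))
  (is_diffVX n hr r0).
apply: (is_diff_eq h); apply/funext => v.
rewrite /dfl /fl /flat /GRing.scale /= !fctE.
move: (x q)^-1 (r q)^-1 ('d x q v : R) ('d r q v : R) (expR (- (x q)^-1 ^+ 2)) => X S a b e.
by rewrite !exprS; ring.
Unshelve. all: by end_near. Qed.

Lemma Cinf_on_flat m n : Cinf_on U (fl m.+1 n).
Proof.
move=> k; elim: k m n => [|k IH] m n.
  by move=> q Uq; apply/differentiable_continuous; have [] := is_diff_flat m n Uq.
have Dx v : Ck_on k U (fun q => 'd x q v) by have /Ck_onS[_] := Cx k.+1; exact.
have Dr v : Ck_on k U (fun q => 'd r q v) by have /Ck_onS[_] := Cr k.+1; exact.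
apply: (Ck_on_step oU (@is_diff_flat m n)) => v.
have C c f : Ck_on k U f -> Ck_on k U (fun q => c *: f q : R).
  by move=> Cf; apply: Ck_on_scale => //; exact: Ck_on_cst.
apply: Ck_onD => //; first apply: Ck_on_scale => //.
  apply: Ck_onD => //; first exact: C (IH _ _).
  apply: (@Ck_on_ext _ _ _ _ _ (fun q => - m.+1%:R *: fl m.+2 n q)) => //.
    by move=> q _; rewrite scaleNr.
  exact: C (IH _ _).
apply: (@Ck_on_ext _ _ _ _ _ (fun q => - n%:R *: (fl m.+1 n.+1 q *: 'd r q v))) => //.
  by move=> q _; rewrite scaleNr.
by apply: C; apply: Ck_on_scale => //; exact: IH.
Qed.

End Flat.

(** * Boosts on one quaternionic factor *)

Section Boost.
Variable R : realType.

(* [flat 2 0]: the function d of the header. *)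
Definition bump (x : R) : R := expR (- x^-1 ^+ 2) * x^-1 ^+ 2.

Lemma bump0 : bump 0 = 0.
Proof. by rewrite /bump invr0 [0 ^+ 2]exprS mul0r mulr0. Qed.

Lemma bump_ge0 x : 0 <= bump x.
Proof. by rewrite mulr_ge0 ?sqr_ge0// ltW// expR_gt0. Qed.

Lemma bump_gt0 x : x != 0 -> 0 < bump x.
Proof. by move=> x0; rewrite mulr_gt0 ?expR_gt0// exprn_even_gt0 ?invr_eq0. Qed.

(* Here [z = a + i b] and [w = p + i s]. *)
Definition hopf_x (a b p s : R) := a ^+ 2 + b ^+ 2 - (p ^+ 2 + s ^+ 2).
Definition hopf_r (a b p s : R) := a ^+ 2 + b ^+ 2 + (p ^+ 2 + s ^+ 2).
Definition hopf_y1 (a b p s : R) := a * p - b * s.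
Definition hopf_y2 (a b p s : R) := a * s + b * p.

(** The Hopf map: (x, 2 y), as a vector of R x C, has norm r. *)
Lemma hopf_r2 a b p s : hopf_r a b p s ^+ 2 =
  hopf_x a b p s ^+ 2 + 4 * (hopf_y1 a b p s ^+ 2 + hopf_y2 a b p s ^+ 2).
Proof. by rewrite /hopf_r /hopf_x /hopf_y1 /hopf_y2; ring. Qed.

Lemma hopf_r_ge0 a b p s : 0 <= hopf_r a b p s.
Proof. by rewrite !addr_ge0 ?sqr_ge0. Qed.

Lemma hopf_x_le a b p s : `|hopf_x a b p s| <= hopf_r a b p s.
Proof.
rewrite ler_norml /hopf_x /hopf_r.
have := sqr_ge0 a; have := sqr_ge0 b; have := sqr_ge0 p; have := sqr_ge0 s; lra.
Qed.

Section Params.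
Variables a b p s c1 c2 : R.
Let x := hopf_x a b p s.
Let r := hopf_r a b p s.
Let y1 := hopf_y1 a b p s.
Let y2 := hopf_y2 a b p s.

(* [boost_s2] is the square of the ratio of the values of [r] after and before the
   boost. Up to the normalization by [Num.sqrt boost_k], the coefficients are
   [boost_h] and [bump x / r]. *)
Definition boost_s2 := 1 + 8 * (y1 * c1 + y2 * c2) * flat 2 2 x r
  + 4 * (c1 ^+ 2 + c2 ^+ 2) * flat 2 1 x r ^+ 2.
Definition boost_h := (1 + Num.sqrt boost_s2) / 2.
Definition boost_k := boost_h ^+ 2 - (c1 ^+ 2 + c2 ^+ 2) * flat 2 1 x r ^+ 2.
Definition boost_C := boost_h / Num.sqrt boost_k.
Definition boost_E := flat 2 1 x r / Num.sqrt boost_k.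
Definition boost_a := boost_C * a + boost_E * (c1 * p + c2 * s).
Definition boost_b := boost_C * b + boost_E * (c2 * p - c1 * s).
Definition boost_p := boost_C * p + boost_E * (c1 * a + c2 * b).
Definition boost_s := boost_C * s + boost_E * (c2 * a - c1 * b).

Lemma flat21 : flat 2 1 x r = bump x / r.
Proof. by rewrite /flat expr1. Qed.

Lemma flat22 : flat 2 2 x r = bump x / r ^+ 2.
Proof. by rewrite /flat (exprVn r). Qed.

(** The flat factors vanish at x = 0 whatever r is, so the boost is the identity there. The other
    computations can then assume that x is nonzero, in which case r is positive and can be divided
    by. *)
Lemma boost_trivial : x = 0 -> [/\ boost_s2 = 1, boost_k = 1, boost_C = 1 & boost_E = 0].
Proof.
move=> x0; have g1 : flat 2 1 x r = 0 by rewrite flat21 x0 bump0 mul0r.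
have g2 : flat 2 2 x r = 0 by rewrite flat22 x0 bump0 mul0r.
have s2 : boost_s2 = 1 by rewrite /boost_s2 g1 g2 [0 ^+ 2]exprS mul0r !mulr0 !addr0.
have h : boost_h = 1 by rewrite /boost_h s2 sqrtr1; field.
have k : boost_k = 1 by rewrite /boost_k g1 h expr1n [0 ^+ 2]exprS mul0r mulr0 subr0.
by split=> //; rewrite ?/boost_C ?/boost_E k sqrtr1 ?h ?g1 divr1.
Qed.

(** By [hopf_r2], the value that r^2 must take once y has moved to y + c d(x) while x is kept. *)
Let t2 := x ^+ 2 + 4 * ((y1 + c1 * bump x) ^+ 2 + (y2 + c2 * bump x) ^+ 2).

Lemma boost_s2E : r != 0 -> boost_s2 = t2 / r ^+ 2.
Proof.
move=> r0; apply: (mulIf (expf_neq0 2 r0)); rewrite mulfVK ?expf_neq0//.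
rewrite /boost_s2 flat21 flat22 /t2 [RHS](_ : _ = r ^+ 2 +
  8 * (y1 * c1 + y2 * c2) * bump x + 4 * (c1 ^+ 2 + c2 ^+ 2) * bump x ^+ 2); last first.
  by rewrite /r hopf_r2 -/x -/y1 -/y2; ring.
by field.
Qed.

Lemma t2_gt0 : x != 0 -> 0 < t2.
Proof.
move=> x0; rewrite ltr_pwDl ?exprn_even_gt0// mulr_ge0// addr_ge0 ?sqr_ge0//.
Qed.

Lemma hopf_r_neq0 : x != 0 -> 0 < r.
Proof. by move=> x0; apply: lt_le_trans (hopf_x_le a b p s); rewrite normr_gt0. Qed.

Lemma boost_s2_gt0 : 0 < boost_s2.
Proof.
have [/boost_trivial[-> _ _ _]//|x0] := eqVneq x 0.
have r0 := hopf_r_neq0 x0.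
by rewrite boost_s2E ?gt_eqF// divr_gt0 ?t2_gt0// exprn_gt0.
Qed.

(** A boost adds to y the multiple C E r + 2 E^2 Re(y conj(c)) of c. For nonzero x, asking that this
    multiple be [bump x] amounts to this second expression of [boost_k]. *)
Lemma boost_kE : boost_k = boost_h + 2 * (y1 * c1 + y2 * c2) * flat 2 2 x r.
Proof.
rewrite /boost_k; have := sqr_sqrtr (ltW boost_s2_gt0).
rewrite {2}/boost_s2 /boost_h => e.
suff -> : ((1 + Num.sqrt boost_s2) / 2) ^+ 2 = (1 + Num.sqrt boost_s2) / 2 +
  (Num.sqrt boost_s2 ^+ 2 - 1) / 4 by rewrite e; field.
by field.
Qed.

(** For nonzero x, 4 r^2 [boost_k] is the Lorentz square of the sum of the future timelike vectors
    (r, - 2 y) and (t, 2 u), with u = y + c d(x); such a sum is timelike. *)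
Lemma boost_k_gt0 : 0 < boost_k.
Proof.
have [/boost_trivial[_ -> _ _]//|x0] := eqVneq x 0.
have r0 := hopf_r_neq0 x0.
have sE : Num.sqrt boost_s2 = Num.sqrt t2 / r.
  by rewrite boost_s2E ?gt_eqF// sqrtrM ?(ltW (t2_gt0 x0))// sqrtrV ?exprn_ge0 ?(ltW r0)// sqrtr_sqr gtr0_norm.
set t := Num.sqrt t2 in sE.
have t0 : 0 < t by rewrite sqrtr_gt0 t2_gt0.
have t2E : t ^+ 2 = t2 by rewrite sqr_sqrtr// ltW// t2_gt0.
suff H : 0 < (r + t) ^+ 2 - 4 * (c1 ^+ 2 + c2 ^+ 2) * bump x ^+ 2.
  rewrite /boost_k /boost_h sE flat21.
  rewrite (_ : _ - _ = ((r + t) ^+ 2 - 4 * (c1 ^+ 2 + c2 ^+ 2) * bump x ^+ 2) / (4 * r ^+ 2)).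
    by rewrite divr_gt0// mulr_gt0// exprn_gt0.
  by field; rewrite gt_eqF.
set u1 := y1 + c1 * bump x; set u2 := y2 + c2 * bump x.
have rt : 4 * `|y1 * u1 + y2 * u2| <= r * t.
  rewrite -(@ler_pXn2r _ 2) ?nnegrE ?mulr_ge0 ?(ltW r0) ?(ltW t0)//.
  rewrite exprMn real_normK ?num_real// [leRHS]exprMn t2E /t2 -/u1 -/u2 /r hopf_r2 -/x -/y1 -/y2.
  (* The difference r^2 t^2 - 16 (y . u)^2 as a sum of squares, the last one coming from Lagrange's
     identity. *)
  rewrite -subr_ge0 [X in 0 <= X](_ : _ = (x ^+ 2) ^+ 2 + 4 * (x * y1) ^+ 2 + 4 * (x * y2) ^+ 2
    + 4 * (x * u1) ^+ 2 + 4 * (x * u2) ^+ 2 + 16 * (y1 * u2 - y2 * u1) ^+ 2); last by ring.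
  by do ! apply: addr_ge0; rewrite ?sqr_ge0// mulr_ge0 ?sqr_ge0// ler0n.
have x2 : 0 < x ^+ 2 by rewrite exprn_even_gt0.
have -> : (r + t) ^+ 2 - 4 * (c1 ^+ 2 + c2 ^+ 2) * bump x ^+ 2 =
    2 * x ^+ 2 + 2 * (r * t) + 8 * (y1 * u1 + y2 * u2).
  rewrite sqrrD t2E /t2 -/u1 -/u2 /r hopf_r2 -/x -/y1 -/y2 /u1 /u2; ring.
have := ler_norm (- (y1 * u1 + y2 * u2)); rewrite normrN; lra.
Qed.

Lemma boost_CE : boost_C ^+ 2 - (c1 ^+ 2 + c2 ^+ 2) * boost_E ^+ 2 = 1.
Proof.
have k0 := boost_k_gt0; have q0 : Num.sqrt boost_k != 0 by rewrite gt_eqF ?sqrtr_gt0.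
apply: (mulIf (expf_neq0 2 q0)); rewrite mul1r [RHS]sqr_sqrtr ?(ltW k0)//.
rewrite /boost_C /boost_E [RHS]/boost_k; move: (Num.sqrt _) q0 => q q0.
by field.
Qed.

Lemma boost_x : hopf_x boost_a boost_b boost_p boost_s = x.
Proof.
transitivity ((boost_C ^+ 2 - (c1 ^+ 2 + c2 ^+ 2) * boost_E ^+ 2) * x).
  rewrite /hopf_x /boost_a /boost_b /boost_p /boost_s /x /hopf_x; ring.
by rewrite boost_CE mul1r.
Qed.

Lemma boost_y :
  hopf_y1 boost_a boost_b boost_p boost_s = y1 + c1 * bump x /\
  hopf_y2 boost_a boost_b boost_p boost_s = y2 + c2 * bump x.
Proof.
have [-> ->] : hopf_y1 boost_a boost_b boost_p boost_s = boost_C ^+ 2 * y1 +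
    boost_C * (boost_E * r) * c1 + boost_E ^+ 2 * ((c1 ^+ 2 - c2 ^+ 2) * y1 + 2 * c1 * c2 * y2) /\
  hopf_y2 boost_a boost_b boost_p boost_s = boost_C ^+ 2 * y2 +
    boost_C * (boost_E * r) * c2 + boost_E ^+ 2 * (2 * c1 * c2 * y1 - (c1 ^+ 2 - c2 ^+ 2) * y2).
  rewrite /hopf_y1 /hopf_y2 /boost_a /boost_b /boost_p /boost_s /y1 /y2 /r /hopf_r
    /hopf_y1 /hopf_y2.
  by split; ring.
have [x0|x0] := eqVneq x 0.
  have [_ _ C1 E0] := boost_trivial x0; rewrite C1 E0 x0 bump0.
  by split; ring.
have r0 := hopf_r_neq0 x0.
have k0 := boost_k_gt0; have q0 : Num.sqrt boost_k != 0 by rewrite gt_eqF ?sqrtr_gt0.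
have q2 : Num.sqrt boost_k ^+ 2 = boost_k by rewrite sqr_sqrtr// ltW.
have kE := boost_kE; rewrite flat22 in kE.
have kE2 : boost_k = boost_h ^+ 2 - (c1 ^+ 2 + c2 ^+ 2) * (bump x / r) ^+ 2.
  by rewrite /boost_k flat21.
rewrite /boost_C /boost_E flat21; move: (Num.sqrt _) q0 q2 => q q0 q2.
have r1 : r != 0 by rewrite gt_eqF.
move: kE kE2 q2 k0; generalize boost_k boost_h (bump x) => k h d kE kE2 q2 k0.
have k1 : k != 0 by rewrite gt_eqF.
split.
  rewrite [LHS](_ : _ = (h ^+ 2 * y1 + h * d * c1 + (d / r) ^+ 2 *
    ((c1 ^+ 2 - c2 ^+ 2) * y1 + 2 * c1 * c2 * y2)) / q ^+ 2); last by field; rewrite q0.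
  (* The factor k that multiplies [y1] is expanded by its definition and the one that multiplies
     [c1 * d] by [boost_kE]; what remains is an identity of rational functions. *)
  apply: (mulIf k1); rewrite q2 mulfVK// [RHS]mulrDl {1}kE2 {1}kE.
  by field.
rewrite [LHS](_ : _ = (h ^+ 2 * y2 + h * d * c2 + (d / r) ^+ 2 *
    (2 * c1 * c2 * y1 - (c1 ^+ 2 - c2 ^+ 2) * y2)) / q ^+ 2); last by field; rewrite q0.
apply: (mulIf k1); rewrite q2 mulfVK// [RHS]mulrDl {1}kE2 {1}kE.
by field.
Qed.

Lemma boost_r : x != 0 -> hopf_r boost_a boost_b boost_p boost_s = r * Num.sqrt boost_s2.
Proof.
move=> x0; have r0 := hopf_r_neq0 x0; have s0 := boost_s2_gt0.
have [e1 e2] := boost_y.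
apply/eqP; rewrite -(@eqrXn2 _ 2)// ?hopf_r_ge0 ?mulr_ge0 ?(ltW r0) ?sqrtr_ge0//.
have r1 : r != 0 by rewrite gt_eqF.
rewrite hopf_r2 boost_x e1 e2 exprMn sqr_sqrtr ?(ltW s0)// boost_s2E//.
by rewrite [eqbRHS]mulrC mulfVK// expf_neq0.
Qed.

End Params.

(** With [sg] the factor by which r grows, the reverse boost has [boost_s2] equal to [sg^-1 ^+ 2],
    so h and the flat factor are divided by [sg], and k by its square. Hence C and E are unchanged,
    and the boosts by c and - c are inverse matrices of SU(1,1). *)
Lemma boost_inv a b p s c1 c2 :
  let a' := boost_a a b p s c1 c2 in let b' := boost_b a b p s c1 c2 in
  let p' := boost_p a b p s c1 c2 in let s' := boost_s a b p s c1 c2 in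
  [/\ boost_a a' b' p' s' (- c1) (- c2) = a, boost_b a' b' p' s' (- c1) (- c2) = b,
      boost_p a' b' p' s' (- c1) (- c2) = p & boost_s a' b' p' s' (- c1) (- c2) = s].
Proof.
move=> a' b' p' s'.
suff [CE EE] : boost_C a' b' p' s' (- c1) (- c2) = boost_C a b p s c1 c2 /\
    boost_E a' b' p' s' (- c1) (- c2) = boost_E a b p s c1 c2.
  have := boost_CE a b p s c1 c2.
  rewrite /boost_a /boost_b /boost_p /boost_s CE EE /a' /b' /p' /s'
   /boost_a /boost_b /boost_p /boost_s.
  set C := boost_C _ _ _ _ _ _; set E := boost_E _ _ _ _ _ _ => H.
  by split; rewrite -[RHS]mul1r -H; ring.
have xE := boost_x a b p s c1 c2; rewrite -/a' -/b' -/p' -/s' in xE.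
have [x0|x0] := eqVneq (hopf_x a b p s) 0.
  have [_ _ -> ->] := boost_trivial (- c1) (- c2) (etrans xE x0).
  by have [_ _ -> ->] := boost_trivial c1 c2 x0.
have r0 := hopf_r_neq0 x0.
have [y1E y2E] := boost_y a b p s c1 c2; rewrite -/a' -/b' -/p' -/s' in y1E y2E.
have rE := boost_r c1 c2 x0; rewrite -/a' -/b' -/p' -/s' in rE.
have s0 := boost_s2_gt0 a b p s c1 c2.
have x'0 : hopf_x a' b' p' s' != 0 by rewrite xE.
have r'0 := hopf_r_neq0 x'0.
pose sg := Num.sqrt (boost_s2 a b p s c1 c2).
have sg0 : 0 < sg by rewrite sqrtr_gt0.
have sg1 : sg != 0 by rewrite gt_eqF.
have r1 : hopf_r a b p s != 0 by rewrite gt_eqF.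
have s2E : boost_s2 a' b' p' s' (- c1) (- c2) = sg^-1 ^+ 2.
  rewrite boost_s2E ?gt_eqF// y1E y2E xE !mulNr !addrK -hopf_r2 rE -/sg.
  by field; rewrite r1 sg1.
have hE : boost_h a' b' p' s' (- c1) (- c2) = boost_h a b p s c1 c2 / sg.
  rewrite /boost_h s2E sqrtr_sqr gtr0_norm ?invr_gt0// -/sg.
  by field.
have gE : flat 2 1 (hopf_x a' b' p' s') (hopf_r a' b' p' s') =
    flat 2 1 (hopf_x a b p s) (hopf_r a b p s) / sg.
  by rewrite !flat21 xE rE -/sg; field; rewrite r1 sg1.
have kE : boost_k a' b' p' s' (- c1) (- c2) = boost_k a b p s c1 c2 * sg^-1 ^+ 2.
  by rewrite /boost_k hE gE; field.
have qE : Num.sqrt (boost_k a' b' p' s' (- c1) (- c2)) = Num.sqrt (boost_k a b p s c1 c2) / sg.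
  rewrite kE sqrtrM ?(ltW (boost_k_gt0 _ _ _ _ _ _))// sqrtr_sqr gtr0_norm ?invr_gt0//.
have q0 : Num.sqrt (boost_k a b p s c1 c2) != 0 by rewrite gt_eqF ?sqrtr_gt0 ?boost_k_gt0.
by rewrite /boost_C /boost_E qE hE gE; split; field; rewrite q0 sg1.
Qed.

End Boost.

Ltac smooth := repeat first
  [ assumption | exact: Cinf_on_cst
  | apply: Cinf_onD; [assumption | |] | apply: Cinf_onN; [assumption |]
  | apply: Cinf_onM; [assumption | |] | apply: Cinf_onX; [assumption |]
  | apply: Cinf_onV; [assumption | |] | apply: Cinf_on_sqrt; [assumption | |] ].

Section SmoothBoost.
Variables (R : realType) (E : normedModType R) (U : set E).
Variables a b p s c1 c2 : E -> R.
Hypotheses (oU : open U) (Ca : Cinf_on U a) (Cb : Cinf_on U b) (Cp : Cinf_on U p)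
  (Cs : Cinf_on U s) (Cc1 : Cinf_on U c1) (Cc2 : Cinf_on U c2).

Let x q := hopf_x (a q) (b q) (p q) (s q).
Let r q := hopf_r (a q) (b q) (p q) (s q).

Lemma Cinf_on_hopf_x : Cinf_on U x.
Proof. by rewrite /x /hopf_x; smooth. Qed.

Lemma Cinf_on_hopf_r : Cinf_on U r.
Proof. by rewrite /r /hopf_r; smooth. Qed.

Let flat_smooth n : Cinf_on U (fun q => flat 2 n (x q) (r q)).
Proof.
apply: Cinf_on_flat => //; [exact: Cinf_on_hopf_x|exact: Cinf_on_hopf_r|].
by move=> q _; exact: hopf_x_le.
Qed.

Let s2_smooth : Cinf_on U (fun q => boost_s2 (a q) (b q) (p q) (s q) (c1 q) (c2 q)).
Proof.
have h1 := flat_smooth 1; have h2 := flat_smooth 2.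
by rewrite /boost_s2 /hopf_y1 /hopf_y2; smooth.
Qed.

Let h_smooth : Cinf_on U (fun q => boost_h (a q) (b q) (p q) (s q) (c1 q) (c2 q)).
Proof. by rewrite /boost_h; smooth => q _; exact: boost_s2_gt0. Qed.

Let k_smooth : Cinf_on U (fun q => boost_k (a q) (b q) (p q) (s q) (c1 q) (c2 q)).
Proof. by have h1 := flat_smooth 1; rewrite /boost_k; smooth. Qed.

Let C_smooth : Cinf_on U (fun q => boost_C (a q) (b q) (p q) (s q) (c1 q) (c2 q)).
Proof.
rewrite /boost_C; smooth => q _; first exact: boost_k_gt0.
by rewrite gt_eqF ?sqrtr_gt0 ?boost_k_gt0.
Qed.

Let E_smooth : Cinf_on U (fun q => boost_E (a q) (b q) (p q) (s q) (c1 q) (c2 q)).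
Proof.
have h1 := flat_smooth 1; rewrite /boost_E; smooth => q _; first exact: boost_k_gt0.
by rewrite gt_eqF ?sqrtr_gt0 ?boost_k_gt0.
Qed.

Lemma Cinf_on_boost :
  [/\ Cinf_on U (fun q => boost_a (a q) (b q) (p q) (s q) (c1 q) (c2 q)),
      Cinf_on U (fun q => boost_b (a q) (b q) (p q) (s q) (c1 q) (c2 q)),
      Cinf_on U (fun q => boost_p (a q) (b q) (p q) (s q) (c1 q) (c2 q)) &
      Cinf_on U (fun q => boost_s (a q) (b q) (p q) (s q) (c1 q) (c2 q))].
Proof.
have hC := C_smooth; have hE := E_smooth.
by split; rewrite /boost_a /boost_b /boost_p /boost_s; smooth.
Qed.

End SmoothBoost.

Section BoostTorus.
Variable R : realType.

(* Multiplication of (z, w) by a unit complex number [a1 + i a2]: z is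
   multiplied by it and w by its conjugate. *)
Lemma boost_torus (a b p s c1 c2 a1 a2 : R) : a1 ^+ 2 + a2 ^+ 2 = 1 ->
  let a' := a * a1 - b * a2 in let b' := a * a2 + b * a1 in
  let p' := p * a1 + s * a2 in let s' := s * a1 - p * a2 in
  let A := boost_a a b p s c1 c2 in let B := boost_b a b p s c1 c2 in
  let P := boost_p a b p s c1 c2 in let S := boost_s a b p s c1 c2 in
  [/\ boost_a a' b' p' s' c1 c2 = A * a1 - B * a2,
      boost_b a' b' p' s' c1 c2 = A * a2 + B * a1,
      boost_p a' b' p' s' c1 c2 = P * a1 + S * a2 &
      boost_s a' b' p' s' c1 c2 = S * a1 - P * a2].
Proof.
move=> u a' b' p' s' A B P S.
have xE : hopf_x a' b' p' s' = hopf_x a b p s.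
  by rewrite -[RHS]mul1r -u /hopf_x /a' /b' /p' /s'; ring.
have rE : hopf_r a' b' p' s' = hopf_r a b p s.
  by rewrite -[RHS]mul1r -u /hopf_r /a' /b' /p' /s'; ring.
have y1E : hopf_y1 a' b' p' s' = hopf_y1 a b p s.
  by rewrite -[RHS]mul1r -u /hopf_y1 /a' /b' /p' /s'; ring.
have y2E : hopf_y2 a' b' p' s' = hopf_y2 a b p s.
  by rewrite -[RHS]mul1r -u /hopf_y2 /a' /b' /p' /s'; ring.
have s2E : boost_s2 a' b' p' s' c1 c2 = boost_s2 a b p s c1 c2.
  by rewrite /boost_s2 xE rE y1E y2E.
have kE : boost_k a' b' p' s' c1 c2 = boost_k a b p s c1 c2.
  by rewrite /boost_k /boost_h xE rE s2E.
have CE : boost_C a' b' p' s' c1 c2 = boost_C a b p s c1 c2.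
  by rewrite /boost_C /boost_h kE s2E.
have EE : boost_E a' b' p' s' c1 c2 = boost_E a b p s c1 c2.
  by rewrite /boost_E kE xE rE.
rewrite /boost_a /boost_b /boost_p /boost_s CE EE /A /B /P /S
  /boost_a /boost_b /boost_p /boost_s /a' /b' /p' /s'.
by split; ring.
Qed.

End BoostTorus.

(** * The moment maps under boosts *)

Section Coordinates.
Variables (R : realType) (N : nat).
Implicit Types (q : Hn R N) (u c : Cn R N).

Definition za q i : R := q.1.1 0 i.
Definition zb q i : R := q.1.2 0 i.
Definition wp q i : R := q.2.1 0 i.
Definition ws q i : R := q.2.2 0 i.

Definition hn (a b p s : 'I_N -> R) : Hn R N :=
  ((\row_i a i, \row_i b i), (\row_i p i, \row_i s i)).

Lemma hnE a b p s i : [/\ za (hn a b p s) i = a i, zb (hn a b p s) i = b i,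
  wp (hn a b p s) i = p i & ws (hn a b p s) i = s i].
Proof. by rewrite /za /zb /wp /ws /hn /= !mxE. Qed.

Lemma za_hn a b p s i : za (hn a b p s) i = a i. Proof. by case: (hnE a b p s i). Qed.
Lemma zb_hn a b p s i : zb (hn a b p s) i = b i. Proof. by case: (hnE a b p s i). Qed.
Lemma wp_hn a b p s i : wp (hn a b p s) i = p i. Proof. by case: (hnE a b p s i). Qed.
Lemma ws_hn a b p s i : ws (hn a b p s) i = s i. Proof. by case: (hnE a b p s i). Qed.

Definition hn_simp := (za_hn, zb_hn, wp_hn, ws_hn).

Lemma hnP q q' : (forall i, [/\ za q i = za q' i, zb q i = zb q' i,
  wp q i = wp q' i & ws q i = ws q' i]) -> q = q'.
Proof.
case: q q' => [[a b] [p s]] [[a' b'] [p' s']] h.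
by congr (_, _, (_, _)); apply/rowP => i; case: (h i).
Qed.

Definition cunit u := forall i, u.1 0 i ^+ 2 + u.2 0 i ^+ 2 = 1.

Lemma norm1_cunit u : (forall i, `|cpt u i| = 1) -> cunit u.
Proof.
move=> h i; have := h i; rewrite normc_def /= => -[h1].
have : 0 <= u.1 0 i ^+ 2 + u.2 0 i ^+ 2 by rewrite addr_ge0 ?sqr_ge0.
by move=> /sqr_sqrtr <-; rewrite h1 expr1n.
Qed.

Lemma subtorus_cunit (K : subtorus R N) u : tset K u -> cunit u.
Proof. by move=> /subtorus_unit/norm1_cunit. Qed.

Lemma cinvE u : cunit u -> cinv u = (u.1, - u.2).
Proof.
by move=> h; congr pair; apply/rowP => i; rewrite !mxE /= h divr1// mulr1.
Qed.

(** Equal to [tact] on unit vectors, with the conjugate of [u] in place of its inverse. Being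
    polynomial, it extends the action smoothly to the ambient space. *)
Definition tactU q u : Hn R N := hn
  (fun i => za q i * u.1 0 i - zb q i * u.2 0 i)
  (fun i => za q i * u.2 0 i + zb q i * u.1 0 i)
  (fun i => wp q i * u.1 0 i + ws q i * u.2 0 i)
  (fun i => ws q i * u.1 0 i - wp q i * u.2 0 i).

Lemma tactE q u : cunit u -> tact q u = tactU q u.
Proof.
move=> uu; apply: hnP => i; rewrite /tact cinvE// !hn_simp.
rewrite /za /zb /wp /ws /cmul /cvec /= !mxE /=.
by split=> //; rewrite ?mulrN ?opprK// addrC.
Qed.

Definition xv q : 'rV[R]_N := \row_i hopf_x (za q i) (zb q i) (wp q i) (ws q i).
Definition y1v q : 'rV[R]_N := \row_i hopf_y1 (za q i) (zb q i) (wp q i) (ws q i).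
Definition y2v q : 'rV[R]_N := \row_i hopf_y2 (za q i) (zb q i) (wp q i) (ws q i).

Lemma tactU_inv q u : cunit u ->
  [/\ xv (tactU q u) = xv q, y1v (tactU q u) = y1v q & y2v (tactU q u) = y2v q].
Proof.
move=> uu; split; apply/rowP => i; rewrite !mxE !hn_simp -[RHS]mul1r -(uu i)
  /hopf_x /hopf_y1 /hopf_y2; ring.
Qed.

Variables (d : nat) (B : 'M[R]_(d, N)).

Lemma mu1E q : mu1 B q = trigo.pi *: (xv q *m B^T).
Proof.
apply/rowP => j; rewrite !mxE; congr (_ * _); apply: eq_bigr => i _.
by rewrite !mxE /sqmod /=.
Qed.

Lemma muCE q : muC B q =
  ((2 * trigo.pi) *: (y2v q *m B^T), - (2 * trigo.pi) *: (y1v q *m B^T)).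
Proof.
have sumE : forall F : 'I_N -> R[i],
    \sum_i F i = ((\sum_i complex.Re (F i)) +i* (\sum_i complex.Im (F i)))%C.
  by move=> F; rewrite -!raddf_sum; case: (\sum_i F i).
congr pair; apply/rowP => j; rewrite !mxE sumE /=.
  set S1 := \sum_(i < N) _; set S2 := \sum_(i < N) _; set S3 := \sum_(i < N) _.
  have -> : S2 = S3.
    by apply: eq_bigr => i _; rewrite !mxE mulr0 add0r.
  by ring.
set S1 := \sum_(i < N) _; set S2 := \sum_(i < N) _; set S3 := \sum_(i < N) _.
have -> : S2 = S3.
  by apply: eq_bigr => i _; rewrite !mxE mulr0 subr0.
by ring.
Qed.

Definition boost c q : Hn R N := hn
  (fun i => boost_a (za q i) (zb q i) (wp q i) (ws q i) (c.1 0 i) (c.2 0 i))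
  (fun i => boost_b (za q i) (zb q i) (wp q i) (ws q i) (c.1 0 i) (c.2 0 i))
  (fun i => boost_p (za q i) (zb q i) (wp q i) (ws q i) (c.1 0 i) (c.2 0 i))
  (fun i => boost_s (za q i) (zb q i) (wp q i) (ws q i) (c.1 0 i) (c.2 0 i)).

Lemma xv_boost c q : xv (boost c q) = xv q.
Proof. by apply/rowP => i; rewrite !mxE !hn_simp boost_x. Qed.

Definition bumpv (x : 'rV[R]_N) : 'rV[R]_N := \row_i bump (x 0 i).

Lemma y1v_boost c q : y1v (boost c q) = y1v q + c.1 *m diag_mx (bumpv (xv q)).
Proof.
apply/rowP => i; rewrite mul_mx_diag !mxE !hn_simp.
by have [-> _] := boost_y (za q i) (zb q i) (wp q i) (ws q i) (c.1 0 i) (c.2 0 i).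
Qed.

Lemma y2v_boost c q : y2v (boost c q) = y2v q + c.2 *m diag_mx (bumpv (xv q)).
Proof.
apply/rowP => i; rewrite mul_mx_diag !mxE !hn_simp.
by have [_ ->] := boost_y (za q i) (zb q i) (wp q i) (ws q i) (c.1 0 i) (c.2 0 i).
Qed.

Lemma boostNK c q : boost (- c) (boost c q) = q.
Proof.
apply: hnP => i; rewrite !hn_simp !mxE.
by have [-> -> -> ->] := boost_inv (za q i) (zb q i) (wp q i) (ws q i) (c.1 0 i) (c.2 0 i).
Qed.

Lemma boost_tactU c q u : cunit u -> boost c (tactU q u) = tactU (boost c q) u.
Proof.
move=> uu; apply: hnP => i; rewrite !hn_simp.
by have [-> -> -> ->] := boost_torus (za q i) (zb q i) (wp q i) (ws q i) (c.1 0 i) (c.2 0 i) (uu i).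
Qed.

Definition gram (x : 'rV[R]_N) : 'M[R]_d := B *m diag_mx (bumpv x) *m B^T.

(* Rapidities [l B] moving [muC] by [b]; the equation for [l] has matrix [gram x]. *)
Definition shift_rapidity (x : 'rV[R]_N) (b : Cn R d) : Cn R N :=
  (- (2 * trigo.pi)^-1 *: (b.2 *m invmx (gram x) *m B),
   (2 * trigo.pi)^-1 *: (b.1 *m invmx (gram x) *m B)).

Definition muC_shift q (b : Cn R d) := boost (shift_rapidity (xv q) b) q.

Lemma shift_rapidityN x b : shift_rapidity x (- b) = - shift_rapidity x b.
Proof.
by rewrite /shift_rapidity /=; congr pair; rewrite !mulNmx scalerN.
Qed.

Lemma xv_muC_shift q b : xv (muC_shift q b) = xv q.
Proof. exact: xv_boost. Qed.

Lemma mu1_muC_shift q b : mu1 B (muC_shift q b) = mu1 B q.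
Proof. by rewrite !mu1E xv_muC_shift. Qed.

(** The rapidity depends on [q] only through [xv], which boosts preserve; hence [- b] undoes [b]
    even where [gram] is singular and [invmx] takes a default value. *)
Lemma muC_shiftNK q b : muC_shift (muC_shift q b) (- b) = q.
Proof. by rewrite {1}/muC_shift xv_muC_shift shift_rapidityN boostNK. Qed.

Lemma muC_shift_tact q b u : cunit u ->
  muC_shift (tact q u) b = tact (muC_shift q b) u.
Proof.
move=> uu; rewrite (tactE q uu) (tactE (muC_shift q b) uu) /muC_shift.
by have [-> _ _] := tactU_inv q uu; rewrite (boost_tactU _ _ uu).
Qed.

Lemma muC_muC_shift q b : gram (xv q) \in unitmx ->
  muC B (muC_shift q b) = muC B q + b.
Proof.
move=> ug; have pi0 : 2 * trigo.pi != 0 :> R by rewrite mulf_neq0 ?pnatr_eq0// gt_eqF ?pi_gt0.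
have H v : v *m invmx (gram (xv q)) *m B *m diag_mx (bumpv (xv q)) *m B^T = v.
  by rewrite -!mulmxA [X in invmx _ *m X](_ : _ = gram (xv q)) ?mulVmx ?mulmx1// /gram !mulmxA.
rewrite !muCE y1v_boost y2v_boost /=; congr pair; rewrite mulmxDl scalerDr; congr (_ + _).
  by rewrite -!scalemxAl H scalerA divff// scale1r.
by rewrite -!scalemxAl H scalerA mulrNN divff// scale1r.
Qed.

End Coordinates.

(** * Smoothness of the moment maps and of the shift of [muC] *)

Section SmoothCoordinates.
Variables (R : realType) (E : normedModType R) (U : set E).
Hypothesis oU : open U.

Lemma Cinf_on_eq (F : normedModType R) (f g : E -> F) :
  f =1 g -> Cinf_on U f -> Cinf_on U g.
Proof. by move=> /funext ->. Qed.

Lemma Cinf_on_mulmx m n k (f : E -> 'M[R]_(m, n)) (g : E -> 'M[R]_(n, k)) :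
  Cinf_on U f -> Cinf_on U g -> Cinf_on U (fun e => f e *m g e).
Proof.
move=> hf hg; apply: (@Cinf_on_eq _ (fun e => \matrix_(i, j) \sum_k0 f e i k0 * g e k0 j)).
  by move=> e; apply/matrixP => i j; rewrite !mxE.
apply: Cinf_on_matrix => // i j; apply: Cinf_on_sum => // l.
by apply: Cinf_onM => //; exact: Cinf_on_coord.
Qed.

Lemma Cinf_on_det n (f : E -> 'M[R]_n) :
  Cinf_on U f -> Cinf_on U (fun e => \det (f e)).
Proof.
move=> hf; rewrite /determinant; apply: Cinf_on_sum => // s.
apply: Cinf_onM => //; first exact: Cinf_on_cst.
by apply: Cinf_on_prod => // i; exact: Cinf_on_coord.
Qed.

Lemma Cinf_on_invmx n (f : E -> 'M[R]_n) : Cinf_on U f ->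
  (forall e, U e -> \det (f e) != 0) -> Cinf_on U (fun e => invmx (f e)).
Proof.
move=> hf f0 k.
apply: (@Ck_on_ext _ _ _ _ _ (fun e => (\det (f e))^-1 *: \adj (f e))) => //.
  by move=> e; rewrite inE => Ue; rewrite /invmx unitmxE unitfE f0.
apply: Ck_on_scale => //; first exact: (Cinf_onV oU (Cinf_on_det hf) f0).
suff h : Cinf_on U (fun e => \adj (f e)) by exact: h.
apply: (@Cinf_on_eq _ (fun e => \matrix_(i, j) cofactor (f e) j i)).
  by move=> e; apply/matrixP => i j; rewrite !mxE.
apply: Cinf_on_matrix => // i j; rewrite /cofactor.
apply: Cinf_onM => //; first exact: Cinf_on_cst.
apply: Cinf_on_det; apply: (@Cinf_on_eq _ (fun e => \matrix_(i', j') f e (lift j i') (lift i j'))).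
  by move=> e; apply/matrixP => i' j'; rewrite !mxE.
by apply: Cinf_on_matrix => // i' j'; exact: Cinf_on_coord.
Qed.

Lemma Cinf_on_bump (x : E -> R) : Cinf_on U x -> Cinf_on U (fun e => bump (x e)).
Proof.
move=> hx; apply: (@Cinf_on_eq _ (fun e => flat 2 0 (x e) (1 + x e ^+ 2))).
  by move=> e; rewrite /flat mulr1.
apply: Cinf_on_flat => //; first by smooth.
move=> q _; have := sqr_ge0 (1 - `|x q|); rewrite sqrrB expr1n mul1r real_normK ?num_real//.
have := normr_ge0 (x q); lra.
Qed.

Variable N : nat.

Lemma Cinf_on_hn (a b p s : E -> 'I_N -> R) :
  (forall i, [/\ Cinf_on U (a ^~ i), Cinf_on U (b ^~ i), Cinf_on U (p ^~ i) &
    Cinf_on U (s ^~ i)]) ->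
  Cinf_on U (fun e => hn (a e) (b e) (p e) (s e)).
Proof.
move=> h; apply: Cinf_on_pair => //; apply: Cinf_on_pair => //;
  by apply: Cinf_on_matrix => // _ i; case: (h i).
Qed.

Lemma Cinf_on_coords (q : E -> Hn R N) i : Cinf_on U q ->
  [/\ Cinf_on U (fun e => za (q e) i), Cinf_on U (fun e => zb (q e) i),
    Cinf_on U (fun e => wp (q e) i) & Cinf_on U (fun e => ws (q e) i)].
Proof.
move=> hq; have h1 := Cinf_on_fst oU hq; have h2 := Cinf_on_snd oU hq.
by split; apply: Cinf_on_coord => //;
  do [exact: Cinf_on_fst h1|exact: Cinf_on_snd h1|exact: Cinf_on_fst h2|exact: Cinf_on_snd h2].
Qed.

Lemma Cinf_on_cn_coord (u : E -> Cn R N) i : Cinf_on U u ->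
  Cinf_on U (fun e => (u e).1 0 i) /\ Cinf_on U (fun e => (u e).2 0 i).
Proof.
move=> hu; split; apply: Cinf_on_coord => //; [exact: Cinf_on_fst|exact: Cinf_on_snd].
Qed.

Lemma Cinf_on_tactU (q : E -> Hn R N) (u : E -> Cn R N) :
  Cinf_on U q -> Cinf_on U u -> Cinf_on U (fun e => tactU (q e) (u e)).
Proof.
move=> hq hu; apply: Cinf_on_hn => i.
have [h1 h2 h3 h4] := Cinf_on_coords i hq; have [h5 h6] := Cinf_on_cn_coord i hu.
by split; smooth.
Qed.

Lemma Cinf_on_boostH (q : E -> Hn R N) (c : E -> Cn R N) :
  Cinf_on U q -> Cinf_on U c -> Cinf_on U (fun e => boost (c e) (q e)).
Proof.
move=> hq hu; apply: Cinf_on_hn => i.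
have [h1 h2 h3 h4] := Cinf_on_coords i hq; have [h5 h6] := Cinf_on_cn_coord i hu.
exact: Cinf_on_boost.
Qed.

Lemma Cinf_on_xv (q : E -> Hn R N) : Cinf_on U q -> Cinf_on U (fun e => xv (q e)).
Proof.
move=> hq; apply: Cinf_on_matrix => // _ i.
by have [h1 h2 h3 h4] := Cinf_on_coords i hq; exact: Cinf_on_hopf_x.
Qed.

Lemma Cinf_on_y1v (q : E -> Hn R N) : Cinf_on U q -> Cinf_on U (fun e => y1v (q e)).
Proof.
move=> hq; apply: Cinf_on_matrix => // _ i.
by have [h1 h2 h3 h4] := Cinf_on_coords i hq; rewrite /hopf_y1; smooth.
Qed.

Lemma Cinf_on_y2v (q : E -> Hn R N) : Cinf_on U q -> Cinf_on U (fun e => y2v (q e)).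
Proof.
move=> hq; apply: Cinf_on_matrix => // _ i.
by have [h1 h2 h3 h4] := Cinf_on_coords i hq; rewrite /hopf_y2; smooth.
Qed.

Variables (d : nat) (B : 'M[R]_(d, N)).

Lemma Cinf_on_gram (q : E -> Hn R N) : Cinf_on U q -> Cinf_on U (fun e => gram B (xv (q e))).
Proof.
move=> hq; have hx := Cinf_on_xv hq.
apply: Cinf_on_mulmx; last exact: Cinf_on_cst.
apply: (@Cinf_on_eq _ (fun e => \matrix_(i, j) (B i j * bump (xv (q e) 0 j)))).
  by move=> e; rewrite mul_mx_diag; apply/matrixP => i j; rewrite !mxE.
apply: Cinf_on_matrix => // i j; apply: Cinf_onM => //; first exact: Cinf_on_cst.
by apply: Cinf_on_bump; exact: Cinf_on_coord.
Qed.

Lemma Cinf_onZ (F : normedModType R) (f : E -> F) (c : R) :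
  Cinf_on U f -> Cinf_on U (fun e => c *: f e).
Proof. by move=> hf k; apply: Ck_on_scale => //; exact: Ck_on_cst. Qed.

Lemma Cinf_on_muC (q : E -> Hn R N) : Cinf_on U q -> Cinf_on U (fun e => muC B (q e)).
Proof.
move=> hq; apply: (@Cinf_on_eq _ (fun e => ((2 * trigo.pi) *: (y2v (q e) *m B^T),
    - (2 * trigo.pi) *: (y1v (q e) *m B^T)))); first by move=> e; rewrite muCE.
apply: Cinf_on_pair => //; apply: Cinf_onZ; apply: Cinf_on_mulmx; rewrite ?Cinf_on_cst//.
- exact: Cinf_on_y2v.
- exact: Cinf_on_cst.
- exact: Cinf_on_y1v.
- exact: Cinf_on_cst.
Qed.

Lemma Cinf_on_mu1 (q : E -> Hn R N) : Cinf_on U q -> Cinf_on U (fun e => mu1 B (q e)).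
Proof.
move=> hq; apply: (@Cinf_on_eq _ (fun e => trigo.pi *: (xv (q e) *m B^T))).
  by move=> e; rewrite mu1E.
by apply: Cinf_onZ; apply: Cinf_on_mulmx; [exact: Cinf_on_xv|exact: Cinf_on_cst].
Qed.

Lemma Cinf_on_muC_shift (q : E -> Hn R N) (b : E -> Cn R d) :
  (forall e, U e -> gram B (xv (q e)) \in unitmx) ->
  Cinf_on U q -> Cinf_on U b -> Cinf_on U (fun e => muC_shift B (q e) (b e)).
Proof.
move=> gu hq hb; apply: Cinf_on_boostH => //.
have hi : Cinf_on U (fun e => invmx (gram B (xv (q e)))).
  apply: Cinf_on_invmx; first exact: Cinf_on_gram.
  by move=> e /gu; rewrite unitmxE unitfE.
apply: Cinf_on_pair => //; apply: Cinf_onZ; (apply: Cinf_on_mulmx; last exact: Cinf_on_cst);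
  apply: Cinf_on_mulmx => //; [exact: Cinf_on_snd|exact: Cinf_on_fst].
Qed.

End SmoothCoordinates.

(** * Consequences of regularity: the Gram matrix and an invertible minor *)

Section Regular.
Variable R : realType.

Lemma findim_continuous (F G : normedModType R) (L : {linear F -> G}) :
  findim F -> continuous L.
Proof.
move=> [n [l [e [lc le]]]] x.
suff : Ck_on 0 setT L by exact.
apply: (@Ck_on_ext _ _ _ _ _ (fun y => \sum_i l i y *: L (e i))); first exact: openT.
  by move=> y _; rewrite [in RHS](le y) linear_sum; apply: eq_bigr => i _; rewrite linearZ.
apply: Ck_on_sum => [|i]; first exact: openT.
by apply: (Ck_on_scale (k := 0)) => [||y _]; [exact: openT|move=> y _; exact: lc|exact: cst_continuous].
Qed.

Lemma diff_linl (E F G : normedModType R) (f : E -> F) (L : {linear F -> G}) x v :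
  continuous L -> differentiable f x -> 'd (fun y => L (f y)) x v = L ('d f x v).
Proof.
move=> Lc df; rewrite (diff_comp df (linear_differentiable _ Lc)) /=.
by rewrite (diff_lin _ Lc).
Qed.

Lemma findim_Hn N : findim (Hn R N).
Proof. by do 2 apply: findim_prod; exact: findim_mx. Qed.

Lemma findim_Cn N : findim (Cn R N).
Proof. by apply: findim_prod; exact: findim_mx. Qed.

Lemma Cinf_onT_differentiable (E F : normedModType R) (f : E -> F) x :
  Cinf_on setT f -> differentiable f x.
Proof. by move=> /(_ 1%N)/Ck_onS[+ _]; exact. Qed.

Variables (N d : nat) (B : 'M[R]_(d, N)).

(** On each factor x is a quadratic form, so its differential vanishes at the origin. *)
Lemma diff_xv0 (q v : Hn R N) i :
  za q i = 0 -> zb q i = 0 -> wp q i = 0 -> ws q i = 0 -> ('d (@xv R N) q v) 0 i = 0.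
Proof.
move=> a0 b0 p0 s0.
have oT : open (setT : set (Hn R N)) by exact: openT.
have dxv : differentiable (@xv R N) q.
  apply: Cinf_onT_differentiable; apply: (Cinf_on_xv oT (q := id)).
  exact: Cinf_on_id.
rewrite -[LHS](@diff_linl _ _ _ (@xv R N) (mxcoord 0 i)) //; last exact: coord_continuous.
have -> : (fun y => mxcoord 0 i (xv y)) = (fun y => za y i * za y i + zb y i * zb y i
   - (wp y i * wp y i + ws y i * ws y i) : R).
  by apply/funext => y; rewrite /mxcoord mxE /hopf_x !expr2.
have [ha hb hp hs] := Cinf_on_coords oT i (@Cinf_on_id _ _ setT).
have sq (f : Hn R N -> R) : Cinf_on setT f -> f q = 0 ->
    is_diff q (fun y => f y * f y) (cst 0).
  move=> hf f0; have /differentiableP df : differentiable f q by exact: Cinf_onT_differentiable.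
  apply: (is_diff_eq (is_diff_mul df df)); apply/funext => w.
  by rewrite f0 mul0r addr0.
have h := is_diffB (is_diffD (sq _ ha a0) (sq _ hb b0)) (is_diffD (sq _ hp p0) (sq _ hs s0)).
have [_ ->] := h.
by rewrite /= !fctE !addr0 subr0.
Qed.

(* Regularity is only assumed at points of the level of [(alpha, 0)]; [q'] is such a
   point, with the same [xv] as [q]. There the differential of [mu1] only involves
   the columns of [B] where [xv q] is nonzero. *)
Lemma regular_span (alpha : 'rV[R]_d) (q : Hn R N) (v : 'rV[R]_d) :
  regular_value (hk_moment B) (alpha, 0) -> mu1 B q = alpha ->
  (forall i, xv q 0 i != 0 -> (v *m B) 0 i = 0) -> v = 0.
Proof.
move=> reg mq hv.
(* [Num.sqrt] is 0 on negative numbers: in each factor z^2 and w^2 are the positive and the negative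
   part of x, and z w = 0. *)
pose q' : Hn R N := hn (fun i => Num.sqrt (xv q 0 i)) (fun=> 0)
  (fun i => Num.sqrt (- xv q 0 i)) (fun=> 0).
have xq' : xv q' = xv q.
  apply/rowP => i; rewrite mxE !hn_simp /hopf_x expr0n /= !addr0.
  have [x0|x0] := leP 0 (xv q 0 i).
    by rewrite sqr_sqrtr// ler0_sqrtr ?oppr_le0// expr0n subr0.
  by rewrite ler0_sqrtr ?(ltW x0)// expr0n sqr_sqrtr ?oppr_ge0 ?(ltW x0)// sub0r opprK.
have ss t : Num.sqrt t * Num.sqrt (- t) = 0 :> R.
  have [x0|x0] := leP 0 t; first by rewrite [X in _ * X]ler0_sqrtr ?oppr_le0// mulr0.
  by rewrite ler0_sqrtr ?(ltW x0)// mul0r.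
have y1q' : y1v q' = 0.
  by apply/rowP => i; rewrite !mxE !hn_simp /hopf_y1 ss mulr0 subr0.
have y2q' : y2v q' = 0.
  by apply/rowP => i; rewrite !mxE !hn_simp /hopf_y2 mulr0 mul0r addr0.
have hkq' : hk_moment B q' = (alpha, 0).
  by rewrite /hk_moment mu1E xq' -mu1E mq muCE y1q' y2q' mul0mx !scaler0.
have oT : open (setT : set (Hn R N)) by exact: openT.
have dxv : differentiable (@xv R N) q'.
  apply: Cinf_onT_differentiable; apply: (Cinf_on_xv oT (q := id)); exact: Cinf_on_id.
have dhk : differentiable (hk_moment B) q'.
  apply: Cinf_onT_differentiable; apply: Cinf_on_pair => //.
    by apply: (Cinf_on_mu1 oT B (q := id)); exact: Cinf_on_id.
  by apply: (Cinf_on_muC oT B (q := id)); exact: Cinf_on_id.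
have [u hu] := reg q' hkq' (v, 0).
pose L : {linear 'rV[R]_N -> 'rV[R]_d} := trigo.pi \*: (mulmxr B^T).
have Lc : continuous L by apply: findim_continuous; exact: findim_mx.
have : 'd (fun y => (hk_moment B y).1) q' u = v.
  rewrite (@diff_linl _ _ _ (hk_moment B) fst) ?hu// => p; exact: cvg_fst.
have -> : (fun y => (hk_moment B y).1) = (fun y => L (xv y)).
  by apply/funext => y /=; rewrite mu1E.
(* Pairing with [v] writes |v|^2 as pi times the pairing of ['d (@xv R N) q' u] with [v *m B], in
   which every term has a vanishing factor. *)
rewrite (@diff_linl _ _ _ (@xv R N) L)// => /(congr1 (fun w => (w *m v^T) 0 0)).
rewrite /L /= -scalemxAl -mulmxA -trmx_mul.
have -> : 'd (@xv R N) q' u *m (v *m B)^T = 0.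
  apply/matrixP => i j; rewrite !ord1 !mxE big1// => k _.
  rewrite [(_ ^T) _ _]mxE; have [x0|x0] := eqVneq (xv q 0 k) 0.
    by rewrite diff_xv0 ?mul0r// !hn_simp// ?x0 ?oppr0 ?sqrtr0.
  by rewrite hv// mulr0.
rewrite scaler0 mxE => /esym; rewrite mxE => h.
apply/rowP => j; rewrite mxE; apply/eqP; rewrite -sqrf_eq0; apply/eqP.
have vv k : v 0 k * v^T k 0 = v 0 k ^+ 2 by rewrite mxE expr2.
rewrite -vv; move/psumr_eq0P : h; apply=> // k _; by rewrite vv sqr_ge0.
Qed.

Variables (alpha : 'rV[R]_d) (q : Hn R N).
Hypotheses (reg : regular_value (hk_moment B) (alpha, 0)) (mq : mu1 B q = alpha).

(** For v in the kernel, v gram v^T is the sum of the nonnegative terms bump(x_i) (v B)_i^2, so v B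
    vanishes wherever x_i does not, and [regular_span] applies. *)
Lemma gram_unit : gram B (xv q) \in unitmx.
Proof.
rewrite -row_free_unit -kermx_eq0; apply/eqP/eqP/rowV0P => v /sub_kermxP.
rewrite /gram !mulmxA => /(congr1 (fun w => (w *m v^T) 0 0)).
rewrite mul0mx -[X in X = _]/((_ *m _ *m _) 0 0) -mulmxA -trmx_mul mul_mx_diag mxE [RHS]mxE => h.
have vv k : (\matrix_(i, j) ((v *m B) i j * bumpv (xv q) 0 j)) 0 k * ((v *m B)^T) k 0
   = bump (xv q 0 k) * (v *m B) 0 k ^+ 2.
  by rewrite !mxE; ring.
apply: (regular_span reg mq) => i x0; move/psumr_eq0P : h => h.
have : bump (xv q 0 i) * (v *m B) 0 i ^+ 2 = 0.
  by rewrite -vv; apply: h => // k _; rewrite vv mulr_ge0 ?bump_ge0 ?sqr_ge0.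
by move=> /eqP; rewrite mulf_eq0 (gt_eqF (bump_gt0 x0))/= sqrf_eq0 => /eqP.
Qed.

(** Scaling the columns of B by the x_i before extracting a full minor gives both properties at
    once: that minor is the product of the chosen x_i with the corresponding minor of B. *)
Lemma regular_minor : exists f : 'I_d -> 'I_N,
  [/\ injective f, forall j, xv q 0 (f j) != 0 & colsub f B \in unitmx].
Proof.
pose A : 'M[R]_(N, d) := (B *m diag_mx (xv q))^T.
have fA : row_full A.
  rewrite /A /row_full mxrank_tr -/(row_free _) -kermx_eq0.
  apply/eqP/eqP/rowV0P => v /sub_kermxP; rewrite mulmxA mul_mx_diag => h.
  apply: (regular_span reg mq) => i x0.
  move/rowP/(_ i): h; rewrite mxE [RHS]mxE => /eqP.
  by rewrite mulf_eq0 (negbTE x0) orbF => /eqP.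
have uA := fullrowsub_unit fA.
exists (fullrankfun fA).
have AE : rowsub (fullrankfun fA) A =
    diag_mx (\row_j xv q 0 (fullrankfun fA j)) *m (colsub (fullrankfun fA) B)^T.
  rewrite mul_diag_mx; apply/matrixP => i j; rewrite mxE mxE mul_mx_diag mxE !mxE.
  by rewrite mulrC.
move: uA; rewrite AE unitmx_mul unitmx_tr => /andP[u1 u2]; split=> //.
  exact: fullrankfun_inj.
move=> j; move: u1; rewrite unitmxE det_diag unitfE.
by move=> /prodf_neq0/(_ j isT); rewrite mxE.
Qed.

End Regular.

(** * Subtori *)

Section Cluster.

Lemma compact_cluster_seq (T : topologicalType) (A : set T) (u : nat -> T) :
  compact A -> (forall n, A (u n)) ->
  exists2 p, A p & forall V, nbhs p V -> forall n, exists2 m, (n <= m)%N & V (u m).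
Proof.
move=> cA Au; have H : (u @ \oo) A by exists 0%N => // n _; exact: Au.
have [p [Ap cp]] := cA (u @ \oo) _ H.
exists p => // V pV n.
have [|x [[m /= nm <-] Vx]] := cp (u @` [set m | (n <= m)%N]) V _ pV.
  by exists n => // m /= nm; exists m.
by exists m.
Qed.

Lemma open_forall (T : topologicalType) (I : finType) (P : I -> set T) :
  (forall i, open (P i)) -> open [set x | forall i, P i x].
Proof.
move=> oP; rewrite openE => x Px; rewrite /interior.
by apply: filter_forall => i; apply: open_nbhs_nbhs.
Qed.

End Cluster.

Section OpenPos.
Variable R : realType.

Lemma Cinf_on_continuous (E F : normedModType R) (U : set E) (f : E -> F) (x : E) :
  Cinf_on U f -> U x -> {for x, continuous f}.
Proof. by move=> hf; exact: (hf 0%N). Qed.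

Lemma open_pos (E : normedModType R) (U : set E) (f : E -> R) :
  open U -> Cinf_on U f -> open [set x | U x /\ 0 < f x].
Proof.
move=> oU hf; rewrite openE => x [Ux fx]; rewrite /interior.
have cf : f @ x --> f x by exact: Cinf_on_continuous hf Ux.
have pf : nbhs (f x) [set t | 0 < t].
  by apply: open_nbhs_nbhs; split=> //; exact: open_gt.
near=> y; split; near: y; [exact: open_nbhs_nbhs|exact: cf pf].
Unshelve. all: by end_near. Qed.

End OpenPos.

(** * Exponential and logarithm of the torus *)

Section TorusExp.
Variables (R : realType) (N : nat).
Implicit Types (u v : Cn R N) (x y : 'rV[R]_N).

Lemma cn_ext u v : (forall i, u.1 0 i = v.1 0 i /\ u.2 0 i = v.2 0 i) -> u = v.
Proof.
by case: u v => [a b] [a' b'] h; congr pair; apply/rowP => i; case: (h i).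
Qed.

Lemma cmul_re u v i : (cmul u v).1 0 i = u.1 0 i * v.1 0 i - u.2 0 i * v.2 0 i.
Proof. by rewrite /cmul /cvec /= !mxE. Qed.

Lemma cmul_im u v i : (cmul u v).2 0 i = u.1 0 i * v.2 0 i + u.2 0 i * v.1 0 i.
Proof. by rewrite /cmul /cvec /= !mxE. Qed.

Lemma texp_re x i : (texp x).1 0 i = cos (2 * trigo.pi * x 0 i).
Proof. by rewrite mxE. Qed.

Lemma texp_im x i : (texp x).2 0 i = sin (2 * trigo.pi * x 0 i).
Proof. by rewrite mxE. Qed.

Lemma cone_re i : (cone R N).1 0 i = 1. Proof. by rewrite mxE. Qed.
Lemma cone_im i : (cone R N).2 0 i = 0. Proof. by rewrite mxE. Qed.

Definition cn_simp := (cmul_re, cmul_im, texp_re, texp_im, cone_re, cone_im).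

Lemma texpD x y : texp (x + y) = cmul (texp x) (texp y).
Proof.
by apply: cn_ext => i; rewrite !cn_simp mxE mulrDr cosD sinD; split=> //; ring.
Qed.

Lemma cunit_texp x : cunit (texp x).
Proof. by move=> i; rewrite !cn_simp cos2Dsin2. Qed.

Lemma texpN x : texp (- x) = cinv (texp x).
Proof.
rewrite (cinvE (cunit_texp x)); apply: cn_ext => i /=.
by rewrite !mxE mulrN cosN sinN.
Qed.

Lemma texp0 : texp 0 = cone R N.
Proof. by apply: cn_ext => i; rewrite !cn_simp mxE mulr0 cos0 sin0. Qed.

Lemma Cinf_on_texp (E : normedModType R) (U : set E) (x : E -> 'rV[R]_N) :
  open U -> Cinf_on U x -> Cinf_on U (fun e => texp (x e)).
Proof.
move=> oU hx; apply: Cinf_on_pair => //; apply: Cinf_on_matrix => // _ i /=.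
  by apply: Cinf_on_cos => //; apply: Cinf_onM => //; [exact: Cinf_on_cst|exact: Cinf_on_coord].
by apply: Cinf_on_sin => //; apply: Cinf_onM => //; [exact: Cinf_on_cst|exact: Cinf_on_coord].
Qed.

Lemma continuous_texp : continuous (@texp R N).
Proof.
have oT : open (setT : set 'rV[R]_N) by exact: openT.
by move=> x; apply: (Cinf_on_continuous (U := setT)) => //; apply: (@Cinf_on_texp _ _ id) => //;
  exact: Cinf_on_id.
Qed.

Lemma Cinf_on_cmul (E : normedModType R) (U : set E) (u v : E -> Cn R N) :
  open U -> Cinf_on U u -> Cinf_on U v -> Cinf_on U (fun e => cmul (u e) (v e)).
Proof.
move=> oU hu hv.
apply: (@Cinf_on_eq _ _ _ _ (fun e =>
  (\row_i ((u e).1 0 i * (v e).1 0 i - (u e).2 0 i * (v e).2 0 i),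
   \row_i ((u e).1 0 i * (v e).2 0 i + (u e).2 0 i * (v e).1 0 i)))).
  by move=> e; apply: cn_ext => i; rewrite !mxE.
by apply: Cinf_on_pair => //; apply: Cinf_on_matrix => // _ i;
  have [h1 h2] := Cinf_on_cn_coord oU i hu; have [h3 h4] := Cinf_on_cn_coord oU i hv; smooth.
Qed.

Lemma cos_atan_div (a b : R) : 0 < a -> cos (atan (b / a)) = a / Num.sqrt (a ^+ 2 + b ^+ 2).
Proof.
move=> a0; rewrite cos_atan (_ : 1 + _ = (a ^+ 2 + b ^+ 2) / a ^+ 2); last first.
  by field; rewrite gt_eqF.
rewrite sqrtrM ?addr_ge0 ?sqr_ge0// sqrtrV ?sqr_ge0// sqrtr_sqr gtr0_norm//.
by rewrite invfM invrK mulrC.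
Qed.

Lemma sin_atan_div (a b : R) : 0 < a -> sin (atan (b / a)) = b / Num.sqrt (a ^+ 2 + b ^+ 2).
Proof.
move=> a0; have c0 : cos (atan (b / a)) != 0.
  rewrite cos_atan_div// mulf_neq0 ?invr_eq0 ?gt_eqF// sqrtr_gt0.
  by rewrite ltr_pwDl ?exprn_gt0// sqr_ge0.
have := atanK (b / a); rewrite /tan => /(congr1 (fun t => t * cos (atan (b / a)))).
by rewrite mulfVK// cos_atan_div// => ->; rewrite mulrA divfK// gt_eqF.
Qed.

(** A smooth logarithm where all real parts are positive: for a > 0 the argument of a + i b is atan
    (b / a). *)
Definition ulog u : 'rV[R]_N := \row_i (atan (u.2 0 i / u.1 0 i) / (2 * trigo.pi)).

Lemma pi2_neq0 : 2 * trigo.pi != 0 :> R.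
Proof. by rewrite mulf_neq0 ?pnatr_eq0// gt_eqF ?pi_gt0. Qed.

Lemma ulogK u : cunit u -> (forall i, 0 < u.1 0 i) -> texp (ulog u) = u.
Proof.
move=> uu u0; apply: cn_ext => i; rewrite !cn_simp mxE.
by rewrite [2 * _ * _]mulrC mulfVK ?pi2_neq0// cos_atan_div// sin_atan_div// uu sqrtr1 !divr1.
Qed.

Lemma open_re_pos : open [set u : Cn R N | forall i, 0 < u.1 0 i].
Proof.
have oT : open (setT : set (Cn R N)) by exact: openT.
apply: open_forall => i.
have [h _] := Cinf_on_cn_coord oT i (@Cinf_on_id _ _ setT).
by have := open_pos oT h; congr open; apply/seteqP; split=> [u []//|u].
Qed.

Lemma Cinf_on_ulog (E : normedModType R) (U : set E) (u : E -> Cn R N) : open U ->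
  (forall e, U e -> forall i, 0 < (u e).1 0 i) -> Cinf_on U u ->
  Cinf_on U (fun e => ulog (u e)).
Proof.
move=> oU u0 hu; apply: Cinf_on_matrix => // _ i.
have [h1 h2] := Cinf_on_cn_coord oU i hu.
apply: Cinf_onM => //; last exact: Cinf_on_cst.
apply: Cinf_on_atan => //; apply: Cinf_onM => //; apply: Cinf_onV => // e Ue.
by rewrite gt_eqF// u0.
Qed.

Lemma ulog1 : ulog (cone R N) = 0.
Proof. by apply/rowP => i; rewrite mxE cone_im mul0r atan0 mul0r mxE. Qed.

Lemma ulog_near1 (e : R) : 0 < e -> \forall u \near cone R N,
  (forall i, 0 < (u : Cn R N).1 0 i) /\ `|ulog u| < e.
Proof.
move=> e0; have o1 : [set u : Cn R N | forall i, 0 < u.1 0 i] (cone R N).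
  by move=> i; rewrite cone_re.
have P := open_nbhs_nbhs (conj open_re_pos o1).
have C : {for cone R N, continuous ulog}.
  apply: Cinf_on_continuous o1; apply: (@Cinf_on_ulog _ _ id) => //; first exact: open_re_pos.
  exact: Cinf_on_id.
near=> u; split; first by near: u; exact: P.
have : `|ulog (cone R N) - ulog u| < e.
  by near: u; move/cvgrPdist_lt : C; apply.
by rewrite ulog1 sub0r normrN.
Unshelve. all: by end_near. Qed.

End TorusExp.

(** * Finiteness of the stabilizer *)

Section FiniteStabilizer.
Variables (R : realType) (N d : nat) (K : subtorus R N) (B : 'M[R]_(d, N)).
Variable f : 'I_d -> 'I_N.
Hypotheses (hB : lie_basis K B) (fB : colsub f B \in unitmx).

Definition stab : set (Cn R N) :=
  [set u | tset K u /\ forall j, u.1 0 (f j) = 1 /\ u.2 0 (f j) = 0].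

Lemma lie_coord0 (x : 'rV[R]_N) :
  lie_algebra K x -> (forall j, x 0 (f j) = 0) -> x = 0.
Proof.
move=> /(proj2 hB)/submxP[l ->] h.
suff -> : l = 0 by rewrite mul0mx.
suff : l *m colsub f B = 0.
  by move=> /(congr1 (mulmx^~ (invmx (colsub f B)))); rewrite mulmxK// mul0mx.
apply/rowP => j; rewrite mxE [RHS]mxE -[RHS](h j) mxE.
by apply: eq_bigr => k _; rewrite mxE.
Qed.

Lemma texp_natmul (x : 'rV[R]_N) n : tset K (texp x) -> tset K (texp (x *+ n)).
Proof.
move=> Kx; elim: n => [|n IH]; first by rewrite mulr0n texp0; exact: subtorus1.
by rewrite mulrS texpD; exact: subtorusM.
Qed.

(* Cartan's argument: directions of small logarithms of elements of [K]
   accumulate only at the Lie algebra. *)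
Lemma log_direction_lie (x : nat -> 'rV[R]_N) (xi : 'rV[R]_N) :
  (forall n, x n != 0) -> (forall n, tset K (texp (x n))) ->
  (forall e : R, 0 < e -> exists n, `|x n| < e /\ `| `|x n|^-1 *: x n - xi| < e) ->
  lie_algebra K xi.
Proof.
move=> x0 Kx hx.
have pos t : 0 <= t -> tset K (texp (t *: xi)).
  move=> t0; have /closure_id cK := @subtorus_closed _ _ K.
  rewrite -[tset K _]/((K : set _) _) cK => V.
  move=> /(@continuous_texp R N (t *: xi)) /nbhs_ballP[e /= e0 he].
  pose e' := e / (t + 2); have e'0 : 0 < e' by rewrite divr_gt0// ltr_wpDl.
  have [n [hn1 hn2]] := hx e' e'0.
  (* The multiple of [x n] by this integer part differs from t times the direction of [x n] by at
     most |x n|, and its exponential is in K. The choice of [e'] keeps the total error t e' + |x n|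
     below e. *)
  pose m := Num.truncn (t / `|x n|).
  have n0 : 0 < `|x n| by rewrite normr_gt0.
  have /andP[m1 m2] : m%:R <= t / `|x n| < m.+1%:R.
    by apply: truncn_itv; rewrite divr_ge0// ltW.
  exists (texp (x n *+ m)); split; first exact: texp_natmul.
  apply: he; rewrite -ball_normE /= /ball_ /=.
  have -> : t *: xi - x n *+ m = t *: (xi - `|x n|^-1 *: x n) + (t / `|x n| - m%:R) *: x n.
    rewrite scalerBr scalerBl scalerA scaler_nat; by rewrite -!addrA (addrA _ (_ *: x n)) addNr add0r.
  apply: le_lt_trans (ler_normD _ _) _; rewrite !normrZ (ger0_norm t0) distrC.
  rewrite [`|_ - m%:R|]ger0_norm ?subr_ge0//.
  have h2 : (t / `|x n| - m%:R) * `|x n| <= `|x n|.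
    by rewrite ler_piMl// lerBlDr addrC natr1 ltW.
  apply: (@le_lt_trans _ _ (t * e' + `|x n|)).
    by rewrite lerD// ler_wpM2l// ltW.
  rewrite (_ : e = t * e' + 2 * e'); last by rewrite -mulrDl /e' mulrC divfK// gt_eqF// ltr_wpDl.
  by rewrite ltrD2l; apply: lt_le_trans hn1 _; rewrite ler_peMl ?(ltW e'0)// ler1n.
move=> t; have [t0|t0] := leP 0 t; first exact: pos.
by rewrite -[t]opprK scaleNr texpN; apply: subtorusV; apply: pos; rewrite oppr_ge0 ltW.
Qed.

(** Otherwise the logarithms of a sequence of stabilizer elements tending to 1, once normalized,
    accumulate at a unit vector of the Lie algebra whose [f]-coordinates vanish, against
    [lie_coord0]. *)
Lemma stab_isolated : \forall u \near cone R N, stab u -> u = cone R N.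
Proof.
apply: contrapT => H.
have ex n : exists x : 'rV[R]_N, [/\ x != 0, `|x| < n.+1%:R^-1, tset K (texp x) &
    forall j, x 0 (f j) = 0].
  apply: contrapT => Hn; apply: H.
  have n0 : 0 < n.+1%:R^-1 :> R by rewrite invr_gt0.
  near=> u => su; apply: contrapT => u1; apply: Hn; exists (ulog u).
  have [u0 ul] : (forall i, 0 < u.1 0 i) /\ `|ulog u| < n.+1%:R^-1.
    by near: u; exact: ulog_near1.
  have [Ku fu] := su.
  have uu : cunit u := subtorus_cunit Ku.
  have lK := ulogK uu u0; split=> //.
  - by apply/eqP => l0; apply: u1; rewrite -lK l0 texp0.
  - by rewrite lK.
  - by move=> j; rewrite mxE; have [_ ->] := fu j; rewrite mul0r atan0 mul0r.
have [x hx] := choice ex.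
pose S : set 'rV[R]_N := [set y | `|y| = 1].
have cS : compact S.
  apply: bounded_closed_compact.
    exists 1; split=> // M M1 y /= ->; exact: ltW.
  have -> : S = (fun y : 'rV[R]_N => `|y|) @^-1` [set 1] by [].
  apply: preimage_closed; last exact: closed_eq.
  by move=> y _; exact: norm_continuous.
have x0 n : x n != 0 by case: (hx n).
have [n|xi Sxi cxi] := compact_cluster_seq (u := fun n => `|x n|^-1 *: x n) cS.
  by rewrite /S /= normrZ normfV normr_id mulVf// normr_eq0.
have Lxi : lie_algebra K xi.
  apply: (@log_direction_lie x) => //; first by move=> n; case: (hx n).
  move=> e e0.
  have [n0 hn0] : exists n0 : nat, n0.+1%:R^-1 < e.
    exists (Num.truncn e^-1); rewrite invf_plt ?posrE//.
    have ei : 0 <= e^-1 by rewrite invr_ge0 ltW.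
    by have /andP[] := truncn_itv ei.
  have [m nm Vm] := cxi _ (nbhsx_ballx xi _ e0) n0.
  exists m; split.
    have [_ + _ _] := hx m; move=> /lt_le_trans; apply; apply: le_trans (ltW hn0).
    by rewrite lef_pV2 ?posrE// ler_nat.
  by move: Vm; rewrite -ball_normE /ball_ /= distrC.
have xi0 : xi = 0.
  apply: lie_coord0 => // j; apply/eqP; rewrite -normr_le0; apply/ler_addgt0Pl => e e0.
  rewrite addr0; have [m _] := cxi _ (nbhsx_ballx xi _ e0) 0%N.
  rewrite -ball_normE /ball_ /= => h; have [_ _ _ xm0] := hx m.
  apply: le_trans (ltW h); have -> : xi 0 (f j) = (xi - `|x m|^-1 *: x m) 0 (f j).
    by rewrite !mxE xm0 mulr0 subr0.
  rewrite [leRHS]mx_normrE.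
  exact: (le_bigmax 0 (fun ij => `|(xi - `|x m|^-1 *: x m) ij.1 ij.2|) (0, f j)).
by move: Sxi; rewrite xi0 /S /= normr0 => /esym/eqP; rewrite oner_eq0.
Unshelve. all: by end_near. Qed.

Lemma stabM u v : stab u -> stab v -> stab (cmul u v).
Proof.
move=> [Ku u1] [Kv v1]; split=> [|j]; first exact: subtorusM.
by rewrite !cn_simp; have [-> ->] := u1 j; have [-> ->] := v1 j; split; ring.
Qed.

Lemma stab1 : stab (cone R N).
Proof. by split=> [|j]; [exact: subtorus1|rewrite !cn_simp]. Qed.

Lemma stabV u : stab u -> stab (cinv u).
Proof.
move=> [Ku u1]; split=> [|j]; first exact: subtorusV.
rewrite (cinvE (subtorus_cunit Ku)) /= mxE.
by have [-> ->] := u1 j; rewrite oppr0.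
Qed.

Lemma compact_subtorus : compact (tset K).
Proof.
have cb : compact [set y : 'rV[R]_N | `|y| <= 1].
  apply: bounded_closed_compact.
    by exists 1; split=> // M M1 y /= /le_trans; apply; exact: ltW.
  have -> : [set y : 'rV[R]_N | `|y| <= 1] = (fun y : 'rV[R]_N => `|y|) @^-1` [set t | t <= 1] by [].
  apply: preimage_closed; last exact: closed_le.
  by move=> y _; exact: norm_continuous.
apply: (subclosed_compact (subtorus_closed (s := K)) (compact_setX cb cb)).
move=> [u v] /subtorus_cunit uu; split; rewrite /= [leLHS]mx_normrE;
  apply: bigmax_le => // -[i0 i] _; rewrite ord1 /=; have := uu i => /= e.
  by rewrite -(@expr_le1 _ 2)// real_normK ?num_real// -e lerDl sqr_ge0.
by rewrite -(@expr_le1 _ 2)// real_normK ?num_real// -e lerDr sqr_ge0.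
Qed.

Lemma cmul_cinv_eq1 u v : cunit v -> cmul u (cinv v) = cone R N -> u = v.
Proof.
move=> uv e; have : cmul (cmul u (cinv v)) v = v.
  by rewrite e; apply: cn_ext => i; rewrite !cn_simp; split; ring.
move=> <-; rewrite (cinvE uv); apply: cn_ext => i; rewrite !cn_simp /= mxE.
by split; rewrite -[LHS]mulr1 -(uv i); ring.
Qed.

(** An injective sequence in [stab] would accumulate at some p of the compact group K. Two of its
    terms close to p have a quotient close to p / p = 1, which must be 1 by [stab_isolated]. *)
Lemma stab_finite : finite_set stab.
Proof.
apply: contrapT => /infiniteP/pcard_leP/unsquash a.
have Sa n : stab (a n) by exact: funS.
have [n|p Kp cp] := compact_cluster_seq (u := a) compact_subtorus.
  by case: (Sa n).
have pp : cunit p := subtorus_cunit Kp.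
(* The quotient is written with the conjugate, which is continuous everywhere and agrees with the
   inverse on K. *)
have phic : {for (p, p), continuous (fun q : Cn R N * Cn R N => cmul q.1 (q.2.1, - q.2.2))}.
  have oT : open (setT : set (Cn R N * Cn R N)%type) by exact: openT.
  apply: (Cinf_on_continuous (U := setT)) => //.
  have h1 := Cinf_on_fst oT (@Cinf_on_id _ _ setT).
  have h2 := Cinf_on_snd oT (@Cinf_on_id _ _ setT).
  apply: Cinf_on_cmul => //; apply: Cinf_on_pair => //; first exact: Cinf_on_fst.
  by apply: Cinf_onN => //; exact: Cinf_on_snd.
have W : nbhs (cmul p (p.1, - p.2)) [set w | stab w -> w = cone R N].
  suff -> : cmul p (p.1, - p.2) = cone R N by exact: stab_isolated.
  by rewrite -cinvE// (cmulV Kp).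
have := phic _ W.
move=> [[V1 V2] /= [pV1 pV2] V12].
have pV : nbhs p (V1 `&` V2) by exact: filterI.
have [m _ [Vm _]] := cp _ pV 0%N.
have [l ml [_ Vl]] := cp _ pV m.+1.
have Kl : tset K (a l) by case: (Sa l).
have := V12 (a m, a l) (conj Vm Vl) => /=; rewrite -(cinvE (subtorus_cunit Kl)).
move=> /(_ (stabM (Sa m) (stabV (Sa l)))) /(cmul_cinv_eq1 (subtorus_cunit Kl)) /inj.
by rewrite !inE => /(_ Logic.I Logic.I) E; rewrite E ltnn in ml.
Qed.

End FiniteStabilizer.

(** * Orbit spaces and slices *)

Section SmoothOn.
Variable R : realType.
Implicit Types E F G : normedModType R.

Lemma Cinf_smooth_on E F (A U : set E) (f g : E -> F) :
  open U -> A `<=` U -> Cinf_on U g -> (forall x, A x -> g x = f x) -> smooth_on A f.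
Proof.
by move=> oU AU hg gf x Ax; exists U, g; split=> //; [exact: AU|move=> y Ay _; exact: gf].
Qed.

Lemma smooth_on_eq E F (A : set E) (f g : E -> F) :
  (forall x, A x -> f x = g x) -> smooth_on A f -> smooth_on A g.
Proof.
move=> fg hf x Ax; have [W [h [oW Wx hh hf']]] := hf x Ax.
by exists W, h; split=> // y Ay Wy; rewrite -fg// hf'.
Qed.

Lemma open_preim E F (W : set E) (W' : set F) (g : E -> F) :
  open W -> Cinf_on W g -> open W' -> open [set x | W x /\ W' (g x)].
Proof.
move=> oW hg oW'; rewrite openE => x [Wx W'x]; rewrite /interior.
have cg : g @ x --> g x by exact: Cinf_on_continuous hg Wx.
have n' : nbhs (g x) W' by exact: open_nbhs_nbhs.
near=> y; split; near: y; [exact: open_nbhs_nbhs|exact: cg n'].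
Unshelve. all: by end_near. Qed.

Lemma smooth_on_comp E F G (A : set E) (B : set F) (f : E -> F) (g : F -> G) :
  findim F -> smooth_on A f -> smooth_on B g -> (forall x, A x -> B (f x)) ->
  smooth_on A (fun x => g (f x)).
Proof.
move=> hF hf hg AB x Ax; have [W [f' [oW Wx hf' ff']]] := hf x Ax.
have [W' [g' [oW' W'x hg' gg']]] := hg (f x) (AB x Ax).
have oP := open_preim oW hf' oW'.
exists [set x | W x /\ W' (f' x)], (fun x => g' (f' x)); split=> //.
- by split=> //; rewrite ff'.
- apply: (@Cinf_on_comp _ _ _ _ _ W') => //; first by move=> y [].
  by move=> k; apply: Ck_on_sub (hf' k) => y [].
- by move=> y Ay [Oy]; rewrite ff'// => W'y; rewrite gg'//; exact: AB.
Qed.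

Lemma smooth_on_pair E F G (A : set E) (f : E -> F) (g : E -> G) :
  smooth_on A f -> smooth_on A g -> smooth_on A (fun x => (f x, g x)).
Proof.
move=> hf hg x Ax; have [W [f' [oW Wx hf' ff']]] := hf x Ax.
have [W' [g' [oW' W'x hg' gg']]] := hg x Ax.
have oI := openI oW oW'.
exists (W `&` W'), (fun x => (f' x, g' x)); split=> //.
- apply: Cinf_on_pair => // k; first by apply: Ck_on_sub (hf' k) => y [].
  by apply: Ck_on_sub (hg' k) => y [].
- by move=> y Ay [Oy W'y]; rewrite ff'// gg'.
Qed.

Lemma smooth_on_lin E F (A : set E) (L : {linear E -> F}) : findim E -> smooth_on A L.
Proof.
move=> hE; apply: (Cinf_smooth_on (openT : open (setT : set E)) _ (g := L)) => // k.
by apply: Ck_on_lin; exact: findim_continuous.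
Qed.

Lemma smooth_on_near E F (A : set E) (f : E -> F) x (V : set F) :
  smooth_on A f -> A x -> nbhs (f x) V -> \forall y \near x, A y -> V (f y).
Proof.
move=> hf Ax fV; have [W [g [oW Wx hg gf]]] := hf x Ax.
have cg : g @ x --> g x by exact: Cinf_on_continuous hg Wx.
rewrite gf// in cg; near=> y => Ay; rewrite -gf//; near: y; last exact: open_nbhs_nbhs.
exact: cg fV.
Unshelve. all: by end_near. Qed.

End SmoothOn.

Lemma cmulC (R : realType) N (u v : Cn R N) : cmul u v = cmul v u.
Proof. by apply: cn_ext => i; rewrite !cn_simp; split; ring. Qed.

Section OrbitSpaces.
Variables (R : realType) (N : nat) (M : set (Hn R N)) (K : subtorus R N).

Local Notation piM := (@orbit_pi R N M K).

Lemma orbit_pi_repr (x : orbit_space M K) : exists m : M, piM m = x.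
Proof. by exists (repr x); exact: reprK. Qed.

Lemma orbit_piP (m m' : M) : piM m = piM m' <->
  exists2 u, tset K u & set_val m' = tact (set_val m) u.
Proof.
rewrite /orbit_pi; split; first by move/eqquotP => /asboolP.
by move=> h; apply/eqquotP/asboolP.
Qed.

Lemma open_set_type (A : set M) :
  open A <-> exists2 W : set (Hn R N), open W & A = set_val @^-1` W.
Proof. by split=> [[W oW <-]|[W oW ->]]; exists W. Qed.

Lemma open_set_type_near (A : set M) :
  (forall m : M, A m -> \forall q \near set_val m, forall m' : M, set_val m' = q -> A m') ->
  open A.
Proof.
move=> h; apply/open_set_type.
exists [set q | \forall q' \near q, forall m' : M, set_val m' = q' -> A m'].
  by rewrite openE => q /=; exact: nbhs_interior.
apply/seteqP; split=> m /= Am; first exact: h.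
exact: (nbhs_singleton Am) m erefl.
Qed.

Lemma orbit_open (W : set (orbit_space M K)) : open W <-> open (piM @^-1` W).
Proof. by []. Qed.

Lemma orbit_pi_continuous : continuous piM.
Proof. exact: pi_continuous. Qed.

Lemma orbit_continuous (T : topologicalType) (f : orbit_space M K -> T) :
  continuous (f \o piM) -> continuous f.
Proof. by move=> h; apply/quotient_continuous. Qed.

Lemma continuous_tact (u : Cn R N) : cunit u -> continuous ((@tact R N)^~ u).
Proof.
move=> uu; have -> : (@tact R N)^~ u = (fun q => tactU q u).
  by apply/funext => q; exact: tactE.
move=> q; have oT : open (setT : set (Hn R N)) by exact: openT.
apply: (Cinf_on_continuous (U := setT)) => //; apply: Cinf_on_tactU => //.
  exact: Cinf_on_id.
exact: Cinf_on_cst.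
Qed.

Hypothesis MK : forall q u, M q -> tset K u -> M (tact q u).

Lemma orbit_pi_open (A : set M) : open A -> open (piM @` A).
Proof.
move=> /open_set_type[W oW ->]; apply/orbit_open/open_set_type_near => m [m' Om' /orbit_piP[u Ku e]].
have e' : set_val m' = tact (set_val m) (cinv u).
  by rewrite e tactM (cmulV Ku) tact1.
have Kv := subtorusV Ku.
have ct : (@tact R N)^~ (cinv u) @ set_val m --> tact (set_val m) (cinv u).
  by apply: continuous_tact; exact: subtorus_cunit Kv.
have nW : nbhs (tact (set_val m) (cinv u)) W by apply: open_nbhs_nbhs; rewrite -e'.
have nV : \forall q \near set_val m, W (tact q (cinv u)) by exact: ct nW.
near=> q => m2 m2q; have Oq : W (tact q (cinv u)) by near: q.
have Mm2 : M (tact (set_val m2) (cinv u)) by apply: MK Kv; exact: set_valP.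
exists (SigSub (mem_set Mm2)); first by rewrite -m2q in Oq.
apply/orbit_piP; exists u => //=.
by rewrite tactM cmulC (cmulV Ku) tact1.
Unshelve. all: by end_near. Qed.

End OrbitSpaces.

Section Slices.
Variables (R : realType) (N : nat).

(* The part of [orbit_atlas] that does not mention the orbit space. *)
Record is_slice (M : set (Hn R N)) (K : subtorus R N) (E : normedModType R)
    (U : set E) (G : finGroupType) (act : G -> E -> E) (j : G -> Cn R N)
    (s : E -> Hn R N) : Prop := IsSlice {
  slice_open : open U;
  slice_act_dom : forall g x, U x -> U (act g x);
  slice_act_smooth : forall g, smooth_on U (act g);
  slice_act1 : forall x, U x -> act 1%g x = x;
  slice_actM : forall g h x, U x -> act (g * h)%g x = act g (act h x);
  slice_smooth : smooth_on U s;
  slice_level : forall x, U x -> M (s x);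
  slice_inj : injective j;
  slice_sub : forall g, tset K (j g);
  slice_mor : forall g h, j (g * h)%g = cmul (j g) (j h);
  slice_local_diffeo : local_diffeo (U `*` tset K) M
    (fun p : E * Cn R N => tact (s p.1) p.2);
  slice_orbit : forall x y a b, U x -> U y -> tset K a -> tset K b ->
    (tact (s x) a = tact (s y) b <-> exists2 g, y = act g x & a = cmul (j g) b)
}.

Variables (M : set (Hn R N)) (K : subtorus R N) (E : normedModType R).
Variables (U : set E) (G : finGroupType) (act : G -> E -> E) (j : G -> Cn R N).
Variable s : E -> Hn R N.
Hypothesis S : is_slice M K U act j s.
Variable m0 : M.

Local Notation piM := (@orbit_pi R N M K).

(** The map of a chart is a total function, so points outside [M] are sent to the base point [m0];
    this happens only for parameters outside [U]. *)
Definition in_level (q : Hn R N) : M :=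
  if pselect (M q) is left h then SigSub (mem_set h) else m0.

Lemma in_levelK q : M q -> set_val (in_level q) = q.
Proof. by rewrite /in_level; case: pselect. Qed.

Definition slice_chart : orbichart E (orbit_space M K) :=
  OrbiChart U act (fun x => piM (in_level (s x))).

Lemma slice_chart_continuous x : U x ->
  {for x, continuous (fun x => piM (in_level (s x)))}.
Proof.
move=> Ux; suff H : (fun x => piM (in_level (s x))) @ x --> piM (in_level (s x)) by [].
move=> V /=; rewrite nbhsE => -[W [oW Wx] WV].
have /open_set_type[D oD e] := (proj1 (orbit_open W)) oW.
have sD : nbhs (s x) D.
  apply: open_nbhs_nbhs; split=> //.
  have : (piM @^-1` W) (in_level (s x)) by [].
  by rewrite e /= in_levelK//; exact: slice_level S _ Ux.
have nU : nbhs x U by apply: open_nbhs_nbhs; split=> //; exact: slice_open S.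
have nO := smooth_on_near (slice_smooth S) Ux sD.
suff : nbhs x [set y | W (piM (in_level (s y)))] by apply: filterS => y; exact: WV.
near=> y => /=; have Uy : U y by near: y.
suff : (piM @^-1` W) (in_level (s y)) by [].
rewrite e /= in_levelK; first by move: Uy; near: y.
exact: slice_level S _ Uy.
Unshelve. all: by end_near. Qed.

Lemma tset_cone : tset K (cone R N). Proof. exact: subtorus1. Qed.

(** The local inverse of (x, a) |-> s(x) a writes every point of [M] near s(x) u as a translate of
    some s(x') with x' close to x, hence in [D]. *)
Lemma slice_chart_open D : open D -> D `<=` U ->
  open ((fun x => piM (in_level (s x))) @` D).
Proof.
move=> oD DU; apply/orbit_open/open_set_type_near => m [x Dx] /= /orbit_piP[u Ku].
have Ux := DU x Dx; rewrite in_levelK; last exact: slice_level S _ Ux.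
move=> mE.
have [W1 [W2 [oW1 W1x oW2 [g [hF hg Fg gF]]]]] :=
  slice_local_diffeo S (conj Ux Ku : (U `*` tset K) (x, u)).
have [[_ W2m] gm] := Fg (x, u) (conj (conj Ux Ku) W1x).
rewrite /= -mE in W2m gm.
have nV : nbhs (g (set_val m)) [set p | D p.1].
  rewrite gm; have : open_nbhs x D by [].
  move=> /open_nbhs_nbhs nD; exact: (@cvg_fst _ _ (nbhs x) (nbhs u) _ D nD).
have Mm : M (set_val m) by exact: set_valP.
have nO := smooth_on_near hg (conj Mm W2m) nV.
have nW2 : nbhs (set_val m) W2 by exact: open_nbhs_nbhs.
near=> q => m' m'q.
have Mq : M q by rewrite -m'q; exact: set_valP.
have W2q : W2 q by near: q.
have Dg : D (g q).1 by have := conj Mq W2q : (M `&` W2) q; near: q.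
have [[[Ug Kg] _] gE] := gF q (conj Mq W2q).
exists (g q).1 => //; apply/orbit_piP; exists (g q).2 => //.
by rewrite in_levelK ?m'q//; exact: slice_level S _ Ug.
Unshelve. all: by end_near. Qed.

Lemma slice_chart_is_chart : is_orbichart slice_chart.
Proof.
split=> /=.
- exact: slice_open S.
- exact: slice_act_dom S.
- exact: slice_act_smooth S.
- exact: slice_act1 S.
- exact: slice_actM S.
- exact: slice_chart_continuous.
- exact: slice_chart_open.
move=> x y Ux Uy; have K1 := tset_cone.
have Mx := slice_level S Ux; have My := slice_level S Uy; split.
  move=> /orbit_piP[u Ku]; rewrite !in_levelK// => e.
  have /(slice_orbit S Ux Uy Ku K1)[g ->] : tact (s x) u = tact (s y) (cone R N).
    by rewrite tact1.
  by exists g.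
move=> [g yE]; apply/orbit_piP; exists (j g); first exact: slice_sub S _.
rewrite !in_levelK//; apply/esym; rewrite -[RHS]tact1.
apply/(slice_orbit S Ux Uy (slice_sub S _) K1); exists g => //.
by apply: cn_ext => i; rewrite !cn_simp; split; ring.
Qed.

Lemma slice_chart_atlas : orbit_atlas slice_chart.
Proof.
split; first exact: slice_chart_is_chart.
exists j, s; split.
- by split; [exact: slice_inj S|exact: slice_sub S].
- exact: slice_mor S.
- exact: slice_local_diffeo S.
- exact: slice_orbit S.
- by move=> x Ux; exists (in_level (s x)) => //; rewrite in_levelK//; exact: slice_level S _ Ux.
Qed.

End Slices.

(** * The trivialization *)

Section Trivialization.
Variables (R : realType) (N d : nat) (K : subtorus R N) (B : 'M[R]_(d, N)).
Variable alpha : 'rV[R]_d.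
Hypothesis reg : regular_value (hk_moment B) (alpha, 0).

Local Notation XL := (level_L B alpha).
Local Notation XX := (level_X B alpha 0).

Lemma tact_invariants (q : Hn R N) u : cunit u ->
  [/\ xv (tact q u) = xv q, y1v (tact q u) = y1v q & y2v (tact q u) = y2v q].
Proof. by move=> uu; rewrite (tactE q uu); exact: tactU_inv. Qed.

Lemma mu1_tact (q : Hn R N) u : cunit u -> mu1 B (tact q u) = mu1 B q.
Proof. by move=> uu; rewrite !mu1E; have [-> _ _] := tact_invariants q uu. Qed.

Lemma muC_tact (q : Hn R N) u : cunit u -> muC B (tact q u) = muC B q.
Proof. by move=> uu; rewrite !muCE; have [_ -> ->] := tact_invariants q uu. Qed.

Lemma level_X_tact q u : XX q -> tset K u -> XX (tact q u).
Proof. by move=> [/= qa qc] /subtorus_cunit uu; rewrite /level_X /= mu1_tact// muC_tact. Qed.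

(** An open neighbourhood of the level of [mu1] on which the shift of [muC] is smooth; it carries
    the ambient extensions that [smooth_on] asks for. *)
Definition gram_dom : set (Hn R N) := [set q | gram B (xv q) \in unitmx].

Lemma open_gram_dom : open gram_dom.
Proof.
have oT : open (setT : set (Hn R N)) by exact: openT.
have h := Cinf_onX 2 oT (Cinf_on_det oT (Cinf_on_gram oT B (@Cinf_on_id _ _ setT))).
have := open_pos oT h; congr open; apply/seteqP; split=> [q /= [_]|q].
  by rewrite /gram_dom /= unitmxE unitfE; rewrite exprn_even_gt0.
by rewrite /gram_dom /= unitmxE unitfE => q0; rewrite exprn_even_gt0.
Qed.

Lemma level_L_gram q : XL q -> gram_dom q.
Proof. by move=> /= qa; exact: gram_unit reg qa. Qed.

Lemma level_X_L q : XX q -> XL q. Proof. by case. Qed.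

Definition retract_X (q : Hn R N) := muC_shift B q (- muC B q).

Lemma retract_X_level q : XL q -> XX (retract_X q).
Proof.
move=> qa; split; first by rewrite /retract_X mu1_muC_shift.
by rewrite muC_muC_shift ?subrr//; exact: level_L_gram.
Qed.

Lemma muC_shift_level q b : XX q -> XL (muC_shift B q b) /\ muC B (muC_shift B q b) = b.
Proof.
move=> qX; split; first by rewrite /level_L /= mu1_muC_shift; exact: level_X_L.
by rewrite muC_muC_shift; [case: qX => _ ->; rewrite add0r|exact/level_L_gram/level_X_L].
Qed.

Lemma retract_XK q : muC_shift B (retract_X q) (muC B q) = q.
Proof. by rewrite -[X in muC_shift _ _ X]opprK muC_shiftNK. Qed.

Lemma muC_shiftK q b : XX q -> retract_X (muC_shift B q b) = q.
Proof. by move=> qX; rewrite /retract_X (proj2 (muC_shift_level b qX)) muC_shiftNK. Qed.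

Lemma muC_shift_inj q q' b b' : XX q -> XX q' ->
  muC_shift B q b = muC_shift B q' b' -> q = q' /\ b = b'.
Proof.
move=> qX qX' e; split; first by rewrite -(muC_shiftK b qX) e muC_shiftK.
by rewrite -(proj2 (muC_shift_level b qX)) e (proj2 (muC_shift_level b' qX')).
Qed.

Lemma retract_X_tact q u : cunit u -> retract_X (tact q u) = tact (retract_X q) u.
Proof. by move=> uu; rewrite /retract_X muC_tact// muC_shift_tact. Qed.

Lemma Cinf_on_retract_X : Cinf_on gram_dom retract_X.
Proof.
have oG := open_gram_dom; have hid := @Cinf_on_id _ (Hn R N) gram_dom.
apply: Cinf_on_muC_shift => //; apply: Cinf_onN => //; exact: Cinf_on_muC.
Qed.

Definition shift_dom : set (Hn R N * Cn R d) := [set p | setT p /\ gram_dom p.1].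

Lemma open_shift_dom : open shift_dom.
Proof.
have oT : open (setT : set (Hn R N * Cn R d)) by exact: openT.
have hid := @Cinf_on_id _ (Hn R N * Cn R d)%type setT.
exact: (open_preim oT (Cinf_on_fst oT hid) open_gram_dom).
Qed.

Lemma Cinf_on_shift_dom : Cinf_on shift_dom
  (fun p : Hn R N * Cn R d => muC_shift B p.1 p.2).
Proof.
have oG := open_shift_dom; have hid := @Cinf_on_id _ (Hn R N * Cn R d)%type shift_dom.
by apply: Cinf_on_muC_shift => //; [move=> e []|exact: Cinf_on_fst|exact: Cinf_on_snd].
Qed.

Lemma smooth_on_muC_shift : smooth_on (XX `*` [set: Cn R d])
  (fun p : Hn R N * Cn R d => muC_shift B p.1 p.2).
Proof.
apply: (Cinf_smooth_on open_shift_dom _ Cinf_on_shift_dom) => //.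
by move=> [q b] [/= qX _]; split=> //; exact/level_L_gram/level_X_L.
Qed.

(** * Slices of the level of [mu1] obtained from slices of the zero level *)

Section TransportSlice.
Variables (E E' : normedModType R) (psi : {linear E' -> (E * Cn R d)%type})
  (phi : {linear (E * Cn R d)%type -> E'}).
Hypotheses (psiK : cancel psi phi) (phiK : cancel phi psi).
Hypotheses (fE : findim E) (fE' : findim E').
Variables (U : set E) (G : finGroupType) (act : G -> E -> E) (j : G -> Cn R N).
Variable s : E -> Hn R N.
Hypothesis S : is_slice XX K U act j s.

Definition tr_dom : set E' := [set e | U (psi e).1].
Definition tr_act g e := phi (act g (psi e).1, (psi e).2).
Definition tr_slice e := muC_shift B (s (psi e).1) (psi e).2.

Let fEC : findim (E * Cn R d)%type.
Proof. by apply: findim_prod => //; exact: findim_Cn. Qed.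

Let smooth_psi1 (A : set E') : smooth_on A (fun e => (psi e).1).
Proof. exact: (@smooth_on_lin _ _ _ A (fst \o psi : {linear E' -> E})). Qed.

Let smooth_psi2 (A : set E') : smooth_on A (fun e => (psi e).2).
Proof. exact: (@smooth_on_lin _ _ _ A (snd \o psi : {linear E' -> Cn R d})). Qed.

Lemma tr_diffeo : diffeo tr_dom (U `*` [set: Cn R d]) psi.
Proof.
exists phi; split; [exact: smooth_on_lin|exact: smooth_on_lin| |].
  by move=> e /= Ue; rewrite psiK.
by move=> [e b] [/= Ue _]; rewrite /tr_dom /= phiK.
Qed.

(** By equivariance of [muC_shift], this map is the one of the zero level times the identity of
    k_C^*, followed by the trivialization. Its local inverse first splits [q] into [retract_X B q]
    and [muC B q]. *)
Lemma tr_local_diffeo : local_diffeo (tr_dom `*` tset K) XL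
  (fun p : E' * Cn R N => tact (tr_slice p.1) p.2).
Proof.
move=> [e u] [/= Ue Ku].
have [W1 [W2 [oW1 W1x oW2 [g [hF hg Fg gF]]]]] :=
  slice_local_diffeo S (conj Ue Ku : (U `*` tset K) ((psi e).1, u)).
have oT : open (setT : set (E' * Cn R N)) by exact: openT.
pose pr (p : E' * Cn R N) : E * Cn R N := ((psi p.1).1, p.2).
have pr_smooth : Cinf_on setT pr.
  apply: Cinf_on_pair => //; last by apply: Cinf_on_snd => //; exact: Cinf_on_id.
  apply: Cinf_on_fst => //; apply: (Cinf_on_linl (L := psi)) => //.
    exact: findim_continuous.
  by apply: Cinf_on_fst => //; exact: Cinf_on_id.
have oV1 := open_preim oT pr_smooth oW1.
have oV2 := open_preim open_gram_dom Cinf_on_retract_X oW2.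
exists [set p | setT p /\ W1 (pr p)], [set q | gram_dom q /\ W2 (retract_X q)].
split=> //.
have FE p : (tr_dom `*` tset K) p ->
    tact (tr_slice p.1) p.2 = muC_shift B (tact (s (psi p.1).1) p.2) (psi p.1).2.
  by move=> [_ /subtorus_cunit uu]; rewrite muC_shift_tact.
pose gL q : E' * Cn R N := (phi ((g (retract_X q)).1, muC B q), (g (retract_X q)).2).
have fEN : findim (E * Cn R N)%type by apply: findim_prod => //; exact: findim_Cn.
have F_level p : (U `*` tset K) p -> XX (tact (s p.1) p.2).
  by move=> [Up Kp]; apply: level_X_tact => //; exact: (slice_level S Up).
exists gL; split.
- apply: (smooth_on_eq (f := fun p => muC_shift B (tact (s (psi p.1).1) p.2) (psi p.1).2)).
    by move=> p [Ap _]; rewrite FE.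
  apply: (@smooth_on_comp _ _ _ _ _ (XX `*` setT)
    (fun p : E' * Cn R N => (tact (s (psi p.1).1) p.2, (psi p.1).2))
    (fun p : Hn R N * Cn R d => muC_shift B p.1 p.2)).
  + by apply: findim_prod; [exact: findim_Hn|exact: findim_Cn].
  + apply: smooth_on_pair.
      apply: (smooth_on_comp fEN (B := (U `*` tset K) `&` W1) (f := pr)
        (g := fun p => tact (s p.1) p.2)) => //.
        exact: (Cinf_smooth_on oT _ pr_smooth).
      by move=> p [[/= Up Kp] [_ W1p]].
    apply: (@smooth_on_lin _ _ _ _ (snd \o (psi \o fst) : {linear (E' * Cn R N)%type -> Cn R d})).
    by apply: findim_prod => //; exact: findim_Cn.
  + exact: smooth_on_muC_shift.
  + by move=> p [[Up Kp] _]; split; [exact: (F_level (pr p) (conj Up Kp))|exact: Logic.I].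
- have hr (A : set (Hn R N)) : A `<=` gram_dom -> smooth_on A retract_X.
    by move=> AG; exact: (Cinf_smooth_on open_gram_dom AG Cinf_on_retract_X).
  have hgr : smooth_on (XL `&` [set q | gram_dom q /\ W2 (retract_X q)]) (fun q => g (retract_X q)).
    apply: (smooth_on_comp (@findim_Hn R N) _ hg); first by apply: hr => q [_ []].
    by move=> q [qL [_ W2q]]; split=> //; exact: retract_X_level.
  have hg1 := smooth_on_comp fEN hgr (@smooth_on_lin _ _ _ setT (fst : {linear (E * Cn R N)%type -> E}) fEN) (fun _ _ => Logic.I).
  have hg2 := smooth_on_comp fEN hgr (@smooth_on_lin _ _ _ setT (snd : {linear (E * Cn R N)%type -> Cn R N}) fEN) (fun _ _ => Logic.I).
  apply: smooth_on_pair => //.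
  apply: (@smooth_on_comp _ _ _ _ _ setT (fun q => ((g (retract_X q)).1, muC B q)) phi) => //.
    apply: smooth_on_pair => //.
    have oT' : open (setT : set (Hn R N)) by exact: openT.
    apply: (Cinf_smooth_on oT' (g := muC B)) => //.
    by apply: Cinf_on_muC => //; exact: Cinf_on_id.
  exact: smooth_on_lin.
- move=> p [Ap [_ W1p]]; have [/= Up Kp] := Ap.
  have Xp := F_level (pr p) (conj Up Kp).
  have [[_ W2p] gp] := Fg (pr p) (conj (conj Up Kp) W1p).
  rewrite FE// /gL; have [h1 h2] := muC_shift_level (psi p.1).2 Xp.
  rewrite muC_shiftK// h2 gp /=; split; last by rewrite -surjective_pairing psiK -surjective_pairing.
  by split; [exact: h1|split; [exact: level_L_gram h1|exact: W2p]].
- move=> q [qL [qG W2q]]; have Xq := retract_X_level qL.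
  have [[[Ug Kg] W1g] gE] := gF (retract_X q) (conj Xq W2q).
  have Ap : (tr_dom `*` tset K) (gL q) by split=> //; rewrite /tr_dom /gL /= phiK.
  split; last by rewrite FE// /gL /= phiK /= gE retract_XK.
  by split=> //; split=> //; rewrite /pr /gL /= phiK /= -surjective_pairing.
Qed.

Lemma tr_is_slice : is_slice XL K tr_dom tr_act j tr_slice.
Proof.
have oU := slice_open S.
split.
- have := @open_preim _ _ _ _ _ (fun e => (psi e).1) (openT : open (setT : set E')) _ oU.
  move=> h; have := h (Cinf_on_linl (L := (fst \o psi : {linear E' -> E})) openT
    (findim_continuous fE') (@Cinf_on_id _ _ setT)).
  by congr open; apply/seteqP; split=> [e []//|e].
- by move=> g e Ue; rewrite /tr_dom /tr_act /= phiK; exact: (slice_act_dom S _ Ue).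
- move=> g.
  apply: (@smooth_on_comp _ _ _ _ _ setT (fun e => (act g (psi e).1, (psi e).2)) phi) => //.
    apply: smooth_on_pair => //.
    exact: (@smooth_on_comp _ _ _ _ tr_dom U (fun e => (psi e).1) (act g) fE (@smooth_psi1 tr_dom) (slice_act_smooth S g) (fun _ h => h)).
  exact: smooth_on_lin.
- by move=> e Ue; rewrite /tr_act (slice_act1 S)// -surjective_pairing psiK.
- by move=> g h e Ue; rewrite /tr_act phiK (slice_actM S).
- apply: (@smooth_on_comp _ _ _ _ _ (XX `*` setT) (fun e => (s (psi e).1, (psi e).2))
    (fun p : Hn R N * Cn R d => muC_shift B p.1 p.2)).
  + by apply: findim_prod; [exact: findim_Hn|exact: findim_Cn].
  + apply: smooth_on_pair => //; exact: (@smooth_on_comp _ _ _ _ tr_dom U (fun e => (psi e).1) s fE (@smooth_psi1 tr_dom) (slice_smooth S) (fun _ h => h)).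
  + exact: smooth_on_muC_shift.
  + by move=> e Ue; split=> //; exact: (slice_level S Ue).
- by move=> e Ue; case: (muC_shift_level (psi e).2 (slice_level S Ue)).
- exact: slice_inj S.
- exact: slice_sub S.
- exact: slice_mor S.
- exact: tr_local_diffeo.
move=> x y a b Ux Uy Ka Kb.
have [ua ub] := (subtorus_cunit Ka, subtorus_cunit Kb).
have Xx := level_X_tact (slice_level S Ux) Ka; have Xy := level_X_tact (slice_level S Uy) Kb.
have ex : tact (tr_slice x) a = muC_shift B (tact (s (psi x).1) a) (psi x).2.
  exact: esym (muC_shift_tact B _ _ ua).
have ey : tact (tr_slice y) b = muC_shift B (tact (s (psi y).1) b) (psi y).2.
  exact: esym (muC_shift_tact B _ _ ub).
(* On the zero level [muC_shift] is injective in the pair of its arguments, so the equality splits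
   into one between translates of [s] and one between second components. *)
split=> [e|[g yE aE]].
  have [/(slice_orbit S Ux Uy Ka Kb)[g yE aE] xyE] :=
    muC_shift_inj Xx Xy (etrans (esym ex) (etrans e ey)).
  by exists g => //; rewrite /tr_act xyE -yE -surjective_pairing psiK.
have psiy : psi y = (act g (psi x).1, (psi x).2) by rewrite yE phiK.
have e1 : tact (s (psi x).1) a = tact (s (psi y).1) b.
  by apply/(slice_orbit S Ux Uy Ka Kb); exists g; rewrite ?psiy.
have e2 : (psi x).2 = (psi y).2 by rewrite psiy.
exact: etrans ex (etrans (congr2 (muC_shift B) e1 e2) (esym ey)).
Qed.

End TransportSlice.

End Trivialization.

(** The dimension is an equation with a variable on one side, so that it can be eliminated and no
    cast between spaces of row vectors remains. *)
Lemma split_rV_iso (R : realType) (m n d : nat) : (m + (d + d))%N = n ->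
  exists (psi : {linear 'rV[R]_n -> ('rV[R]_m * Cn R d)%type})
    (phi : {linear ('rV[R]_m * Cn R d)%type -> 'rV[R]_n}),
    cancel psi phi /\ cancel phi psi.
Proof.
case: n /.
pose psi (x : 'rV[R]_(m + (d + d))) : 'rV[R]_m * Cn R d :=
  (lsubmx x, (lsubmx (rsubmx x), rsubmx (rsubmx x))).
pose phi (p : 'rV[R]_m * Cn R d) : 'rV[R]_(m + (d + d)) :=
  row_mx p.1 (row_mx p.2.1 p.2.2).
have psil : linear psi by move=> a x y; rewrite /psi !linearP.
have phil : linear phi.
  by move=> a [x [y z]] [x' [y' z']]; rewrite /phi /= !scale_row_mx !add_row_mx.
pose psiL : {linear _ -> _} := HB.pack psi (GRing.isLinear.Build _ _ _ _ _ psil).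
pose phiL : {linear _ -> _} := HB.pack phi (GRing.isLinear.Build _ _ _ _ _ phil).
exists psiL, phiL; split=> [x|[x [y z]]]; rewrite /= /psi /phi /=.
  by rewrite !hsubmxK.
by rewrite !(row_mxKl, row_mxKr).
Qed.

(** * Homotopy equivalence with a factor, by scaling the linear one *)

Section Homotopy.
Variable R : realType.

Lemma homotopy_equivalent_prod (T T' : topologicalType) (V : normedModType R)
    (f : T -> T' * V) (f' : T' * V -> T) :
  continuous f -> continuous f' -> cancel f f' -> cancel f' f ->
  homotopy_equivalent R T' T.
Proof.
move=> fc fc' fK fK'.
have cp : continuous (fun x : T' => (x, 0 : V)).
  by move=> x; apply: cvg_pair; [exact: cvg_id|exact: cvg_cst].
exists (fun x => f' (x, 0)), (fun y => (f y).1); split.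
- by move=> x; apply: continuous_comp; [exact: cp|exact: fc'].
- by move=> y; apply: continuous_comp; [exact: fc|exact: cvg_fst].
- exists (fun p => p.2); split=> [|x|x]; [|by rewrite /= fK'|by []].
  by apply: continuous_subspaceT => p; exact: cvg_snd.
exists (fun p => f' ((f p.2).1, p.1 *: (f p.2).2)); split.
- apply: continuous_subspaceT => p; apply: continuous_comp; last exact: fc'.
  have h : continuous (fun p : R * T => f p.2).
    by move=> q; apply: continuous_comp; [exact: cvg_snd|exact: fc].
  apply: cvg_pair.
    by apply: (continuous_comp (h p)); exact: cvg_fst.
  apply: cvgZ; first exact: cvg_fst.
  by apply: (continuous_comp (h p)); exact: cvg_snd.
- by move=> x /=; rewrite scale0r.
- by move=> x /=; rewrite scale1r -surjective_pairing fK.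
Qed.

End Homotopy.

(** * Descent of the trivialization to the orbit spaces *)

Section Main.
Variables (R : realType) (N d : nat) (K : subtorus R N) (B : 'M[R]_(d, N)).
Variable alpha : 'rV[R]_d.
Hypothesis hB : lie_basis K B.
Hypothesis reg : regular_value (hk_moment B) (alpha, 0).

Local Notation XL := (level_L B alpha).
Local Notation XX := (level_X B alpha 0).
Local Notation piL := (@orbit_pi R N XL K).
Local Notation piX := (@orbit_pi R N XX K).

Definition to_X (m : XL) : XX := SigSub (mem_set (retract_X_level reg (set_valP m))).
Definition to_L (m : XX) (b : Cn R d) : XL :=
  SigSub (mem_set (proj1 (muC_shift_level reg b (set_valP m)))).

Lemma to_XE m : set_val (to_X m) = retract_X B (set_val m). Proof. by []. Qed.

Lemma to_LE m b : set_val (to_L m b) = muC_shift B (set_val m) b. Proof. by []. Qed.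

Definition triv_map (l : L_space K B alpha) : X_space K B alpha 0 * Cn R d :=
  (piX (to_X (repr l)), muC B (set_val (repr l))).
Definition triv_inv (p : X_space K B alpha 0 * Cn R d) : L_space K B alpha :=
  piL (to_L (repr p.1) p.2).

(** Equivariance of [retract_X] and invariance of [muC] remove the dependence on the
    representative. *)
Lemma triv_mapE m : triv_map (piL m) = (piX (to_X m), muC B (set_val m)).
Proof.
have /orbit_piP[u Ku e] : piL m = piL (repr (piL m)) by rewrite [RHS]reprK.
have uu := subtorus_cunit Ku.
congr pair; last by rewrite e muC_tact.
by apply/esym/orbit_piP; exists u; rewrite // !to_XE e retract_X_tact.
Qed.

Lemma triv_invE m b : triv_inv (piX m, b) = piL (to_L m b).
Proof.
have /orbit_piP[u Ku e] : piX m = piX (repr (piX m)) by rewrite [RHS]reprK.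
apply/esym/orbit_piP; exists u; first exact: Ku.
by rewrite !to_LE e (muC_shift_tact B _ _ (subtorus_cunit Ku)).
Qed.

Lemma set_val_inj (M : set (Hn R N)) (m m' : M) : set_val m = set_val m' -> m = m'.
Proof. exact: val_inj. Qed.

Lemma triv_mapK : cancel triv_map triv_inv.
Proof.
move=> l; have [m <-] := orbit_pi_repr l; rewrite triv_mapE triv_invE; congr piL.
by apply: set_val_inj; rewrite to_LE to_XE retract_XK.
Qed.

Lemma triv_invK : cancel triv_inv triv_map.
Proof.
move=> [x b]; have [m <-] := orbit_pi_repr x; rewrite triv_invE triv_mapE.
have Xm : XX (set_val m) by exact: set_valP.
congr pair; last exact: (proj2 (muC_shift_level reg b Xm)).
by congr piX; apply: set_val_inj; rewrite to_XE to_LE (muC_shiftK reg).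
Qed.

Lemma continuous_to_set (T : topologicalType) (M : set (Hn R N)) (f : T -> M) x :
  {for x, continuous (fun y => set_val (f y))} -> {for x, continuous f}.
Proof.
move=> h; suff H : f @ x --> f x by [].
move=> V; rewrite nbhsE => -[W [/open_set_type[D oD e] Wx] WV].
have nD : nbhs (set_val (f x)) D.
  by apply: open_nbhs_nbhs; split=> //; move: Wx; rewrite e.
suff : nbhs x [set y | D (set_val (f y))].
  by apply: filterS => y Dy; apply: WV; rewrite e.
exact: h nD.
Qed.

Lemma continuous_at_pair (T T1 T2 : topologicalType) (f : T -> T1) (g : T -> T2) x :
  {for x, continuous f} -> {for x, continuous g} ->
  {for x, continuous (fun y => (f y, g y))}.
Proof. by move=> hf hg; exact: cvg_pair hf hg. Qed.

Lemma continuous_set_val (M : set (Hn R N)) : continuous (@set_val _ M).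
Proof. exact: initial_continuous. Qed.

Lemma triv_map_continuous : continuous triv_map.
Proof.
apply: orbit_continuous => m.
suff : {for m, continuous (fun m => (piX (to_X m), muC B (set_val m)))}.
  by congr continuous_at; apply/funext => m'; rewrite /= triv_mapE.
have sm : XL (set_val m) by exact: set_valP.
apply: continuous_at_pair.
  apply: continuous_comp; last exact: orbit_pi_continuous.
  apply: continuous_to_set.
  apply: (continuous_comp (@continuous_set_val XL m) (g := retract_X B)).
  exact: (Cinf_on_continuous (Cinf_on_retract_X B) (level_L_gram reg sm)).
apply: (continuous_comp (@continuous_set_val XL m) (g := muC B)).
have oT : open (setT : set (Hn R N)) by exact: openT.
apply: (Cinf_on_continuous (U := setT)) => //.
by apply: Cinf_on_muC => //; exact: Cinf_on_id.
Qed.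

(** The product of a quotient map with an identity need not be a quotient map; here the openness of
    the orbit projection provides the neighbourhoods. *)
Lemma triv_inv_continuous : continuous triv_inv.
Proof.
move=> [x b]; have [m xE] := orbit_pi_repr x; rewrite -xE.
have hc : {for (m, b), continuous (fun p : XX * Cn R d => piL (to_L p.1 p.2))}.
  apply: continuous_comp; last exact: orbit_pi_continuous.
  apply: continuous_to_set.
  have Xm : (XX `*` [set: Cn R d]) (set_val m, b) by split=> //; exact: set_valP.
  apply: (continuous_comp (f := fun p : XX * Cn R d => (set_val p.1, p.2))
    (g := fun p : Hn R N * Cn R d => muC_shift B p.1 p.2)).
    apply: continuous_at_pair; last exact: cvg_snd.
    by apply: continuous_comp; [exact: cvg_fst|exact: continuous_set_val].
  apply: (Cinf_on_continuous (@Cinf_on_shift_dom _ _ _ B)); split=> //.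
  by apply/(level_L_gram reg)/level_X_L; case: Xm.
move=> V; rewrite triv_invE => /hc [[A C] /= [mA bC] AC].
exists (piX @` A°, C) => /=.
  split=> //; apply: open_nbhs_nbhs; split.
    by apply: orbit_pi_open; [exact: level_X_tact|exact: open_interior].
  by exists m.
move=> [_ b'] [/= [m' Am' <-] Cb']; rewrite triv_invE.
by apply: (AC (m', b')); split=> //; exact: interior_subset Am'.
Qed.

Lemma lie_basis_dim : (d <= N)%N.
Proof. by have [/eqP e _] := hB; rewrite -{1}e rank_leq_col. Qed.

Hypothesis X_slices : forall q, XX q ->
  exists (U : set 'rV[R]_(4 * N - 4 * d)) (G : finGroupType)
    (act : G -> 'rV[R]_(4 * N - 4 * d) -> 'rV[R]_(4 * N - 4 * d))
    (j : G -> Cn R N) (s : 'rV[R]_(4 * N - 4 * d) -> Hn R N),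
    is_slice XX K U act j s /\ exists x u, [/\ U x, tset K u & q = tact (s x) u].

(** The chart of L is the transport of a chart of X with the same group, so the trivialization lifts
    to the linear isomorphism [psi], equivariantly for the identity of that group. *)
Lemma triv_orbifold : orbifold_diffeomorphic (L_atlas K B alpha)
  (prod_orbiatlas (Cn R d) (X_atlas K B alpha 0)).
Proof.
exists triv_map, triv_inv; split; [exact: triv_map_continuous|
  exact: triv_inv_continuous|exact: triv_mapK|exact: triv_invK|].
move=> l; have [m lE] := orbit_pi_repr l.
have [U [G [act [j [s [S [x0 [u [Ux0 Ku mE]]]]]]]]] := X_slices (set_valP (to_X m)).
(* Subtraction is truncated, so this relies on d <= N. *)
have dim : (4 * N - 4 * d + (d + d) = 4 * N - 2 * d)%N by have := lie_basis_dim; lia.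
have [psi [phi [psiK phiK]]] := split_rV_iso R dim.
have fE : findim 'rV[R]_(4 * N - 4 * d) by exact: findim_mx.
have fE' : findim 'rV[R]_(4 * N - 2 * d) by exact: findim_mx.
have SL := tr_is_slice reg psiK phiK fE fE' S.
pose cX := slice_chart K U act s (to_X m).
pose cL := slice_chart K (tr_dom psi U) (tr_act psi phi act) (tr_slice B psi s) m.
exists cL, (prod_orbichart (Cn R d) cX), id, psi; split.
- split; first exact: slice_chart_atlas SL m.
  by exists cX => //; exact: slice_chart_atlas S (to_X m).
- rewrite -lE; have U0 : tr_dom psi U (phi (x0, muC B (set_val m))).
    by rewrite /tr_dom /= phiK.
  exists (phi (x0, muC B (set_val m))); first exact: U0.
  apply/orbit_piP; exists u => //.
  rewrite in_levelK; last exact: slice_level SL _ U0.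
  rewrite /tr_slice phiK -(muC_shift_tact B _ _ (subtorus_cunit Ku)) -[LHS](retract_XK B).
  exact: (congr1 (fun q => muC_shift B q (muC B (set_val m))) mE).
- by split; [exists id|].
- exact: tr_diffeo.
move=> y Uy; split=> [g|]; first by rewrite /= /tr_act phiK.
have My := slice_level SL Uy.
rewrite [LHS]triv_mapE /= in_levelK//.
congr pair; last by rewrite (proj2 (muC_shift_level reg _ (slice_level S Uy))).
congr piX; apply: set_val_inj; rewrite to_XE !in_levelK//; last exact: slice_level S _ Uy.
exact: (muC_shiftK reg _ (slice_level S Uy)).
Qed.

End Main.

(** Turns the stabilizer, known only as a finite set closed under the operations, into the
    [finGroupType] that a chart requires. *)
Lemma finite_group_of_set (C : choiceType) (S : set C) (mul : C -> C -> C) (one : C)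
    (inv : C -> C) :
  finite_set S -> S one -> (forall a b, S a -> S b -> S (mul a b)) ->
  (forall a, S a -> S (inv a)) ->
  associative mul -> left_id one mul -> (forall a, S a -> mul (inv a) a = one) ->
  exists (G : finGroupType) (j : G -> C),
    [/\ injective j, forall g, S (j g), forall a, S a -> exists g, j g = a,
      j 1%g = one & forall g h, j (g * h)%g = mul (j g) (j h)].
Proof.
move=> fS S1 SM SV mA m1 mV.
have /finite_seqP[s sE] := fS.
have TS (x : seq_sub s) : S (ssval x) by rewrite sE /=; exact: ssvalP.
have ST a : S a -> a \in s by rewrite sE.
pose mulT (x y : seq_sub s) := SeqSub (ST _ (SM _ _ (TS x) (TS y))).
pose oneT := SeqSub (ST _ S1).
pose invT (x : seq_sub s) := SeqSub (ST _ (SV _ (TS x))).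
have mAT : associative mulT by move=> x y z; apply: val_inj; rewrite /= mA.
have m1T : left_id oneT mulT by move=> x; apply: val_inj; rewrite /= m1.
have mVT : left_inverse oneT invT mulT by move=> x; apply: val_inj; rewrite /= (mV _ (TS x)).
pose G : finGroupType := HB.pack (seq_sub s) (Finite_isGroup.Build (seq_sub s) mAT m1T mVT).
exists G, (@ssval _ s); split=> //; first exact: val_inj.
by move=> a Sa; exists (SeqSub (ST _ Sa)).
Qed.

(** * The free coordinates of a slice: those outside the image of [f] *)

Section SplitCoordinates.
Variables (R : realType) (N d : nat) (f : 'I_d -> 'I_N).
Hypothesis f_inj : injective f.

Definition same_at (q q' : Hn R N) i :=
  [/\ za q i = za q' i, zb q i = zb q' i, wp q i = wp q' i & ws q i = ws q' i].

Definition hn_coord (q : Hn R N) (p : 'I_4 * 'I_N) : R :=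
  match val p.1 with 0%N => za q p.2 | 1%N => zb q p.2 | 2%N => wp q p.2 | _ => ws q p.2 end.

Lemma hn_coord_linear p : linear (hn_coord ^~ p).
Proof.
by move=> a u v; rewrite /hn_coord; case: (val p.1) => [|[|[|k]]];
  rewrite /za /zb /wp /ws /= !mxE.
Qed.

Let T := {p : 'I_4 * 'I_N | p.2 \notin codom f}.

Let cardT : (4 * N - 4 * d)%N = #|{: T}|.
Proof.
have -> : #|{: T}| = #|[predX [pred _ : 'I_4 | true] & [predC codom f]]|.
  by rewrite card_sig; apply: eq_card => p; rewrite !inE.
rewrite cardX card_ord; have := cardC [in codom f]; rewrite card_codom// !card_ord => e.
have e' : (d + #|[predC codom f]|)%N = N by rewrite -[RHS]e; congr addn; apply: eq_card.
by rewrite -mulnBr -{1}e' addKn.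
Qed.

Lemma split_coordinates : exists (pr : {linear Hn R N -> 'rV[R]_(4 * N - 4 * d)})
    (em : {linear 'rV[R]_(4 * N - 4 * d) -> Hn R N}),
  [/\ forall u j, same_at (em u) 0 (f j),
      forall q i, i \notin codom f -> same_at (em (pr q)) q i &
      forall q u, (forall i, i \notin codom f -> same_at q (em u) i) -> pr q = u].
Proof.
pose pr (q : Hn R N) : 'rV[R]_(4 * N - 4 * d) :=
  \row_l hn_coord q (val (enum_val (cast_ord cardT l))).
pose g (u : 'rV[R]_(4 * N - 4 * d)) (k : 'I_4) (i : 'I_N) : R :=
  if insub (k, i) is Some t then u 0 (cast_ord (esym cardT) (enum_rank (t : T))) else 0.
pose em (u : 'rV[R]_(4 * N - 4 * d)) : Hn R N :=
  hn (g u (@Ordinal 4 0 isT)) (g u (@Ordinal 4 1 isT)) (g u (@Ordinal 4 2 isT))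
     (g u (@Ordinal 4 3 isT)).
have prl : linear pr by move=> a u v; apply/rowP => l; rewrite !mxE hn_coord_linear.
have gl a u v k i : g (a *: u + v) k i = a * g u k i + g v k i.
  by rewrite /g; case: insubP => [t _ _|_]; rewrite ?mxE// mulr0 addr0.
have eml : linear em.
  move=> a u v; apply: hnP => i; rewrite /em !hn_simp !gl.
  by rewrite /za /zb /wp /ws /= !mxE.
pose prL : {linear _ -> _} := HB.pack pr (GRing.isLinear.Build _ _ _ _ _ prl).
pose emL : {linear _ -> _} := HB.pack em (GRing.isLinear.Build _ _ _ _ _ eml).
have gpr q k i : i \notin codom f -> g (pr q) k i = hn_coord q (k, i).
  move=> Ji; rewrite /g; case: insubP => [t _ tE|]; last by rewrite Ji.
  by rewrite mxE cast_ordKV enum_rankK tE.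
have emg u (t : T) : hn_coord (em u) (val t) = u 0 (cast_ord (esym cardT) (enum_rank t)).
  case: t => -[k i] h /=.
  have gE : g u k i = u 0 (cast_ord (esym cardT) (enum_rank (exist _ (k, i) h : T))).
    by rewrite /g insubT.
  rewrite -gE /hn_coord /= /em; case: k h gE => -[|[|[|[|//]]]] lt4 h _ /=;
    rewrite !hn_simp; by congr g; exact: val_inj.
exists prL, emL; split=> [u j|q i Ji|q u h] /=.
- have g0 k : g u k (f j) = 0 by rewrite /g insubF//= codom_f.
  by rewrite /same_at /em !hn_simp !g0 /za /zb /wp /ws /= !mxE.
- by rewrite /same_at /em !hn_simp !gpr.
apply/rowP => l; rewrite mxE; set t := enum_val _.
have -> : l = cast_ord (esym cardT) (enum_rank t) by rewrite /t enum_valK cast_ordK.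
rewrite -emg /hn_coord; have [h1 h2 h3 h4] := h _ (valP t).
by case: (val (val t).1) => [|[|[|k]]].
Qed.

End SplitCoordinates.

(** * Slices of the zero level *)

Section HopfSection.
Variable R : realType.
Implicit Types (b : bool) (X Y : R).

(* If [0 < sgn b X], the unique [(z, w)] with [|z|^2 - |w|^2 = X] and
   [z w = Y1 + i Y2] whose larger coordinate ([z] if [b], else [w]) is a positive
   real, namely [sec_t]. *)
Definition sgn b X := if b then X else - X.
Definition sec_t b X Y1 Y2 :=
  Num.sqrt ((Num.sqrt (X ^+ 2 + 4 * (Y1 ^+ 2 + Y2 ^+ 2)) + sgn b X) / 2).
Definition sec_a b X Y1 Y2 := if b then sec_t b X Y1 Y2 else Y1 / sec_t b X Y1 Y2.
Definition sec_b b X Y1 Y2 := if b then 0 else Y2 / sec_t b X Y1 Y2.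
Definition sec_p b X Y1 Y2 := if b then Y1 / sec_t b X Y1 Y2 else sec_t b X Y1 Y2.
Definition sec_s b X Y1 Y2 := if b then Y2 / sec_t b X Y1 Y2 else 0.

(* The real and imaginary parts of [z] (if [b]) or of the conjugate of [w]; both
   are multiplied by [u] under the action of [u]. *)
Definition phase_re b (x1 x2 x3 x4 : R) := if b then x1 else x3.
Definition phase_im b (x1 x2 x3 x4 : R) := if b then x2 else - x4.

Lemma sgn_sqr b X : sgn b X ^+ 2 = X ^+ 2.
Proof. by case: b; rewrite /sgn ?sqrrN. Qed.

Lemma sec_t_arg_gt0 b X Y1 Y2 : 0 < sgn b X ->
  0 < (Num.sqrt (X ^+ 2 + 4 * (Y1 ^+ 2 + Y2 ^+ 2)) + sgn b X) / 2.
Proof. by move=> h; rewrite divr_gt0// ltr_wpDl// sqrtr_ge0. Qed.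

Lemma sec_t_gt0 b X Y1 Y2 : 0 < sgn b X -> 0 < sec_t b X Y1 Y2.
Proof. by move=> h; rewrite sqrtr_gt0 sec_t_arg_gt0. Qed.

Lemma sec_sqr_gt0 b X Y1 Y2 : 0 < sgn b X -> 0 < X ^+ 2 + 4 * (Y1 ^+ 2 + Y2 ^+ 2).
Proof.
move=> h; rewrite -(sgn_sqr b) ltr_pwDl ?exprn_gt0// mulr_ge0// addr_ge0 ?sqr_ge0//.
Qed.

Lemma sec_hopf b X Y1 Y2 : 0 < sgn b X ->
  let a := sec_a b X Y1 Y2 in let b' := sec_b b X Y1 Y2 in
  let p := sec_p b X Y1 Y2 in let s := sec_s b X Y1 Y2 in
  [/\ hopf_x a b' p s = X, hopf_y1 a b' p s = Y1 & hopf_y2 a b' p s = Y2].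
Proof.
move=> h; have t0 := sec_t_gt0 Y1 Y2 h; have t1 : sec_t b X Y1 Y2 != 0 by rewrite gt_eqF.
have r2 := sqr_sqrtr (ltW (sec_sqr_gt0 Y1 Y2 h)).
have t2 := sqr_sqrtr (ltW (sec_t_arg_gt0 Y1 Y2 h)).
have rX : Num.sqrt (X ^+ 2 + 4 * (Y1 ^+ 2 + Y2 ^+ 2)) + sgn b X != 0.
  by rewrite gt_eqF// ltr_wpDl// sqrtr_ge0.
rewrite -/(sec_t b X Y1 Y2) in t2.
(* The squared modulus of the smaller coordinate: |y|^2 divided by t^2 = (r + |X|) / 2 is (r - |X|)
   / 2, because r^2 - X^2 = 4 |y|^2. *)
have YE : (Y1 ^+ 2 + Y2 ^+ 2) / sec_t b X Y1 Y2 ^+ 2 =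
    (Num.sqrt (X ^+ 2 + 4 * (Y1 ^+ 2 + Y2 ^+ 2)) - sgn b X) / 2.
  rewrite t2; move: r2 rX; set r := Num.sqrt _ => r2 rX.
  have -> : Y1 ^+ 2 + Y2 ^+ 2 = (r ^+ 2 - sgn b X ^+ 2) / 4.
    by rewrite r2 sgn_sqr; field.
  by field.
rewrite /sec_a /sec_b /sec_p /sec_s /hopf_x /hopf_y1 /hopf_y2.
move: t2 YE; set r := Num.sqrt _; set t := sec_t _ _ _ _ in t0 t1 *; case: (b) => /= t2 YE.
  split; last 2 first.
  - by field.
  - by field.
  have -> : t ^+ 2 + 0 ^+ 2 - ((Y1 / t) ^+ 2 + (Y2 / t) ^+ 2) =
    t ^+ 2 - (Y1 ^+ 2 + Y2 ^+ 2) / t ^+ 2 by field.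
  by rewrite YE t2; field.
split; last 2 first.
- by field.
- by field.
have -> : (Y1 / t) ^+ 2 + (Y2 / t) ^+ 2 - (t ^+ 2 + 0 ^+ 2) =
    (Y1 ^+ 2 + Y2 ^+ 2) / t ^+ 2 - t ^+ 2 by field.
by rewrite YE t2; field.
Qed.

Lemma sec_unique b (x1 x2 x3 x4 : R) :
  0 < phase_re b x1 x2 x3 x4 -> phase_im b x1 x2 x3 x4 = 0 ->
  let X := hopf_x x1 x2 x3 x4 in let Y1 := hopf_y1 x1 x2 x3 x4 in
  let Y2 := hopf_y2 x1 x2 x3 x4 in
  [/\ sec_a b X Y1 Y2 = x1, sec_b b X Y1 Y2 = x2, sec_p b X Y1 Y2 = x3 &
      sec_s b X Y1 Y2 = x4].
Proof.
move=> h1 h2 X Y1 Y2.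
(* Here r + X = 2 |z|^2 and r - X = 2 |w|^2, and the coordinate selected by [b] is a positive
   real. *)
have tE : sec_t b X Y1 Y2 = phase_re b x1 x2 x3 x4.
  rewrite /sec_t -hopf_r2 sqrtr_sqr ger0_norm ?hopf_r_ge0//.
  rewrite -[RHS]ger0_norm ?(ltW h1)// -sqrtr_sqr; congr Num.sqrt.
  move: h2; rewrite /X /hopf_r /hopf_x /phase_re /phase_im /sgn.
  by case: b {h1} => [-> | /eqP]; [|rewrite oppr_eq0 => /eqP ->]; field.
rewrite /sec_a /sec_b /sec_p /sec_s tE /Y1 /Y2 /hopf_y1 /hopf_y2.
case: b h1 h2 {tE} => /= h1; [move=> -> | move=> /eqP; rewrite oppr_eq0 => /eqP ->];
  by split=> //; field; rewrite gt_eqF.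
Qed.

Lemma phase_torus b (x1 x2 x3 x4 a1 a2 : R) :
  let y1 := x1 * a1 - x2 * a2 in let y2 := x1 * a2 + x2 * a1 in
  let y3 := x3 * a1 + x4 * a2 in let y4 := x4 * a1 - x3 * a2 in
  phase_re b y1 y2 y3 y4 = phase_re b x1 x2 x3 x4 * a1 - phase_im b x1 x2 x3 x4 * a2 /\
  phase_im b y1 y2 y3 y4 = phase_re b x1 x2 x3 x4 * a2 + phase_im b x1 x2 x3 x4 * a1.
Proof. by case: b => /=; split; ring. Qed.

Lemma phase_sec b X Y1 Y2 :
  let a := sec_a b X Y1 Y2 in let b' := sec_b b X Y1 Y2 in
  let p := sec_p b X Y1 Y2 in let s := sec_s b X Y1 Y2 in
  phase_re b a b' p s = sec_t b X Y1 Y2 /\ phase_im b a b' p s = 0.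
Proof. by case: b => /=; rewrite ?oppr0. Qed.

Lemma phase_neq0 b (x1 x2 x3 x4 : R) : 0 < sgn b (hopf_x x1 x2 x3 x4) ->
  0 < phase_re b x1 x2 x3 x4 ^+ 2 + phase_im b x1 x2 x3 x4 ^+ 2.
Proof.
have h1 := addr_ge0 (sqr_ge0 x1) (sqr_ge0 x2); have h2 := addr_ge0 (sqr_ge0 x3) (sqr_ge0 x4).
by rewrite /hopf_x; case: b => /=; rewrite ?sqrrN ?opprB subr_gt0; apply: le_lt_trans.
Qed.

Lemma unit_angle (a1 a2 : R) : a1 ^+ 2 + a2 ^+ 2 = 1 ->
  exists th : R, cos (2 * trigo.pi * th) = a1 /\ sin (2 * trigo.pi * th) = a2.
Proof.
move=> e; have a1b : -1 <= a1 <= 1.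
  rewrite -ler_norml -(@expr_le1 _ 2)// real_normK ?num_real// -e lerDl sqr_ge0//.
have thE t : 2 * trigo.pi * (t / (2 * trigo.pi)) = t :> R.
  by rewrite mulrC divfK// pi2_neq0.
have cE : cos (acos a1) = a1 by apply: acosK; rewrite in_itv.
have sE : sin (acos a1) = `|a2|.
  by rewrite sin_acos// -e addrAC subrr add0r sqrtr_sqr.
have [a20|a20] := leP 0 a2.
  by exists (acos a1 / (2 * trigo.pi)); rewrite thE cE sE ger0_norm.
exists (- acos a1 / (2 * trigo.pi)); rewrite thE cosN sinN cE sE.
by rewrite ltr0_norm// opprK.
Qed.

End HopfSection.

Lemma cmul_cinv_at (R : realType) N (u v : Cn R N) i : cunit v ->
  u.1 0 i = v.1 0 i -> u.2 0 i = v.2 0 i ->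
  (cmul u (cinv v)).1 0 i = 1 /\ (cmul u (cinv v)).2 0 i = 0.
Proof.
move=> uv e1 e2; rewrite (cinvE uv) !cn_simp /= mxE e1 e2.
by split; rewrite -?(uv i); ring.
Qed.

Section TorusMonoid.
Variables (R : realType) (N : nat).

Lemma cmulA (u v w : Cn R N) : cmul u (cmul v w) = cmul (cmul u v) w.
Proof. by apply: cn_ext => i; rewrite !cn_simp; split; ring. Qed.

Lemma cmul1 (u : Cn R N) : cmul (cone R N) u = u.
Proof. by apply: cn_ext => i; rewrite !cn_simp; split; ring. Qed.

End TorusMonoid.

(** * Slices built from the moment equations *)

Section XSlice.
Variables (R : realType) (N d : nat) (K : subtorus R N) (B : 'M[R]_(d, N)).
Variable alpha : 'rV[R]_d.
Hypothesis hB : lie_basis K B.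
Variable f : 'I_d -> 'I_N.
Hypotheses (f_inj : injective f) (fB : colsub f B \in unitmx).
Variable sg : 'I_d -> bool.
Variables (E : normedModType R) (pr : {linear Hn R N -> E}) (em : {linear E -> Hn R N}).
Hypotheses (fE : findim E).
Hypothesis em0 : forall u j, same_at (em u) 0 (f j).
Hypothesis empr : forall q i, i \notin codom f -> same_at (em (pr q)) q i.
Hypothesis prem : forall q u, (forall i, i \notin codom f -> same_at q (em u) i) -> pr q = u.

Local Notation XX := (level_X B alpha 0).
Local Notation P := (colsub f B).

Lemma xyvE (q : Hn R N) i : [/\ xv q 0 i = hopf_x (za q i) (zb q i) (wp q i) (ws q i),
  y1v q 0 i = hopf_y1 (za q i) (zb q i) (wp q i) (ws q i) &
  y2v q 0 i = hopf_y2 (za q i) (zb q i) (wp q i) (ws q i)].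
Proof. by rewrite !mxE. Qed.

Lemma xv0 (q : Hn R N) i : same_at q 0 i -> [/\ xv q 0 i = 0, y1v q 0 i = 0 & y2v q 0 i = 0].
Proof.
move=> [h1 h2 h3 h4]; rewrite !mxE /hopf_x /hopf_y1 /hopf_y2 h1 h2 h3 h4.
by rewrite /za /zb /wp /ws /= !mxE expr2 !mul0r !addr0 !subr0.
Qed.

Lemma xv_same (q q' : Hn R N) i : same_at q q' i ->
  [/\ xv q 0 i = xv q' 0 i, y1v q 0 i = y1v q' 0 i & y2v q 0 i = y2v q' 0 i].
Proof. by move=> [h1 h2 h3 h4]; rewrite !mxE h1 h2 h3 h4. Qed.

Lemma split_mulmx (x x' : 'rV[R]_N) : (forall i, i \notin codom f -> x 0 i = x' 0 i) ->
  (forall j, x' 0 (f j) = 0) -> x *m B^T = x' *m B^T + colsub f x *m P^T.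
Proof.
move=> h h'; apply/rowP => k; rewrite !mxE (bigID (mem (codom f))) /= addrC; congr (_ + _).
  rewrite [RHS](bigID (mem (codom f))) /= [X in _ = X + _]big1 ?add0r.
    by apply: eq_bigr => i Ji; rewrite h.
  by move=> i /codomP[j ->]; rewrite h' mul0r.
transitivity (\sum_(i <- codom f) x 0 i * B^T i k).
  by rewrite big_uniq//; rewrite map_inj_uniq// enum_uniq.
by rewrite big_map enumT; apply: eq_bigr => j _; rewrite !mxE.
Qed.

(** For [x] vanishing at every [f j], these are the values to put there so that the image under B^T
    becomes [a]; they exist and are unique because the minor is invertible. *)
Definition solve (a : 'rV[R]_d) (x : 'rV[R]_N) : 'rV[R]_d := (a - x *m B^T) *m invmx P^T.

Lemma solveP (a : 'rV[R]_d) (x x' : 'rV[R]_N) :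
  (forall i, i \notin codom f -> x 0 i = x' 0 i) -> (forall j, x' 0 (f j) = 0) ->
  x *m B^T = a <-> forall j, x 0 (f j) = solve a x' 0 j.
Proof.
move=> h h'; rewrite (split_mulmx h h'); have uP : P^T \in unitmx by rewrite unitmx_tr.
have -> : (forall j, x 0 (f j) = solve a x' 0 j) <-> colsub f x = solve a x'.
  by split=> [e|e j]; [apply/rowP => j; rewrite mxE e|rewrite -e mxE].
rewrite /solve; split=> [<-|->]; first by rewrite addrAC subrr add0r mulmxK.
by rewrite mulmxKV// addrC subrK.
Qed.

Definition slX u := solve (trigo.pi^-1 *: alpha) (xv (em u)).
Definition slY1 u := solve 0 (y1v (em u)).
Definition slY2 u := solve 0 (y2v (em u)).

Lemma level_XP (q : Hn R N) : XX q <->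
  [/\ xv q *m B^T = trigo.pi^-1 *: alpha, y1v q *m B^T = 0 & y2v q *m B^T = 0].
Proof.
have pi0 : trigo.pi != 0 :> R by rewrite gt_eqF ?pi_gt0.
have pi20 := @pi2_neq0 R.
rewrite /level_X /= mu1E muCE; split=> [[<- [h2 h1]]|[-> -> ->]].
  rewrite scalerA mulVf// scale1r; split=> //.
    by move/eqP: h1; rewrite scaler_eq0 oppr_eq0 (negbTE pi20) => /eqP.
  by move/eqP: h2; rewrite scaler_eq0 (negbTE pi20) => /eqP.
by rewrite scalerA divff// scale1r !scaler0.
Qed.

Lemma level_X_solve (q : Hn R N) u : (forall i, i \notin codom f -> same_at q (em u) i) ->
  XX q <-> forall j, [/\ xv q 0 (f j) = slX u 0 j, y1v q 0 (f j) = slY1 u 0 j &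
    y2v q 0 (f j) = slY2 u 0 j].
Proof.
move=> h; rewrite level_XP.
have hx i : i \notin codom f -> xv q 0 i = xv (em u) 0 i by case/h/xv_same.
have hy1 i : i \notin codom f -> y1v q 0 i = y1v (em u) 0 i by case/h/xv_same.
have hy2 i : i \notin codom f -> y2v q 0 i = y2v (em u) 0 i by case/h/xv_same.
have zx j : xv (em u) 0 (f j) = 0 by case: (xv0 (em0 u j)).
have zy1 j : y1v (em u) 0 (f j) = 0 by case: (xv0 (em0 u j)).
have zy2 j : y2v (em u) 0 (f j) = 0 by case: (xv0 (em0 u j)).
have [[e1 e2] e3] := (solveP (trigo.pi^-1 *: alpha) hx zx, solveP 0 hy1 zy1, solveP 0 hy2 zy2).
split=> [[/e1 h1 /e2 h2 /e3 h3] j|hj]; first by split.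
by split; [apply/e1|apply/e2|apply/e3] => j; case: (hj j).
Qed.

Definition fpick i := [pick j | f j == i].

Lemma fpickE j : fpick (f j) = Some j.
Proof.
rewrite /fpick; case: pickP => [j' /eqP/f_inj -> //|/(_ j)]; by rewrite eqxx.
Qed.

Lemma fpickN i : i \notin codom f -> fpick i = None.
Proof.
rewrite /fpick; case: pickP => [j /eqP <-|//]; by rewrite codom_f.
Qed.

Definition sl u : Hn R N := hn
  (fun i => if fpick i is Some j then sec_a (sg j) (slX u 0 j) (slY1 u 0 j) (slY2 u 0 j)
            else za (em u) i)
  (fun i => if fpick i is Some j then sec_b (sg j) (slX u 0 j) (slY1 u 0 j) (slY2 u 0 j)
            else zb (em u) i)
  (fun i => if fpick i is Some j then sec_p (sg j) (slX u 0 j) (slY1 u 0 j) (slY2 u 0 j)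
            else wp (em u) i)
  (fun i => if fpick i is Some j then sec_s (sg j) (slX u 0 j) (slY1 u 0 j) (slY2 u 0 j)
            else ws (em u) i).

Definition sl_dom : set E := [set u | forall j, 0 < sgn (sg j) (slX u 0 j)].

Definition ph1 (q : Hn R N) j := phase_re (sg j) (za q (f j)) (zb q (f j)) (wp q (f j)) (ws q (f j)).
Definition ph2 (q : Hn R N) j := phase_im (sg j) (za q (f j)) (zb q (f j)) (wp q (f j)) (ws q (f j)).

Lemma sl_same u i : i \notin codom f -> same_at (sl u) (em u) i.
Proof. by move=> Ji; rewrite /same_at /sl !hn_simp fpickN. Qed.

Lemma pr_sl u : pr (sl u) = u.
Proof. by apply: prem => i; exact: sl_same. Qed.

Lemma sl_f u : sl_dom u -> forall j, [/\ xv (sl u) 0 (f j) = slX u 0 j,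
  y1v (sl u) 0 (f j) = slY1 u 0 j & y2v (sl u) 0 (f j) = slY2 u 0 j].
Proof.
move=> Uu j; have [-> -> ->] := xyvE (sl u) (f j); rewrite /sl !hn_simp fpickE.
by have [-> -> ->] := sec_hopf (slY1 u 0 j) (slY2 u 0 j) (Uu j).
Qed.

Lemma sl_level u : sl_dom u -> XX (sl u).
Proof.
move=> Uu; apply/level_X_solve; [exact: sl_same|exact: sl_f].
Qed.

Lemma ph_sl u j : ph1 (sl u) j = sec_t (sg j) (slX u 0 j) (slY1 u 0 j) (slY2 u 0 j) /\
  ph2 (sl u) j = 0.
Proof. by rewrite /ph1 /ph2 /sl !hn_simp fpickE; exact: phase_sec. Qed.

Lemma ph1_sl_gt0 u j : sl_dom u -> 0 < ph1 (sl u) j.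
Proof. by move=> Uu; rewrite (proj1 (ph_sl u j)) sec_t_gt0. Qed.

Lemma sl_unique q : XX q -> (forall j, 0 < sgn (sg j) (xv q 0 (f j))) ->
  (forall j, 0 < ph1 q j /\ ph2 q j = 0) -> sl_dom (pr q) /\ sl (pr q) = q.
Proof.
move=> Xq hx hp.
have hs i : i \notin codom f -> same_at q (em (pr q)) i.
  by move=> Ji; have [h1 h2 h3 h4] := empr q Ji; split.
have hj := proj1 (level_X_solve hs) Xq.
split; first by move=> j; have [<- _ _] := hj j.
apply: hnP => i; have [/codomP[j ->]|Ji] := boolP (i \in codom f).
  rewrite /sl !hn_simp fpickE; have [<- <- <-] := hj j; have [-> -> ->] := xyvE q (f j).
  by have [p1 p2] := hp j; exact: sec_unique.
by have [-> -> -> ->] := sl_same (pr q) Ji; have [-> -> -> ->] := hs i Ji.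
Qed.

Lemma ph_tact q u j : cunit u ->
  ph1 (tact q u) j = ph1 q j * u.1 0 (f j) - ph2 q j * u.2 0 (f j) /\
  ph2 (tact q u) j = ph1 q j * u.2 0 (f j) + ph2 q j * u.1 0 (f j).
Proof.
by move=> uu; rewrite /ph1 /ph2 (tactE q uu) /tactU !hn_simp; exact: phase_torus.
Qed.

Lemma Cinf_on_em (V : set E) : open V -> Cinf_on V em.
Proof. by move=> oV k; apply: Ck_on_lin; exact: findim_continuous. Qed.

Lemma Cinf_on_solve (V : set E) a (x : E -> 'rV[R]_N) j : open V -> Cinf_on V x ->
  Cinf_on V (fun u => solve a (x u) 0 j).
Proof.
move=> oV hx; apply: Cinf_on_coord => //; apply: Cinf_on_mulmx => //; last exact: Cinf_on_cst.
apply: Cinf_onB => //; first exact: Cinf_on_cst.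
by apply: Cinf_on_mulmx => //; exact: Cinf_on_cst.
Qed.

Lemma Cinf_on_slXY (V : set E) j : open V -> [/\ Cinf_on V (fun u => slX u 0 j),
  Cinf_on V (fun u => slY1 u 0 j) & Cinf_on V (fun u => slY2 u 0 j)].
Proof.
move=> oV; have he := Cinf_on_em oV; split; apply: Cinf_on_solve => //.
- exact: Cinf_on_xv.
- exact: Cinf_on_y1v.
- exact: Cinf_on_y2v.
Qed.

Lemma open_sl_dom : open sl_dom.
Proof.
have oT : open (setT : set E) by exact: openT.
apply: open_forall => j; have [hX _ _] := Cinf_on_slXY j oT.
have hs : Cinf_on setT (fun u => sgn (sg j) (slX u 0 j)).
  by rewrite /sgn; case: (sg j) => //; exact: Cinf_onN.
by have := open_pos oT hs; congr open; apply/seteqP; split=> [u []//|u].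
Qed.

Lemma Cinf_on_sl : Cinf_on sl_dom sl.
Proof.
have oU := open_sl_dom; have he := Cinf_on_em oU.
apply: Cinf_on_hn => // i; have [ha hb hp hs] := Cinf_on_coords oU i he.
case: (fpick i) => [j|]; last by split.
have [hX hY1 hY2] := Cinf_on_slXY j oU.
have hg : Cinf_on sl_dom (fun u => sgn (sg j) (slX u 0 j)).
  by rewrite /sgn; case: (sg j) => //; exact: Cinf_onN.
have ht : Cinf_on sl_dom (fun u => sec_t (sg j) (slX u 0 j) (slY1 u 0 j) (slY2 u 0 j)).
  rewrite /sec_t; apply: Cinf_on_sqrt => //; last by move=> u Uu; exact: sec_t_arg_gt0 (Uu j).
  apply: Cinf_onM => //; last exact: Cinf_on_cst.
  apply: Cinf_onD => //; apply: Cinf_on_sqrt => //; first by smooth.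
  by move=> u Uu; exact: sec_sqr_gt0 (Uu j).
have t0 u : sl_dom u -> sec_t (sg j) (slX u 0 j) (slY1 u 0 j) (slY2 u 0 j) != 0.
  by move=> Uu; rewrite gt_eqF// sec_t_gt0.
rewrite /sec_a /sec_b /sec_p /sec_s; split; case: (sg j) ht t0 => ht t0 //;
  (exact: Cinf_on_cst || (apply: Cinf_onM => //; exact: Cinf_onV)).
Qed.

(** The element of the Lie algebra with [f]-coordinates [t]: inside K the angles at the chosen
    coordinates can be prescribed freely. *)
Definition lift_angle (t : 'rV[R]_d) : 'rV[R]_N := t *m invmx P *m B.

Lemma lift_angle_f t j : lift_angle t 0 (f j) = t 0 j.
Proof.
have <- : colsub f (lift_angle t) 0 j = lift_angle t 0 (f j) by rewrite mxE.
suff -> : colsub f (lift_angle t) = t by [].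
have -> : colsub f (lift_angle t) = t *m invmx P *m P.
  by apply/rowP => k; rewrite mxE !mxE; apply: eq_bigr => l _; rewrite [X in _ = _ * X]mxE.
by rewrite mulmxKV.
Qed.

Lemma lift_angle_K t : tset K (texp (lift_angle t)).
Proof.
have /(proj2 hB)/(_ 1) : (lift_angle t <= B)%MS by rewrite submxMl.
by rewrite scale1r.
Qed.

Section Corrector.
Variable a0 : Cn R N.
Hypothesis Ka0 : tset K a0.

(** Real part of (c1 + i c2) conj(a0), whose imaginary part comes next. For phases close to those of
    [a0] it is positive, which is where atan gives the argument smoothly. *)
Definition rel_re (c1 c2 : 'I_d -> R) j := c1 j * a0.1 0 (f j) + c2 j * a0.2 0 (f j).
Definition rel_im (c1 c2 : 'I_d -> R) j := c2 j * a0.1 0 (f j) - c1 j * a0.2 0 (f j).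

(* The element of [K] near [a0] whose [f j]-coordinates have the phases of
   [c1 j + i c2 j]. *)
Definition corr (c1 c2 : 'I_d -> R) : Cn R N := cmul a0 (texp (lift_angle
  (\row_j (atan (rel_im c1 c2 j / rel_re c1 c2 j) / (2 * trigo.pi))))).

Lemma corr_K c1 c2 : tset K (corr c1 c2).
Proof. by apply: subtorusM => //; exact: lift_angle_K. Qed.

Lemma rel_norm c1 c2 j : rel_re c1 c2 j ^+ 2 + rel_im c1 c2 j ^+ 2 = c1 j ^+ 2 + c2 j ^+ 2.
Proof.
by rewrite -[RHS]mulr1 -(subtorus_cunit Ka0 (f j)) /rel_re /rel_im; ring.
Qed.

Lemma corr_f c1 c2 j : 0 < rel_re c1 c2 j ->
  (corr c1 c2).1 0 (f j) = c1 j / Num.sqrt (c1 j ^+ 2 + c2 j ^+ 2) /\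
  (corr c1 c2).2 0 (f j) = c2 j / Num.sqrt (c1 j ^+ 2 + c2 j ^+ 2).
Proof.
move=> h; rewrite /corr !cn_simp lift_angle_f !mxE [2 * _ * _]mulrC divfK ?pi2_neq0//.
rewrite cos_atan_div// sin_atan_div// rel_norm; set n := Num.sqrt _.
by split; rewrite -[RHS]mulr1 -(subtorus_cunit Ka0 (f j)) /rel_re /rel_im; ring.
Qed.

(** Only the quotient of [rel_im] by [rel_re] enters, so the moduli of the c's are irrelevant: the
    coordinates of a point and their phases give the same correction. *)
Lemma corr_scale c1 c2 (t : 'I_d -> R) : (forall j, 0 < t j) ->
  corr (fun j => t j * c1 j) (fun j => t j * c2 j) = corr c1 c2.
Proof.
move=> t0; rewrite /corr; congr (cmul _ (texp (lift_angle _))); apply/rowP => j; rewrite !mxE.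
congr (atan _ / _).
have -> : rel_im (fun j => t j * c1 j) (fun j => t j * c2 j) j = t j * rel_im c1 c2 j.
  by rewrite /rel_im; ring.
have -> : rel_re (fun j => t j * c1 j) (fun j => t j * c2 j) j = t j * rel_re c1 c2 j.
  by rewrite /rel_re; ring.
by rewrite invfM mulrACA divff ?mul1r// gt_eqF.
Qed.

Lemma Cinf_on_corr (F : normedModType R) (V : set F) (c1 c2 : F -> 'I_d -> R) :
  open V -> (forall j, Cinf_on V (c1 ^~ j) /\ Cinf_on V (c2 ^~ j)) ->
  (forall x, V x -> forall j, 0 < rel_re (c1 x) (c2 x) j) ->
  Cinf_on V (fun x => corr (c1 x) (c2 x)).
Proof.
move=> oV hc hr; apply: Cinf_on_cmul => //; first exact: Cinf_on_cst.
apply: Cinf_on_texp => //; apply: Cinf_on_mulmx => //; last exact: Cinf_on_cst.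
apply: Cinf_on_mulmx => //; last exact: Cinf_on_cst.
apply: Cinf_on_matrix => // _ j; have [h1 h2] := hc j.
apply: Cinf_onM => //; last exact: Cinf_on_cst.
apply: Cinf_on_atan => //; rewrite /rel_im; apply: Cinf_onM => //; first by smooth.
apply: Cinf_onV => //; first by rewrite /rel_re; smooth.
by move=> x Vx; rewrite gt_eqF// hr.
Qed.

Lemma corr_self : corr (fun j => a0.1 0 (f j)) (fun j => a0.2 0 (f j)) = a0.
Proof.
rewrite /corr (_ : \row_j _ = 0); last first.
  by apply/rowP => j; rewrite !mxE /rel_im [X in X - _]mulrC subrr mul0r atan0 mul0r.
rewrite /lift_angle !mul0mx texp0.
by apply: cn_ext => i; rewrite !cn_simp; split; ring.
Qed.

Lemma Cinf_on_ph (F : normedModType R) (V : set F) (q : F -> Hn R N) j : open V ->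
  Cinf_on V q -> Cinf_on V (fun x => ph1 (q x) j) /\ Cinf_on V (fun x => ph2 (q x) j).
Proof.
move=> oV hq; have [h1 h2 h3 h4] := Cinf_on_coords oV (f j) hq.
by rewrite /ph1 /ph2 /phase_re /phase_im; case: (sg j); split=> //; exact: Cinf_onN.
Qed.

Definition cconj (u : Cn R N) : Cn R N := (u.1, - u.2).

Lemma Cinf_on_cconj (F : normedModType R) (V : set F) (u : F -> Cn R N) : open V ->
  Cinf_on V u -> Cinf_on V (fun x => cconj (u x)).
Proof.
move=> oV hu; apply: Cinf_on_pair => //; first exact: Cinf_on_fst.
by apply: Cinf_onN => //; exact: Cinf_on_snd.
Qed.

Definition near_dom : set (Hn R N) := [set q | (forall j, 0 < sgn (sg j) (xv q 0 (f j))) /\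
  (forall j, 0 < rel_re (ph1 q) (ph2 q) j)].

Lemma open_near_dom : open near_dom.
Proof.
have oT : open (setT : set (Hn R N)) by exact: openT.
have hid := @Cinf_on_id _ (Hn R N) setT.
apply: openI; apply: open_forall => j.
  have hs : Cinf_on setT (fun q : Hn R N => sgn (sg j) (xv q 0 (f j))).
    have hx : Cinf_on setT (fun q : Hn R N => xv q 0 (f j)).
      by apply: Cinf_on_coord => //; exact: Cinf_on_xv.
    by rewrite /sgn; case: (sg j) => //; exact: Cinf_onN.
  by have := open_pos oT hs; congr open; apply/seteqP; split=> [u []//|u].
have [h1 h2] := Cinf_on_ph j oT hid.
have hs : Cinf_on setT (fun q : Hn R N => rel_re (ph1 q) (ph2 q) j).
  by rewrite /rel_re; smooth.
by have := open_pos oT hs; congr open; apply/seteqP; split=> [u []//|u].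
Qed.

Definition qcorr (q : Hn R N) := corr (ph1 q) (ph2 q).

Lemma Cinf_on_qcorr : Cinf_on near_dom qcorr.
Proof.
have oV := open_near_dom; apply: Cinf_on_corr => //; last by move=> q [].
by move=> j; apply: Cinf_on_ph => //; exact: Cinf_on_id.
Qed.

Lemma ph_norm_gt0 q j : 0 < sgn (sg j) (xv q 0 (f j)) -> 0 < ph1 q j ^+ 2 + ph2 q j ^+ 2.
Proof. by have [-> _ _] := xyvE q (f j); exact: phase_neq0. Qed.

Lemma rotate_sl q a : XX q -> tset K a -> (forall j, 0 < sgn (sg j) (xv q 0 (f j))) ->
  (forall j, a.1 0 (f j) = ph1 q j / Num.sqrt (ph1 q j ^+ 2 + ph2 q j ^+ 2) /\
    a.2 0 (f j) = ph2 q j / Num.sqrt (ph1 q j ^+ 2 + ph2 q j ^+ 2)) ->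
  let q' := tact q (cinv a) in sl_dom (pr q') /\ sl (pr q') = q'.
Proof.
move=> Xq Ka hx ha q'; have Kv := subtorusV Ka; have uv := subtorus_cunit Kv.
apply: sl_unique; first exact: (level_X_tact Xq Kv).
  by have [-> _ _] := tact_invariants q uv.
move=> j; have [-> ->] := ph_tact q j uv; rewrite (cinvE (subtorus_cunit Ka)) /=.
have [e1 e2] := ha j; rewrite [(- a.2) _ _]mxE e1 e2.
have n0 := ph_norm_gt0 (hx j); have s0 : 0 < Num.sqrt (ph1 q j ^+ 2 + ph2 q j ^+ 2) by rewrite sqrtr_gt0.
have s2 := sqr_sqrtr (ltW n0); move: s0 s2; set n := Num.sqrt _ => s0 s2.
split; last by ring.
rewrite [ltRHS](_ : _ = (ph1 q j ^+ 2 + ph2 q j ^+ 2) / n); last by ring.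
by rewrite divr_gt0.
Qed.

Lemma tact_cinvK q a : tset K a -> tact (tact q (cinv a)) a = q.
Proof. by move=> Ka; rewrite tactM cmulC (cmulV Ka) tact1. Qed.

Lemma tact_cinv q a : tset K a -> tact (tact q a) (cinv a) = q.
Proof. by move=> Ka; rewrite tactM (cmulV Ka) tact1. Qed.

End Corrector.

Lemma ph_sl_tact u a j : cunit a -> ph1 (tact (sl u) a) j = ph1 (sl u) j * a.1 0 (f j) /\
  ph2 (tact (sl u) a) j = ph1 (sl u) j * a.2 0 (f j).
Proof.
move=> ua; have [-> ->] := ph_tact (sl u) j ua; have [_ ->] := ph_sl u j.
by rewrite !mul0r subr0 addr0.
Qed.

Lemma xv_sl_tact u a : sl_dom u -> cunit a -> forall j, 0 < sgn (sg j) (xv (tact (sl u) a) 0 (f j)).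
Proof.
by move=> Uu ua j; have [-> _ _] := tact_invariants (sl u) ua; have [-> _ _] := sl_f Uu j.
Qed.

Lemma stab_isolated_open : exists W : set (Cn R N),
  [/\ open W, W (cone R N) & forall v, W v -> stab K f v -> v = cone R N].
Proof.
have : nbhs (cone R N) [set v | stab K f v -> v = cone R N] := stab_isolated hB fB.
rewrite nbhsE => -[W [oW W1] h].
by exists W; split.
Qed.

(** The inverse reads the phases of a point at the coordinates [f j] and lets [corr] rebuild the
    group element. Phases determine that element only up to the stabilizer; staying near [a0], where
    1 is isolated in the stabilizer, removes the ambiguity. *)
Lemma sl_local_diffeo : local_diffeo (sl_dom `*` tset K) XX
  (fun p : E * Cn R N => tact (sl p.1) p.2).
Proof.
move=> [u0 a0] [/= Uu0 Ka0]; have ua0 := subtorus_cunit Ka0.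
have [W [oW W1 HW]] := stab_isolated_open.
pose c1 (p : E * Cn R N) j := p.2.1 0 (f j); pose c2 (p : E * Cn R N) j := p.2.2 0 (f j).
have oT : open (setT : set (E * Cn R N)) by exact: openT.
have hid := @Cinf_on_id _ (E * Cn R N)%type setT.
have hc (V : set (E * Cn R N)) j : open V -> Cinf_on V (c1 ^~ j) /\ Cinf_on V (c2 ^~ j).
  by move=> oV; apply: Cinf_on_cn_coord => //; apply: Cinf_on_snd => //; exact: Cinf_on_id.
pose D : set (E * Cn R N) := [set p | sl_dom p.1 /\ forall j, 0 < rel_re a0 (c1 p) (c2 p) j].
have oD : open D.
  apply: openI.
    have := open_preim oT (Cinf_on_fst oT hid) open_sl_dom.
    by congr open; apply/seteqP; split=> [p []//|p].
  apply: open_forall => j; have [h1 h2] := hc setT j oT.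
  have hs : Cinf_on setT (fun p => rel_re a0 (c1 p) (c2 p) j) by rewrite /rel_re; smooth.
  by have := open_pos oT hs; congr open; apply/seteqP; split=> [p []//|p].
pose cr p := corr a0 (c1 p) (c2 p).
have hcr : Cinf_on D cr by apply: Cinf_on_corr => // [j|p []//]; exact: hc.
(* The discrepancy between a group element and its reconstruction. On the part of [D] over K it lies
   in [stab], and it is 1 at [a0]; restricting to the preimage of [W] forces it to be 1. *)
pose h (p : E * Cn R N) := cmul p.2 (cconj (cr p)).
have hh : Cinf_on D h.
  apply: Cinf_on_cmul => //; last exact: Cinf_on_cconj.
  by apply: Cinf_on_snd => //; exact: Cinf_on_id.
have Kcr p : tset K (cr p) by exact: corr_K.
have hE p : h p = cmul p.2 (cinv (cr p)) by rewrite /h (cinvE (subtorus_cunit (Kcr p))).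
exists [set p | D p /\ W (h p)], (near_dom a0); split.
- exact: open_preim.
- split; first by split=> // j; rewrite /rel_re /c1 /c2 /= -!expr2 ua0.
  by rewrite hE /cr (corr_self a0) (cmulV Ka0).
- exact: open_near_dom.
pose g q := (pr (tactU q (cconj (qcorr a0 q))), qcorr a0 q).
have Kq q : tset K (qcorr a0 q) by exact: corr_K.
have gE q : g q = (pr (tact q (cinv (qcorr a0 q))), qcorr a0 q).
  have uq := subtorus_cunit (Kq q).
  by rewrite (tactE _ (subtorus_cunit (subtorusV (Kq q)))) (cinvE uq).
exists g; split.
- apply: (Cinf_smooth_on oD (g := fun p => tactU (sl p.1) p.2)).
  + by move=> p [_ [Dp _]].
  + apply: Cinf_on_tactU => //; last by apply: Cinf_on_snd => //; exact: Cinf_on_id.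
    apply: (@Cinf_on_comp _ _ _ _ D sl_dom fst sl) => //; [exact: open_sl_dom| | |exact: Cinf_on_sl].
      by move=> p [].
    by apply: Cinf_on_fst => //; exact: Cinf_on_id.
  + by move=> p [[_ Kp] _]; rewrite (tactE _ (subtorus_cunit Kp)).
- have oN := @open_near_dom a0; apply: (Cinf_smooth_on oN (g := g)) => //.
  have hq := @Cinf_on_qcorr a0; apply: Cinf_on_pair => //.
  apply: (Cinf_on_linl (L := pr)) => //; first by apply: findim_continuous; exact: findim_Hn.
  by apply: Cinf_on_tactU => //; [exact: Cinf_on_id|exact: Cinf_on_cconj].
- move=> [u a] [[/= Uu Ka] [[_ re0] Wh]]; have ua := subtorus_cunit Ka.
  have phE j := ph_sl_tact u j ua.
  have t0 j : 0 < ph1 (sl u) j by exact: ph1_sl_gt0.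
  have qE : qcorr a0 (tact (sl u) a) = cr (u, a).
    have p1 : ph1 (tact (sl u) a) = (fun j => ph1 (sl u) j * c1 (u, a) j).
      by apply/funext => j; case: (phE j).
    have p2 : ph2 (tact (sl u) a) = (fun j => ph1 (sl u) j * c2 (u, a) j).
      by apply/funext => j; case: (phE j).
    by rewrite /qcorr p1 p2 (corr_scale a0 _ _ t0).
  have crE : cr (u, a) = a.
    apply/esym/(cmul_cinv_eq1 (subtorus_cunit (Kcr (u, a)))).
    rewrite -(hE (u, a)); apply: HW => //; rewrite hE.
    split; first by apply: subtorusM => //; apply: subtorusV.
    move=> j; have [e1 e2] := corr_f Ka0 (re0 j).
    have un : c1 (u, a) j ^+ 2 + c2 (u, a) j ^+ 2 = 1 by exact: ua (f j).
    rewrite un sqrtr1 !divr1 in e1 e2.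
    by apply: cmul_cinv_at => //; exact: subtorus_cunit (Kcr (u, a)).
  rewrite gE qE crE (tact_cinv (sl u) Ka) pr_sl; split=> //; split.
    by apply: level_X_tact Ka; exact: sl_level.
  split; first exact: xv_sl_tact.
  move=> j; have [e1 e2] := phE j.
  have -> : rel_re a0 (ph1 (tact (sl u) a)) (ph2 (tact (sl u) a)) j =
      ph1 (sl u) j * rel_re a0 (c1 (u, a)) (c2 (u, a)) j.
    by rewrite /rel_re e1 e2 /c1 /c2 /=; ring.
  by rewrite mulr_gt0// re0.
- move=> q [Xq [hx re0]]; set a := qcorr a0 q; have Ka : tset K a := Kq q.
  have ha j := corr_f Ka0 (re0 j).
  have [U' slE] := rotate_sl Xq Ka hx ha.
  rewrite gE /= slE (tact_cinvK q Ka); split=> //; split=> //.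
  have n0 j := ph_norm_gt0 (hx j).
  have s0 j : 0 < (Num.sqrt (ph1 q j ^+ 2 + ph2 q j ^+ 2))^-1 by rewrite invr_gt0 sqrtr_gt0.
  have cE1 : c1 (g q) = fun j => (Num.sqrt (ph1 q j ^+ 2 + ph2 q j ^+ 2))^-1 * ph1 q j.
    by apply/funext => j; rewrite gE /c1 /= (proj1 (ha j)) mulrC.
  have cE2 : c2 (g q) = fun j => (Num.sqrt (ph1 q j ^+ 2 + ph2 q j ^+ 2))^-1 * ph2 q j.
    by apply/funext => j; rewrite gE /c2 /= (proj2 (ha j)) mulrC.
  rewrite gE in cE1 cE2; split.
    split=> // j; rewrite cE1 cE2.
    rewrite /rel_re -!mulrA -mulrDr mulr_gt0//; exact: re0.
  by rewrite hE /cr cE1 cE2 corr_scale// -/(qcorr a0 q) /= (cmulV Ka).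
Qed.

Lemma sl_stab u v : sl_dom u -> stab K f v ->
  sl_dom (pr (tact (sl u) v)) /\ sl (pr (tact (sl u) v)) = tact (sl u) v.
Proof.
move=> Uu [Kv v1]; have uv := subtorus_cunit Kv.
apply: sl_unique.
- by apply: level_X_tact Kv; exact: sl_level.
- exact: xv_sl_tact.
move=> j; have [-> ->] := ph_sl_tact u j uv.
have [-> ->] := v1 j; rewrite mulr1 mulr0; split=> //.
exact: ph1_sl_gt0.
Qed.

(** On the slice the distinguished coordinate at each [f j] is a positive real, so comparing moduli
    and then phases of the two sides makes [a] and [b] agree there. *)
Lemma sl_orbit_stab u u' a b : sl_dom u -> sl_dom u' -> tset K a -> tset K b ->
  tact (sl u) a = tact (sl u') b -> stab K f (cmul a (cinv b)).
Proof.
move=> Uu Uu' Ka Kb e; have [ua ub] := (subtorus_cunit Ka, subtorus_cunit Kb).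
split=> [|j]; first by apply: subtorusM Ka _; exact: subtorusV.
have [e1 e2] := ph_sl_tact u j ua.
have [e1' e2'] := ph_sl_tact u' j ub.
rewrite e e1' in e1; rewrite e e2' in e2.
have t0 := ph1_sl_gt0 j Uu; have t0' := ph1_sl_gt0 j Uu'.
move: e1 e2 t0 t0'; set t := ph1 (sl u) j; set t' := ph1 (sl u') j => e1 e2 t0 t0'.
have tt : t = t'.
  apply/eqP; rewrite -(@eqrXn2 _ 2) ?ltW//; apply/eqP.
  by rewrite -[LHS]mulr1 -(ua (f j)) -[RHS]mulr1 -(ub (f j)) !mulrDr -!exprMn e1 e2.
rewrite tt in e1 e2; have t1 : t' != 0 by rewrite gt_eqF.
by apply: cmul_cinv_at => //; apply: (mulfI t1).
Qed.

Lemma sl_is_slice : exists (G : finGroupType) (act : G -> E -> E) (j : G -> Cn R N),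
  is_slice XX K sl_dom act j sl.
Proof.
have [G [j [ji jS jsurj j1 jM]]] := finite_group_of_set (stab_finite hB fB) (stab1 K f)
  (@stabM _ _ _ K f) (@stabV _ _ _ K f) (@cmulA R N) (@cmul1 R N)
  (fun a (Sa : stab K f a) => etrans (cmulC _ _) (cmulV (proj1 Sa))).
have Kj g : tset K (j g) by case: (jS g).
have uj g : cunit (j g) by exact: subtorus_cunit.
have oU := open_sl_dom.
have sm := Cinf_on_sl.
(* By [sl_stab] a stabilizer element maps the slice to itself, and [pr] reads off the new
   parameter. *)
exists G, (fun g u => pr (tact (sl u) (j g))), j; split.
- exact: oU.
- by move=> g u Uu; case: (sl_stab Uu (jS g)).
- move=> g; apply: (Cinf_smooth_on oU (g := fun u => pr (tactU (sl u) (j g)))) => //.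
    apply: (Cinf_on_linl (L := pr)) => //; first by apply: findim_continuous; exact: findim_Hn.
    by apply: Cinf_on_tactU => //; exact: Cinf_on_cst.
  by move=> u _; rewrite -(tactE (sl u) (uj g)).
- by move=> u _; rewrite j1 tact1; exact: (pr_sl u).
- move=> g h u Uu; have [_ ->] := sl_stab Uu (jS h).
  by rewrite tactM jM (cmulC (j g)).
- exact: (Cinf_smooth_on oU _ sm).
- by move=> u Uu; exact: sl_level.
- exact: ji.
- exact: Kj.
- exact: jM.
- exact: sl_local_diffeo.
move=> x y a b Ux Uy Ka Kb; split=> [e|[g -> ->]]; last first.
  by have [_ ->] := sl_stab Ux (jS g); rewrite tactM.
have Sv := sl_orbit_stab Ux Uy Ka Kb e; have [g gE] := jsurj _ Sv; exists g; last first.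
  by rewrite gE -cmulA (cmulC (cinv b)) (cmulV Kb) cmulC cmul1.
have := congr1 (fun q => tact q (cinv b)) e; rewrite /= (tact_cinv _ Kb) tactM -gE => ->.
exact: esym (pr_sl y).
Qed.

End XSlice.

Section XSlices.
Variables (R : realType) (N d : nat) (K : subtorus R N) (B : 'M[R]_(d, N)).
Variable alpha : 'rV[R]_d.
Hypothesis hB : lie_basis K B.
Hypothesis reg : regular_value (hk_moment B) (alpha, 0).

Local Notation E := 'rV[R]_(4 * N - 4 * d).

Lemma level_X_slices q : level_X B alpha 0 q ->
  exists (U : set E) (G : finGroupType) (act : G -> E -> E) (j : G -> Cn R N) (s : E -> Hn R N),
    is_slice (level_X B alpha 0) K U act j s /\
    exists x u, [/\ U x, tset K u & q = tact (s x) u].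
Proof.
move=> Xq; have [f [f_inj f0 fB]] := regular_minor reg (proj1 Xq).
have [pr [em [em0 empr prem]]] := split_coordinates R f_inj.
(* The sign of x tells which of z, w is certainly nonzero at [f j], hence which one is to be made
   positive. *)
pose sg j := 0 < xv q 0 (f j).
have hx j : 0 < sgn (sg j) (xv q 0 (f j)).
  rewrite /sgn /sg; case: ifP => // /negbT; rewrite -leNgt oppr_gt0 => h.
  by rewrite lt_neqAle f0.
have fE : findim E by exact: findim_mx.
have [G [act [j S]]] := sl_is_slice alpha hB f_inj fB sg fE em0 empr prem.
exists (sl_dom B alpha f sg em), G, act, j, (sl B alpha f sg em); split=> //.
pose n k := Num.sqrt (ph1 f sg q k ^+ 2 + ph2 f sg q k ^+ 2).
have ex k : exists th : R, cos (2 * trigo.pi * th) = ph1 f sg q k / n k /\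
    sin (2 * trigo.pi * th) = ph2 f sg q k / n k.
  apply: unit_angle; have n0 := ph_norm_gt0 (hx k).
  rewrite !exprMn !exprVn -mulrDl sqr_sqrtr ?ltW// divff// gt_eqF//.
have [th hth] := choice ex.
(* An element of K with the phases of [q] at the chosen coordinates; undoing it moves [q] into the
   slice. *)
pose a := texp (lift_angle B f (\row_k th k)).
have Ka : tset K a by exact: lift_angle_K.
have ha k : a.1 0 (f k) = ph1 f sg q k / n k /\ a.2 0 (f k) = ph2 f sg q k / n k.
  by rewrite /a !cn_simp lift_angle_f// mxE.
have [Uq slq] := rotate_sl f_inj fB em0 empr Xq Ka hx ha.
exists (pr (tact q (cinv a))), a; split=> //.
by rewrite slq (tact_cinvK q Ka).
Qed.

End XSlices.

Theorem proposition4p9 (R : realType) (N d : nat) (K : subtorus R N)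
    (B : 'M[R]_(d, N)) (alpha : 'rV[R]_d) :
  lie_basis K B ->
  regular_value (hk_moment B) (alpha, 0) ->
  orbifold_diffeomorphic (L_atlas K B alpha)
    (prod_orbiatlas (Cn R d) (X_atlas K B alpha 0)) /\
  homotopy_equivalent R (X_space K B alpha 0) (L_space K B alpha).
Proof.
move=> hB reg; split; first by apply: triv_orbifold => // q; exact: level_X_slices.
have fc := @triv_map_continuous R N d K B alpha reg.
have fc' := @triv_inv_continuous R N d K B alpha reg.
exact: (homotopy_equivalent_prod fc fc' (triv_mapK reg) (triv_invK reg)).
Qed.
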